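(* Let $n\ge 1$ and $r\ge 0$ be integers and let $I=\{1,2,\dots,n,\overline{n},\overline{n-1},\dots,\overline{1}\}$. Then the Macdonald polynomials of types $C_n$ and $D_n$ attached to a single row $(r)$ satisfy \begin{align*} P_{(r)}^{(C_n)}\big(x;q,t,t^2/q\big)={}&\frac{(q;q)_r}{(t;q)_r}\sum_{\theta_1+\theta_2+\cdots+\theta_{\overline{1}}=r}\ \prod_{k\in I}\frac{(t;q)_{\theta_k}}{(q;q)_{\theta_k}}\\ &\times\prod_{1\le l\le n}\frac{(t^{n-l+1}q^{\theta_l+\cdots+\theta_{\overline{l+1}}};q)_{\theta_{\overline{l}}}\,(t^{n-l+2}q^{\theta_{l+1}+\cdots+\theta_{\overline{l+1}}-1};q)_{\theta_{\overline{l}}}}{(t^{n-l+2}q^{\theta_l+\cdots+\theta_{\overline{l+1}}-1};q)_{\theta_{\overline{l}}}\,(t^{n-l+1}q^{\theta_{l+1}+\cdots+\theta_{\overline{l+1}}};q)_{\theta_{\overline{l}}}}\ x_1^{\theta_1-\theta_{\overline{1}}}x_2^{\theta_2-\theta_{\overline{2}}}\cdots x_n^{\theta_n-\theta_{\overline{n}}} \end{align*} and \begin{align*} P_{(r)}^{(D_n)}(x;q,t)={}&\frac{(q;q)_r}{(t;q)_r}\sum_{\substack{\theta_1+\theta_2+\cdots+\theta_{\overline{1}}=r\\ \theta_n\theta_{\overline{n}}=0}}\ \prod_{k\in I}\frac{(t;q)_{\theta_k}}{(q;q)_{\theta_k}}\\ &\times\prod_{1\le l\le n-1}\frac{(t^{n-l-1}q^{\theta_l+\theta_{l+1}+\cdots+\theta_{\overline{l+1}}+1};q)_{\theta_{\overline{l}}}\,(t^{n-l}q^{\theta_{l+1}+\theta_{l+2}+\cdots+\theta_{\overline{l+1}}};q)_{\theta_{\overline{l}}}}{(t^{n-l}q^{\theta_l+\theta_{l+1}+\cdots+\theta_{\overline{l+1}}};q)_{\theta_{\overline{l}}}\,(t^{n-l-1}q^{\theta_{l+1}+\theta_{l+2}+\cdots+\theta_{\overline{l+1}}+1};q)_{\theta_{\overline{l}}}}\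 x_1^{\theta_1-\theta_{\overline{1}}}x_2^{\theta_2-\theta_{\overline{2}}}\cdots x_n^{\theta_n-\theta_{\overline{n}}}. \end{align*} In both sums $(\theta_k)_{k\in I}$ runs over families of nonnegative integers with the indicated constraints.
   Context: Notation. $(z;q)_k=\prod_{i=0}^{k-1}(1-q^iz)$ for $k\ge 0$. The parameters $q,t,T$ are generic complex numbers with $|q|<1$ (or indeterminates). Sums in exponents: $\theta_1+\theta_2+\cdots+\theta_{\overline{1}}$ means $\sum_{k\in I}\theta_k$. For $1\le l\le n$, $\theta_l+\cdots+\theta_{\overline{l+1}}=\sum_{k=l}^{n}\theta_k+\sum_{k=l+1}^{n}\theta_{\overline{k}}$ and $\theta_{l+1}+\cdots+\theta_{\overline{l+1}}=\sum_{k=l+1}^{n}(\theta_k+\theta_{\overline{k}})$; empty sums are $0$ (so for $l=n$ these are $\theta_n$ and $0$). Macdonald polynomials. Let $x=(x_1,\dots,x_n)$. For parameters $(a,b,c,d,q,t)$ put $\alpha=(abcdq^{-1})^{1/2}$ and let $\mathcal{D}_x=\mathcal{D}_x(a,b,c,d|q,t)$ be Koornwinder's $q$-difference operator \begin{align*} \mathcal{D}_x={}&\sum_{i=1}^n\frac{(1-ax_i)(1-bx_i)(1-cx_i)(1-dx_i)}{\alpha t^{n-1}(1-x_i^2)(1-qx_i^2)}\prod_{j\ne i}\frac{(1-tx_ix_j)(1-tx_i/x_j)}{(1-x_ix_j)(1-x_i/x_j)}(T_{q,x_i}-1)\\ &+\sum_{i=1}^n\frac{(1-a/x_i)(1-b/x_i)(1-c/x_i)(1-d/x_i)}{\alpha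 t^{n-1}(1-1/x_i^2)(1-q/x_i^2)}\prod_{j\ne i}\frac{(1-tx_j/x_i)(1-t/x_ix_j)}{(1-x_j/x_i)(1-1/x_ix_j)}(T_{q^{-1},x_i}-1), \end{align*} where $T_{q^{\pm1},x_i}$ replaces $x_i$ by $q^{\pm1}x_i$. For a partition $\lambda=(\lambda_1\ge\cdots\ge\lambda_n\ge 0)$ the Koornwinder polynomial $P_\lambda(x;a,b,c,d,q,t)$ is the unique Laurent polynomial, invariant under $S_n\ltimes(\mathbb{Z}/2\mathbb{Z})^n$ (permutations of the $x_i$ and inversions $x_i\mapsto x_i^{-1}$), such that (a) $P_\lambda=m_\lambda+{}$(linear combination of $m_\mu$ with $\mu<\lambda$), where $m_\lambda$ is the sum of the distinct monomials in the $S_n\ltimes(\mathbb{Z}/2\mathbb{Z})^n$-orbit of $x^\lambda$ and $\mu\le\lambda$ means $\mu_1+\cdots+\mu_i\le\lambda_1+\cdots+\lambda_i$ for all $i$; (b) $\mathcal{D}_xP_\lambda=d_\lambda P_\lambda$ with $d_\lambda=\sum_{j=1}^n\big(\alpha t^{n-j}q^{\lambda_j}+\alpha^{-1}t^{-(n-j)}q^{-\lambda_j}-\alpha t^{n-j}-\alpha^{-1}t^{-(n-j)}\big)$. The Macdonald polynomials of types $C_n$ and $D_n$ are $$P^{(C_n)}_\lambda(x;q,t,T)=P_\lambda\big(x;-T^{1/2},T^{1/2},-q^{1/2}T^{1/2},q^{1/2}T^{1/2},q,t\big),\qquad P^{(D_n)}_\lambda(x;q,t)=P_\lambda\big(x;-1,1,-q^{1/2},q^{1/2},q,t\big),$$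 with $\alpha=T$ and $\alpha=1$ respectively, and $(r)$ denotes the partition $(r,0,\dots,0)$. *)

(* Defs.v *)
From mathcomp Require Import all_boot all_order all_algebra all_fingroup.
From mathcomp Require Import finmap monalg.

Set Implicit Arguments.
Unset Strict Implicit.
Unset Printing Implicit Defensive.

Import GRing.Theory.
Local Open Scope ring_scope.

(* q and t are algebraically independent over the prime field: no nonzero
   F(t)(q) with integer coefficients vanishes (outer variable t, inner q).
   On constant polynomials this already forces characteristic 0. *)
Definition generic (K : fieldType) (q t : K) : Prop :=
  forall F : {poly {poly int}}, F != 0 ->
    (map_poly (map_poly intr) F).[t%:P].[q] != 0.

(* (z;q)_k *)
Definition qpoch (K : fieldType) (q z : K) (k : nat) : K :=
  \prod_(i < k) (1 - q ^+ i * z).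

(** * Laurent polynomials in x_0, ..., x_{n-1} *)

(* Finite K-linear combinations of exponent vectors; << c *g m >> is c x^m. *)
Definition laurent (K : fieldType) (n : nat) := {malg K[{ffun 'I_n -> int}]}.

Definition leval (K : fieldType) (n : nat) (P : laurent K n)
    (x : {ffun 'I_n -> K}) : K :=
  \sum_(m <- msupp P) P@_m * \prod_(i < n) x i ^ m i.

(* Exponents of the monomial obtained from x^m by x_i |-> x_{s^-1 i}
   composed with x_i |-> x_i^-1 for those i such that e i. *)
Definition hyp_act (n : nat) (w : {perm 'I_n} * {ffun 'I_n -> bool})
    (m : {ffun 'I_n -> int}) : {ffun 'I_n -> int} :=
  [ffun i => (-1) ^+ w.2 i * m (w.1 i)].

Definition hyp_invariant (K : fieldType) (n : nat) (P : laurent K n) : Prop :=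
  forall (w : {perm 'I_n} * {ffun 'I_n -> bool}) (m : {ffun 'I_n -> int}),
    P@_(hyp_act w m) = P@_m.

(** * Partitions with at most n parts *)

Definition is_partition (n : nat) (la : {ffun 'I_n -> nat}) : Prop :=
  forall i j : 'I_n, (i <= j)%N -> (la j <= la i)%N.

Definition dominated (n : nat) (mu la : {ffun 'I_n -> nat}) : Prop :=
  forall i : 'I_n, (\sum_(j < n | j <= i) mu j <= \sum_(j < n | j <= i) la j)%N.

Definition row_partition (n r : nat) : {ffun 'I_n -> nat} :=
  [ffun i : 'I_n => if i == 0%N :> nat then r else 0%N].

(* The orbit is listed without repetition, so each monomial occurs once. *)
Definition orbit_sum (K : fieldType) (n : nat) (la : {ffun 'I_n -> nat}) :
    laurent K n :=
  let la_int : {ffun 'I_n -> int} := [ffun i => (la i)%:Z] in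
  \sum_(m <- undup [seq hyp_act w la_int
                   | w : {perm 'I_n} * {ffun 'I_n -> bool}])
    << (1 : K) *g m >>.

(** * Koornwinder polynomials *)

Definition scale_var (K : fieldType) (n : nat) (c : K) (i : 'I_n)
    (x : {ffun 'I_n -> K}) : {ffun 'I_n -> K} :=
  [ffun j => if j == i then c * x j else x j].

(* The points at which no denominator of the operator below vanishes. *)
Definition regular_point (K : fieldType) (n : nat) (q : K)
    (x : {ffun 'I_n -> K}) : Prop :=
  (forall i, [/\ x i != 0, 1 - x i ^+ 2 != 0, 1 - q * x i ^+ 2 != 0
               & 1 - q / x i ^+ 2 != 0]) /\
  (forall i j, j != i -> 1 - x i * x j != 0 /\ 1 - x i / x j != 0).

(* alpha is the chosen square root of a b c d / q. *)
Definition koornwinder_op (K : fieldType) (n : nat) (a b c d q t alpha : K)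
    (f : {ffun 'I_n -> K} -> K) (x : {ffun 'I_n -> K}) : K :=
  \sum_(i < n)
     (1 - a * x i) * (1 - b * x i) * (1 - c * x i) * (1 - d * x i)
     / (alpha * t ^+ (n - 1) * (1 - x i ^+ 2) * (1 - q * x i ^+ 2))
     * (\prod_(j < n | j != i)
          ((1 - t * x i * x j) * (1 - t * x i / x j)
           / ((1 - x i * x j) * (1 - x i / x j))))
     * (f (scale_var q i x) - f x)
  + \sum_(i < n)
     (1 - a / x i) * (1 - b / x i) * (1 - c / x i) * (1 - d / x i)
     / (alpha * t ^+ (n - 1) * (1 - 1 / x i ^+ 2) * (1 - q / x i ^+ 2))
     * (\prod_(j < n | j != i)
          ((1 - t * x j / x i) * (1 - t / (x i * x j))
           / ((1 - x j / x i) * (1 - 1 / (x i * x j)))))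
     * (f (scale_var q^-1 i x) - f x).

(* n - j.+1 because j is counted from 0. *)
Definition koornwinder_eigenvalue (K : fieldType) (n : nat) (q t alpha : K)
    (la : {ffun 'I_n -> nat}) : K :=
  \sum_(j < n)
     (alpha * t ^+ (n - j.+1) * q ^+ la j
      + alpha^-1 * t ^- (n - j.+1) * q ^- la j
      - alpha * t ^+ (n - j.+1)
      - alpha^-1 * t ^- (n - j.+1)).

(* The eigenvalue equation is an identity of rational functions in x; for
   generic q and t the field K is infinite, so that it amounts to equality at
   all points of K^n where both sides are defined. *)
Definition is_koornwinder (K : fieldType) (n : nat) (a b c d q t alpha : K)
    (la : {ffun 'I_n -> nat}) (P : laurent K n) : Prop :=
  [/\ hyp_invariant P,
      exists (s : seq {ffun 'I_n -> nat}) (u : {ffun 'I_n -> nat} -> K),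
        (forall mu, mu \in s ->
           [/\ is_partition mu, dominated mu la & mu <> la]) /\
        P = orbit_sum K la + \sum_(mu <- s) u mu *: orbit_sum K mu
    & forall x : {ffun 'I_n -> K}, regular_point q x ->
        koornwinder_op a b c d q t alpha (leval P) x
        = koornwinder_eigenvalue q t alpha la * leval P x].

(* rq and rT are square roots of q and T. *)
Definition is_macdonaldC (K : fieldType) (n : nat) (q t T rq rT : K)
    (la : {ffun 'I_n -> nat}) (P : laurent K n) : Prop :=
  is_koornwinder (- rT) rT (- (rq * rT)) (rq * rT) q t T la P.

Definition is_macdonaldD (K : fieldType) (n : nat) (q t rq : K)
    (la : {ffun 'I_n -> nat}) (P : laurent K n) : Prop :=
  is_koornwinder (-1) 1 (- rq) rq q t 1 la P.

(** * The explicit sums *)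

(* Families indexed by I: [inl k] is the index k+1 of I and [inr k] its barred
   version.  Entries of a family with sum r are at most r. *)
Definition row_family (n r : nat) := {ffun 'I_n + 'I_n -> 'I_r.+1}.

Section Families.
Variables (n r : nat) (th : row_family n r).

Definition th_sum : nat := (\sum_(k : 'I_n + 'I_n) th k)%N.

(* theta_l + ... + theta_{bar(l+1)} *)
Definition th_from (l : 'I_n) : nat :=
  (\sum_(k < n | l <= k) th (inl k) + \sum_(k < n | l < k) th (inr k))%N.

(* theta_{l+1} + ... + theta_{bar(l+1)} *)
Definition th_after (l : 'I_n) : nat :=
  (\sum_(k < n | l < k) (th (inl k) + th (inr k)))%N.

Definition th_exponent : {ffun 'I_n -> int} :=
  [ffun k => (th (inl k))%:Z - (th (inr k))%:Z].

(* theta_n theta_{bar n} = 0 *)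
Definition th_last_zero : bool :=
  [forall k : 'I_n, (k.+1 == n) ==> (th (inl k) * th (inr k) == 0)%N].

Variables (K : fieldType) (q t : K).

Definition th_weight : K :=
  \prod_(k : 'I_n + 'I_n) (qpoch q t (th k) / qpoch q q (th k)).

(* The l-th factors, with l.+1 in the role of l. *)
Definition factorC (l : 'I_n) : K :=
  (qpoch q (t ^+ (n - l.+1 + 1) * q ^+ th_from l) (th (inr l))
   * qpoch q (t ^+ (n - l.+1 + 2) * q ^ ((th_after l)%:Z - 1)) (th (inr l)))
  / (qpoch q (t ^+ (n - l.+1 + 2) * q ^ ((th_from l)%:Z - 1)) (th (inr l))
     * qpoch q (t ^+ (n - l.+1 + 1) * q ^+ th_after l) (th (inr l))).

(* Used for l.+1 < n only, so that the subtraction of 1 is exact. *)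
Definition factorD (l : 'I_n) : K :=
  (qpoch q (t ^+ (n - l.+1 - 1) * q ^+ (th_from l + 1)) (th (inr l))
   * qpoch q (t ^+ (n - l.+1) * q ^+ th_after l) (th (inr l)))
  / (qpoch q (t ^+ (n - l.+1) * q ^+ th_from l) (th (inr l))
     * qpoch q (t ^+ (n - l.+1 - 1) * q ^+ (th_after l + 1)) (th (inr l))).

End Families.

Definition row_sumC (K : fieldType) (n r : nat) (q t : K) : laurent K n :=
  (qpoch q q r / qpoch q t r) *:
  \sum_(th : row_family n r | th_sum th == r)
    << th_weight th q t * \prod_(l < n) factorC th q t l *g th_exponent th >>.

Definition row_sumD (K : fieldType) (n r : nat) (q t : K) : laurent K n :=
  (qpoch q q r / qpoch q t r) *:
  \sum_(th : row_family n r | (th_sum th == r) && th_last_zero th)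
    << th_weight th q t * \prod_(l < n | (l.+1 < n)%N) factorD th q t l
       *g th_exponent th >>.

(* Main.v *)
(* The right-hand sides are row polynomials Q_r(x_1,...,x_n), up to the factor
   (q;q)_r/(t;q)_r; splitting off theta_1 and theta_(bar 1) gives a branching rule
   from n to n - 1 variables.  Let
     G(u) = h(u) prod_i (t x_i u)_oo (t u/x_i)_oo / ((x_i u)_oo (u/x_i)_oo),
   where h is an explicit series in u^2 independent of x.  The branching rule and
   Watson's transformation give, by induction on n,
     G(u) = sum_R Q_R(x) psi_R(u),   psi_R(u) = u^R (1 + O(u^2)),
   with psi_R an explicit series.  A partial fraction argument turns Koornwinder's
   operator acting on G in x into a q-difference operator in u, which is diagonal
   on the psi_R.  Since the psi_R are linearly independent, every Q_R is an
   eigenfunction; likewise Q_R inherits the hyperoctahedral symmetry of G.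
   For uniqueness, let x tend to infinity along a curve with
   x_1 >> x_2 >> ... >> x_n >> 1: the leading exponent m of an eigenfunction
   determines its eigenvalue, which differs from that of (r) as soon as every
   |m_i| is less than r. *)

(* Types C and D differ only in a constant [tau]: every factor of both formulas is [branch_weight]
   at [c] and [t * c / q], where c = t^m q^N tau, m is the number of variables present and N is the
   degree in all of them but the first. The one exception is the last variable in type D.

   The series h compensates for the two values of T: once the kernel is multiplied by it, the two
   shift coefficients of its q-difference equation in u agree in both types up to constants, so that
   a single family psi_R serves both.

   K is a bare field, hence nothing converges. With x fixed, series in u are formal, and the
   operator identity is checked at all but finitely many values of u before it is read as an
   identity of Taylor expansions. The limit of large x is likewise the value at 0 of a rational
   function of one parameter. *)
From HB Require Import structures.
Require Import Defs.
From mathcomp Require Import all_boot all_order all_algebra all_fingroup.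
From mathcomp Require Import finmap monalg.
From mathcomp Require Import ring zify.
From mathcomp Require boolp.

Set Implicit Arguments.
Unset Strict Implicit.
Unset Printing Implicit Defensive.

Import GRing.Theory.
Local Open Scope ring_scope.

(* Closes the nonvanishing conditions left by [field] by matching each of them
   with a hypothesis, up to [ring] and sign. *)
Ltac nz1 :=
  first [ assumption | exact: oner_neq0 |
  match goal with
  | H : is_true (?x != 0) |- is_true (?y != 0) =>
      have -> : y = x by ring
  end; assumption |
  match goal with
  | H : is_true (?x != 0) |- is_true (?y != 0) =>
      have -> : y = - x by ring
  end; rewrite oppr_eq0; assumption ].
Ltac nz := rewrite ?oppr_eq0; repeat (apply/andP; split); nz1.

(* [lia] is slow in contexts with many hypotheses on field elements. *)
Ltac nlia :=
  repeat match goal with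
  | H : is_true (leq _ _) |- _ => revert H
  | H : is_true (negb (odd _)) |- _ => revert H
  | H : is_true (negb (leq _ _)) |- _ => revert H
  | H : @eq ?T _ _ |- _ => unify T nat; revert H
  | H : @eq bool _ _ |- _ => revert H
  end; clear; intros; lia.

(** * Basic hypergeometric summations *)

Section QSeries.
Variables (K : fieldType) (q : K).
Hypothesis q0 : q != 0.
Local Notation qp := (qpoch q).

Lemma qpoch0 z : qp z 0 = 1.
Proof. by rewrite /qpoch big_ord0. Qed.

Lemma qpochS z k : qp z k.+1 = qp z k * (1 - q ^+ k * z).
Proof. by rewrite /qpoch big_ord_recr. Qed.

Lemma qpochSl z k : qp z k.+1 = (1 - z) * qp (q * z) k.
Proof.
rewrite /qpoch big_ord_recl expr0 mul1r; congr (_ * _).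
by apply: eq_bigr => i _; rewrite /= /bump add1n exprSr mulrA.
Qed.

Lemma qpochD z m k : qp z (m + k) = qp z m * qp (q ^+ m * z) k.
Proof.
elim: k => [|k IH]; first by rewrite addn0 qpoch0 mulr1.
by rewrite addnS !qpochS IH exprD; ring.
Qed.

Lemma qpoch_neq0 z k :
  (forall i, (i < k)%N -> 1 - q ^+ i * z != 0) -> qp z k != 0.
Proof. by move=> h; rewrite /qpoch prodf_seq_neq0; apply/allP=> i _ /=; exact: h. Qed.

Lemma qpoch1_eq0 k : qp 1 k.+1 = 0.
Proof. by rewrite qpochSl subrr mul0r. Qed.

Lemma qpoch_invX_eq0 k j : (k < j)%N -> qp (q ^- k) j = 0.
Proof.
move=> kj; rewrite -(subnKC kj) qpochD qpochS mulfV ?expf_neq0 //.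
by rewrite subrr mulr0 mul0r.
Qed.

Section Saalschutz.
Variables (a B C : K).
Hypothesis a0 : a != 0.
(** The balancing condition: the summand below belongs to a 3phi2 of argument q with upper
    parameters a q^k, q^(-k), g and lower parameters B, C, and B C is q times the product of the
    upper ones. *)
Let g := B * C / (a * q).

Definition saal_term k j :=
  qp (a * q ^+ k) j * qp (q ^- k) j * qp g j * q ^+ j
  / (qp q j * qp B j * qp C j).

(** The quotient of the closed forms in [saalschutz] at [k.+1] and at [k]. *)
Let ratio k := (1 - a * q ^+ k.+1 / B) * (1 - a * q ^+ k.+1 / C) * g
  / ((1 - B * q ^+ k) * (1 - C * q ^+ k)).

(* Certificate of the WZ method. *)
Let cert k j := (1 - a * q ^+ k * q ^+ k.+1)
  / ((1 - a * q ^+ k) * (1 - B * q ^+ k) * (1 - C * q ^+ k))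
  * (1 - a * q ^+ k * q ^+ j) * (1 - g * q ^+ j) / q ^+ j * saal_term k j.

Let saal_termS k j : saal_term k j.+1 = saal_term k j *
  ((1 - q ^+ j * (a * q ^+ k)) * (1 - q ^+ j * q ^- k) * (1 - q ^+ j * g) * q
   / ((1 - q ^+ j * q) * (1 - q ^+ j * B) * (1 - q ^+ j * C))).
Proof.
rewrite /saal_term !qpochS (exprSr q j) !invfM; ring.
Qed.

(** Both indices are raised together, so that (q^(-k-1))_(j+1) is a scalar multiple of (q^(-k))_j.
    Raising [k] alone would mean dividing by 1 - q^(j-k-1), which vanishes at j = k + 1. *)
Let saal_termSS k j : 1 - a * q ^+ k != 0 ->
  saal_term k.+1 j.+1 = saal_term k j *
  ((1 - q ^+ j * (a * q ^+ k)) * (1 - q ^+ j.+1 * (a * q ^+ k)) / (1 - a * q ^+ k)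
   * (1 - q ^- k.+1) * (1 - q ^+ j * g) * q
   / ((1 - q ^+ j * q) * (1 - q ^+ j * B) * (1 - q ^+ j * C))).
Proof.
move=> ak; rewrite /saal_term.
have -> : qp (a * q ^+ k.+1) j.+1 = qp (a * q ^+ k) j *
  ((1 - q ^+ j * (a * q ^+ k)) * (1 - q ^+ j.+1 * (a * q ^+ k)) / (1 - a * q ^+ k)).
  apply: (mulfI ak).
  have -> : a * q ^+ k.+1 = q * (a * q ^+ k) by rewrite exprS; ring.
  rewrite -qpochSl !qpochS; field.
  by rewrite ak.
have -> : qp (q ^- k.+1) j.+1 = (1 - q ^- k.+1) * qp (q ^- k) j.
  by rewrite qpochSl exprS invfM mulrA mulfV // mul1r.
rewrite !qpochS (exprSr q j) !invfM; ring.
Qed.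

(** The q-Pfaff-Saalschuetz sum. Both sides obey the same first-order recurrence in [k]; for the
    left side this is the telescoping of a WZ pair. *)
Lemma saalschutz k :
  (forall i, (i < k)%N -> 1 - a * q ^+ i != 0) ->
  (forall i, (i < k)%N -> 1 - q ^+ i * q != 0) ->
  (forall i, (i < k)%N -> 1 - q ^+ i * B != 0) ->
  (forall i, (i < k)%N -> 1 - q ^+ i * C != 0) ->
  B != 0 -> C != 0 ->
  \sum_(j < k.+1) saal_term k j =
  qp (a * q / B) k * qp (a * q / C) k / (qp B k * qp C k) * g ^+ k.
Proof.
move=> ha hq hB hC B0 C0.
elim: k ha hq hB hC => [|k IH] ha hq hB hC.
  by rewrite big_ord_recl big_ord0 /saal_term !qpoch0 !expr0; field; rewrite oner_eq0.
have ltkS i : (i < k)%N -> (i < k.+1)%N by apply: ltnW.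
have {}IH := IH (fun i h => ha i (ltkS i h)) (fun i h => hq i (ltkS i h))
                (fun i h => hB i (ltkS i h)) (fun i h => hC i (ltkS i h)).
have ak := ha _ (ltnSn k); have Bk := hB _ (ltnSn k); have Ck := hC _ (ltnSn k).
have qk0 : q ^+ k != 0 by rewrite expf_neq0.
have telescope m : (m <= k.+1)%N ->
    \sum_(j < m.+1) (saal_term k.+1 j - ratio k * saal_term k j) = cert k m.
  elim: m => [|m IHm] mk.
    rewrite big_ord_recl big_ord0 /cert /saal_term !qpoch0 !expr0 /ratio /g !exprS.
    move: qk0 ak Bk Ck; set u := q ^+ k => qk0 ak Bk Ck.
    by field; nz.
  rewrite big_ord_recr /= IHm 1?ltnW // /cert (saal_termSS m ak) (saal_termS k m) /ratio /g.
  have qm := hq _ mk; have Bm := hB _ mk; have Cm := hC _ mk.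
  have qm0 : q ^+ m != 0 by rewrite expf_neq0.
  rewrite !exprS.
  move: (saal_term k m) qk0 ak Bk Ck qm0 qm Bm Cm.
  set u := q ^+ k; set x := q ^+ m => s qk0 ak Bk Ck qm0 qm Bm Cm.
  by field; nz.
have /eqP := telescope _ (leqnn _).
(* The boundary term contains (q^(-k))_(k+1), whose last factor is 0. *)
have -> : cert k k.+1 = 0.
  by rewrite /cert /saal_term qpoch_invX_eq0 // !(mulr0, mul0r).
rewrite sumrB subr_eq0 => /eqP ->.
rewrite -mulr_sumr big_ord_recr /= IH [saal_term k _]/saal_term qpoch_invX_eq0 //.
rewrite !(mulr0, mul0r) addr0 /ratio !qpochS (exprSr g) !exprS !invfM !mulrA.
by rewrite (mulrC C) (mulrC B (q^+k)); ring.
Qed.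

End Saalschutz.

Section VeryWellPoised.
Variables (a b c : K).
Hypotheses (a0 : a != 0) (b0 : b != 0) (c0 : c != 0).
Hypothesis hq : forall i, 1 - q ^+ i * q != 0.
Hypothesis ha : forall i, 1 - q ^+ i * (a * q) != 0.
Hypothesis hb : forall i, 1 - q ^+ i * (a * q / b) != 0.
Hypothesis hc : forall i, 1 - q ^+ i * (a * q / c) != 0.

(** The summand of the 6phi5 without its very-well-poised factor (1 - a q^(2k)) / (1 - a). The
    numerator of that factor is restored in [vwp_sum] and its denominator is cleared. *)
Let y L k := qp a k * qp b k * qp c k * qp (q ^- L) k
  / (qp q k * qp (a * q / b) k * qp (a * q / c) k * qp (a * q * q ^+ L) k)
  * (a * q * q ^+ L / (b * c)) ^+ k.

Let yS L k : y L k.+1 = y L k *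
  ((1 - q ^+ k * a) * (1 - q ^+ k * b) * (1 - q ^+ k * c) * (1 - q ^+ k * q ^- L)
   / ((1 - q ^+ k * q) * (1 - q ^+ k * (a * q / b)) * (1 - q ^+ k * (a * q / c))
      * (1 - q ^+ k * (a * q * q ^+ L))) * (a * q * q ^+ L / (b * c))).
Proof. rewrite /y !qpochS (exprSr _ k) !invfM; ring. Qed.

Let ySS L k : y L.+1 k.+1 = y L k *
  ((1 - q ^+ k * a) * (1 - q ^+ k * b) * (1 - q ^+ k * c) * (1 - q ^- L.+1)
   / ((1 - q ^+ k * q) * (1 - q ^+ k * (a * q / b)) * (1 - q ^+ k * (a * q / c))
      * (1 - q ^+ k * (a * q * q ^+ L)) * (1 - q ^+ k.+1 * (a * q * q ^+ L)))
   * (1 - a * q * q ^+ L) * q ^+ k * (a * q * q ^+ L.+1 / (b * c))).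
Proof.
have hL : 1 - a * q * q ^+ L != 0 by rewrite mulrC; exact: ha.
have hLS : 1 - q ^+ k.+1 * (a * q * q ^+ L) != 0.
  have -> : q ^+ k.+1 * (a * q * q ^+ L) = q ^+ (k.+1 + L) * (a * q).
    by rewrite exprD; ring.
  exact: ha.
rewrite /y; set D := a * q * q ^+ L in hL hLS *.
have -> : a * q * q ^+ L.+1 = q * D by rewrite /D exprS; ring.
have -> : qp (q * D) k.+1 = qp D k * ((1 - q ^+ k * D) * (1 - q ^+ k.+1 * D) / (1 - D)).
  by apply: (mulfI hL); rewrite -qpochSl !qpochS; field; nz.
have -> : qp (q ^- L.+1) k.+1 = (1 - q ^- L.+1) * qp (q ^- L) k.
  by rewrite qpochSl exprS invfM mulrA mulfV // mul1r.
have -> : (q * D / (b * c)) ^+ k.+1 = (D / (b * c)) ^+ k * q ^+ k * (q * D / (b * c)).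
  by rewrite exprSr -!mulrA exprMn (mulrC (q ^+ k)) !mulrA.
rewrite !qpochS !invfM invrK; ring.
Qed.

Let ratio L := (1 - a * q * q ^+ L) * (1 - a * q * q ^+ L / (b * c))
  / ((1 - a * q * q ^+ L / b) * (1 - a * q * q ^+ L / c)).

Let cert L k := (1 - a * q * q ^+ L)
  / ((1 - a * q * q ^+ L / b) * (1 - a * q * q ^+ L / c))
  * (a * q * q ^+ L / (b * c)) * (1 - a * q ^+ k) * (1 - b * q ^+ k) * (1 - c * q ^+ k)
  / (1 - a * q * q ^+ L * q ^+ k) * y L k.

(* The terminating summation of a very-well-poised 6phi5. *)
Lemma vwp_sum L :
  \sum_(k < L.+1) (1 - a * q ^+ (2 * k)) * y L k =
  (1 - a) * (qp (a * q) L * qp (a * q / (b * c)) L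
             / (qp (a * q / b) L * qp (a * q / c) L)).
Proof.
have hb' i : b - a * q * q ^+ i != 0.
  have -> : b - a * q * q ^+ i = b * (1 - q ^+ i * (a * q / b)) by field; nz.
  by rewrite mulf_neq0.
have hc' i : c - a * q * q ^+ i != 0.
  have -> : c - a * q * q ^+ i = c * (1 - q ^+ i * (a * q / c)) by field; nz.
  by rewrite mulf_neq0.
elim: L => [|L IH].
  rewrite big_ord_recl big_ord0 /y !qpoch0 muln0 !expr0 !mulr1.
  by field; nz.
have hbL := hb' L; have hcL := hc' L.
have haL : 1 - a * q * q ^+ L != 0 by rewrite mulrC; exact: ha.
have telescope m : (m <= L.+1)%N ->
    \sum_(k < m.+1) ((1 - a * q ^+ (2 * k)) * y L.+1 k
      - ratio L * ((1 - a * q ^+ (2 * k)) * y L k)) = cert L m.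
  elim: m => [|m IHm] mL.
    rewrite big_ord_recl big_ord0 /cert /y !qpoch0 muln0 !expr0 /ratio.
    move: hbL hcL haL; set u := q ^+ L => hbL hcL haL.
    by field; nz.
  rewrite big_ord_recr /= IHm 1?ltnW // /cert (ySS L m) (yS L m) /ratio.
  have qm := hq m; have bm := hb' m; have cm := hc' m.
  have haLm : 1 - a * q * q ^+ L * q ^+ m != 0.
    have -> : a * q * q ^+ L * q ^+ m = q ^+ (L + m) * (a * q) by rewrite exprD; ring.
    exact: ha.
  have haLm' : 1 - a * q * q ^+ L * q ^+ m * q != 0.
    have -> : a * q * q ^+ L * q ^+ m * q = q ^+ (L + m).+1 * (a * q).
      by rewrite exprSr exprD; ring.
    exact: ha.
  have qm0 : q ^+ m != 0 by rewrite expf_neq0.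
  have qL0 : q ^+ L != 0 by rewrite expf_neq0.
  rewrite mulnS exprD expr2 (mulnC 2) exprM !exprS.
  move: (y L m) qm0 qL0 qm bm cm haLm haLm' hbL hcL haL.
  set u := q ^+ L; set x := q ^+ m => s qm0 qL0 qm bm cm haLm haLm' hbL hcL haL.
  by field; nz.
have /eqP := telescope _ (leqnn _).
have yL : y L L.+1 = 0 by rewrite /y qpoch_invX_eq0 // !(mulr0, mul0r).
have -> : cert L L.+1 = 0 by rewrite /cert yL mulr0.
rewrite sumrB subr_eq0 => /eqP ->.
rewrite -mulr_sumr big_ord_recr /= IH yL mulr0 addr0 /ratio !qpochS.
have com x : q ^+ L * (a * q / x) = a * q * q ^+ L / x by ring.
rewrite !com (mulrC (q ^+ L)) !invfM; ring.
Qed.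
End VeryWellPoised.

End QSeries.

Lemma sum_triangle (V : nmodType) (n : nat) (F : nat -> nat -> V) :
  \sum_(k < n.+1) \sum_(j < k.+1) F k j =
  \sum_(j < n.+1) \sum_(s < (n - j).+1) F (j + s)%N j.
Proof.
transitivity (\sum_(k < n.+1) \sum_(j < n.+1 | (j <= k)%N) F k j).
  apply: eq_bigr => k _.
  by rewrite (big_ord_widen_cond n.+1 xpredT (fun j => F k j)) //; apply: ltn_ord.
rewrite (exchange_big_dep xpredT) //=; apply: eq_bigr => j _.
rewrite -(big_mkord (fun s => xpredT s && (j <= s)%N) (fun s => F s j)).
rewrite -big_nat_widenl // -{1}[nat_of_ord j]add0n big_addn subSn ?big_mkord; last by rewrite -ltnS.
by apply: eq_bigr => s _; rewrite addnC.
Qed.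

Section Watson.
Variables (K : fieldType) (q : K).
Hypothesis q0 : q != 0.
Hypothesis hq : forall i, 1 - q ^+ i * q != 0.
Local Notation qp := (qpoch q).

(** The last j factors of (x)_k, read backwards, are those of (q^(1-k) / x)_j up to a sign and
    powers of q and x. The product form avoids dividing by the latter symbol. *)
Lemma qpoch_sub x k j : x != 0 -> (j <= k)%N ->
  qp (q / x * q ^- k) j * qp x (k - j) =
  (-1) ^+ j * q ^+ 'C(j, 2) * (q / x) ^+ j / q ^+ (k * j) * qp x k.
Proof.
move=> x0; elim: j => [|j IH] jk.
  by rewrite muln0 !expr0 subn0 qpoch0 divr1 !mul1r.
have := IH (ltnW jk).
have -> : (k - j = (k - j.+1).+1)%N by rewrite subnSK.
rewrite !qpochS; set u := (k - j.+1)%N => E.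
have qu0 : q ^+ u != 0 by rewrite expf_neq0.
have qj0 : q ^+ j != 0 by rewrite expf_neq0.
have qkj0 : q ^+ (k * j) != 0 by rewrite expf_neq0.
have -> : q ^+ j * (q / x * q ^- k) = (q ^+ u * x)^-1.
  rewrite -[in LHS](subnK jk) -/u exprD exprS; field; nz.
have -> : 'C(j.+1, 2) = (j + 'C(j, 2))%N by rewrite binS bin1 addnC.
have -> : (k * j.+1 = k * j + (u.+1 + j))%N by rewrite mulnS addnC addSnnS subnK.
transitivity (- (q ^+ u * x)^-1
  * (qp (q / x * q ^- k) j * (qp x u * (1 - q ^+ u * x)))).
  by field; nz.
by rewrite E !exprS !exprD !exprS; field; nz.
Qed.

Lemma qpoch_invX k j : (j <= k)%N ->
  qp (q ^- k) j * qp q (k - j) = (-1) ^+ j * q ^+ 'C(j, 2) / q ^+ (k * j) * qp q k.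
Proof.
by move=> jk; have := qpoch_sub q0 jk; rewrite divff // mul1r expr1n mulr1.
Qed.

(** In a quotient the signs and the powers of q from the two reversals cancel. This turns sums over
    k - j into standard hypergeometric sums over j. *)
Lemma qpoch_sub_ratio x y k j : x != 0 -> y != 0 -> (j <= k)%N ->
  qp y k != 0 -> qp (q / x * q ^- k) j != 0 ->
  qp x (k - j) / qp y (k - j) =
  qp x k / qp y k * (qp (q / y * q ^- k) j / qp (q / x * q ^- k) j) * (y / x) ^+ j.
Proof.
move=> x0 y0 jk pyk px.
have := qpoch_sub x0 jk; have := qpoch_sub y0 jk.
have py : qp y (k - j) != 0.
  by apply: contraNneq pyk => py; rewrite -(subnK jk) qpochD py mul0r.
have xj0 : x ^+ j != 0 by rewrite expf_neq0.
have yj0 : y ^+ j != 0 by rewrite expf_neq0.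
rewrite !exprMn !exprVn; set Z := (-1) ^+ j * _.
have Z0 : Z != 0 by rewrite mulf_neq0 ?expf_neq0 // oppr_eq0 oner_neq0.
have qj0 : q ^+ j != 0 by rewrite expf_neq0.
have qkj0 : q ^+ (k * j) != 0 by rewrite expf_neq0.
move: (qp x (k - j)) (qp y (k - j)) (qp x k) (qp y k) (qp (q / x * q ^- k) j)
  (qp (q / y * q ^- k) j) pyk px py => X' Y' X Y A B pyk px py EY EX.
have -> : X' = Z * (q ^+ j * x ^- j) / q ^+ (k * j) * X / A by rewrite -EX; field.
have -> : B = Z * (q ^+ j * y ^- j) / q ^+ (k * j) * Y / Y' by rewrite -EY; field.
by field; nz.
Qed.

Variables (a b c d e : K).
Hypotheses (a0 : a != 0) (b0 : b != 0) (c0 : c != 0) (d0 : d != 0) (e0 : e != 0).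
Hypothesis ha : forall i, 1 - q ^+ i * a != 0.
Hypothesis hb : forall i, 1 - q ^+ i * (a * q / b) != 0.
Hypothesis hc : forall i, 1 - q ^+ i * (a * q / c) != 0.
Hypothesis hd : forall i, 1 - q ^+ i * (a * q / d) != 0.
Hypothesis he : forall i, 1 - q ^+ i * (a * q / e) != 0.

(* Watson's transformation of a terminating very-well-poised 8phi7 into a
   balanced 4phi3.  The first three factors on the left are expanded by the
   q-Saalschutz formula, and the inner sum is then a very-well-poised 6phi5. *)
Lemma watson L :
  \sum_(k < L.+1) (1 - a * q ^+ (2 * k)) *
    (qp a k * qp b k * qp c k * qp d k * qp e k * qp (q ^- L) k
     / (qp q k * qp (a * q / b) k * qp (a * q / c) k * qp (a * q / d) k
        * qp (a * q / e) k * qp (a * q * q ^+ L) k)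
     * (a * q / (b * c) * (a * q * q ^+ L / (d * e))) ^+ k) =
  (1 - a) * (qp (a * q) L * qp q L / (qp (a * q / d) L * qp (a * q / e) L))
  * \sum_(j < L.+1)
      (qp (a * q / (b * c)) j * qp d j * qp e j
       / (qp q j * qp (a * q / b) j * qp (a * q / c) j)
       * (qp (a * q / (d * e)) (L - j) / qp q (L - j)) * (a * q / (d * e)) ^+ j).
Proof.
have pq k : qp q k != 0 by apply: qpoch_neq0.
have pb k : qp (a * q / b) k != 0 by apply: qpoch_neq0.
have pc k : qp (a * q / c) k != 0 by apply: qpoch_neq0.
have pd k : qp (a * q / d) k != 0 by apply: qpoch_neq0.
have pe k : qp (a * q / e) k != 0 by apply: qpoch_neq0.
have haX i m : 1 - q ^+ i * (a * q ^+ m) != 0.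
  have -> : q ^+ i * (a * q ^+ m) = q ^+ (i + m) * a by rewrite exprD; ring.
  exact: ha.
have aq i : 1 - a * q ^+ i != 0 by rewrite mulrC.
have aq0 i : a * q ^+ i != 0 by rewrite mulf_neq0 ?expf_neq0.
set g := a * q / (b * c); set x := a * q / (d * e).
have g0 : g != 0 by rewrite /g mulf_neq0 ?invr_eq0 ?mulf_neq0.
pose G j := qp g j * q ^+ j / (qp q j * qp (a * q / b) j * qp (a * q / c) j).
have expand k : qp b k * qp c k / (qp (a * q / b) k * qp (a * q / c) k) * g ^+ k =
    \sum_(j < k.+1) qp (a * q ^+ k) j * qp (q ^- k) j * G j.
  have := @saalschutz K q q0 a (a * q / b) (a * q / c) a0 k.
  have -> : a * q / (a * q / b) = b by field; nz.
  have -> : a * q / (a * q / c) = c by field; nz.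
  have -> : a * q / b * (a * q / c) / (a * q) = g by rewrite /g; field; nz.
  move=> <- //; first last.
  - by rewrite mulf_neq0 ?invr_eq0 ?mulf_neq0.
  - by rewrite mulf_neq0 ?invr_eq0 ?mulf_neq0.
  apply: eq_bigr => j _; rewrite /saal_term /G.
  have -> : a * q / b * (a * q / c) / (a * q) = g by rewrite /g; field; nz.
  ring.
pose D k := qp a k * qp d k * qp e k * qp (q ^- L) k
  / (qp q k * qp (a * q / d) k * qp (a * q / e) k * qp (a * q * q ^+ L) k)
  * (a * q * q ^+ L / (d * e)) ^+ k.
transitivity (\sum_(k < L.+1) \sum_(j < k.+1)
    (1 - a * q ^+ (2 * k)) * D k * (qp (a * q ^+ k) j * qp (q ^- k) j * G j)).
  apply: eq_bigr => k _; rewrite -mulr_sumr -expand /D exprMn !invfM; ring.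
rewrite (sum_triangle L (fun k j => (1 - a * q ^+ (2 * k)) * D k *
  (qp (a * q ^+ k) j * qp (q ^- k) j * G j))) mulr_sumr.
apply: eq_bigr => -[j /= jL] _; rewrite ltnS in jL.
pose sg : K := (-1) ^+ j * q ^+ 'C(j, 2).
(* The exponents collected by reversing (q^(-k))_j and (q^(-L))_j match through 2 C(j, 2) + j =
   j^2. *)
have sg2 : sg * sg * q ^+ j = q ^+ (j * j).
  rewrite /sg mulrACA -exprD addnn -mul2n exprM sqrrN !expr1n mul1r -!exprD.
  congr (q ^+ _); elim: (j) => // i IHi; rewrite binS bin1; nlia.
have qj0 : q ^+ j != 0 by rewrite expf_neq0.
have qjj0 : q ^+ (j * j) != 0 by rewrite expf_neq0.
pose X := a * q * q ^+ L / (d * e).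
have qLmj0 : q ^+ (L - j) != 0 by rewrite expf_neq0.
have qLj : q ^+ L = q ^+ (L - j) * q ^+ j by rewrite -exprD subnK.
pose C := G j * qp a (2 * j) * qp d j * qp e j * qp (q ^- L) j * (sg / q ^+ (j * j))
  / (qp (a * q / d) j * qp (a * q / e) j * qp (a * q * q ^+ L) j) * X ^+ j.
(* For fixed j the sum over s = k - j is again very-well-poised, with a, d, e, L replaced by a
   q^(2j), d q^j, e q^j, L - j; [C] collects what does not depend on s. *)
pose a' := a * q ^+ (2 * j); pose d' := d * q ^+ j; pose e' := e * q ^+ j.
have q2j : q ^+ (2 * j) = q ^+ j * q ^+ j by rewrite mul2n -addnn exprD.
have ad' : a' * q / d' = q ^+ j * (a * q / d) by rewrite /a' /d' q2j; field; nz.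
have ae' : a' * q / e' = q ^+ j * (a * q / e) by rewrite /a' /e' q2j; field; nz.
have aL' : a' * q * q ^+ (L - j) = q ^+ j * (a * q * q ^+ L).
  by rewrite /a' q2j qLj; ring.
have ade' : a' * q / (d' * e') = x by rewrite /a' /d' /e' /x q2j; field; nz.
have qL' : q ^- (L - j) = q ^+ j * q ^- L by rewrite qLj; field; nz.
have pL i m : qp (q ^+ i * (a * q * q ^+ L)) m != 0.
  apply: qpoch_neq0 => l _.
  have -> : q ^+ l * (q ^+ i * (a * q * q ^+ L)) = q ^+ (l + i + L).+1 * a.
    by rewrite exprSr !exprD; ring.
  exact: ha.
have pjd m : qp (q ^+ j * (a * q / d)) m != 0.
  by apply: qpoch_neq0 => i _; rewrite mulrA -exprD.
have pje m : qp (q ^+ j * (a * q / e)) m != 0.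
  by apply: qpoch_neq0 => i _; rewrite mulrA -exprD.
transitivity (C * \sum_(s < (L - j).+1) (1 - a' * q ^+ (2 * s)) *
   (qp a' s * qp d' s * qp e' s * qp (q ^- (L - j)) s
    / (qp q s * qp (a' * q / d') s * qp (a' * q / e') s * qp (a' * q * q ^+ (L - j)) s)
    * (a' * q * q ^+ (L - j) / (d' * e')) ^+ s)).
  rewrite mulr_sumr; apply: eq_bigr => -[s /= _] _.
  have -> : a * q ^+ (2 * (j + s)) = a' * q ^+ (2 * s) by rewrite mulnDr exprD mulrA.
  set V := 1 - _.
  have E1 : qp a (j + s) * qp (a * q ^+ (j + s)) j = qp a (2 * j) * qp a' s.
    rewrite /a' (mulrC a) (mulrC a) -!qpochD; congr (qp _ _); nlia.
  have E2 : qp (q ^- (j + s)) j / qp q (j + s) = sg / q ^+ (j * j) / q ^+ (s * j) / qp q s.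
    have := @qpoch_invX (j + s) j (leq_addr _ _); rewrite addKn -/sg => E.
    have qsj0 : q ^+ (s * j) != 0 by rewrite expf_neq0.
    have pqs := pq s; have pqjs := pq (j + s)%N.
    apply: (mulIf pqs); rewrite mulrAC E mulnDl exprD; field; nz.
  have E3 : X ^+ (j + s) / q ^+ (s * j) = X ^+ j * (a' * q * q ^+ (L - j) / (d' * e')) ^+ s.
    rewrite exprD mulnC exprM -mulrA; congr (_ * _).
    rewrite -exprVn -exprMn; congr (_ ^+ _).
    by rewrite /X qLj /a' /d' /e' q2j; field; nz.
  rewrite /D -/X aL' ad' ae' qL' /C /d' /e' (mulrC d) (mulrC e).
  rewrite !(qpochD q _ j s).
  transitivity (V * (qp a (j + s) * qp (a * q ^+ (j + s)) j)
    * (qp (q ^- (j + s)) j / qp q (j + s)) * X ^+ (j + s) *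
    (qp d j * qp (q ^+ j * d) s * (qp e j * qp (q ^+ j * e) s)
    * (qp (q ^- L) j * qp (q ^+ j * q ^- L) s) * G j) /
    (qp (a * q / d) j * qp (q ^+ j * (a * q / d)) s *
    (qp (a * q / e) j * qp (q ^+ j * (a * q / e)) s) *
    (qp (a * q * q ^+ L) j * qp (q ^+ j * (a * q * q ^+ L)) s))).
    by rewrite (qpochD q a) (qpochD q q); rewrite !invfM; ring.
  rewrite E1 E2.
  transitivity (V * (qp a (2 * j) * qp a' s)
    * (sg / q ^+ (j * j) / qp q s) * (X ^+ (j + s) / q ^+ (s * j)) *
    (qp d j * qp (q ^+ j * d) s * (qp e j * qp (q ^+ j * e) s)
    * (qp (q ^- L) j * qp (q ^+ j * q ^- L) s) * G j) /
    (qp (a * q / d) j * qp (q ^+ j * (a * q / d)) s *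
    (qp (a * q / e) j * qp (q ^+ j * (a * q / e)) s) *
    (qp (a * q * q ^+ L) j * qp (q ^+ j * (a * q * q ^+ L)) s))).
    by ring.
  rewrite E3 aL' /d' /e' (mulrC d) (mulrC e) !invfM; ring.
rewrite vwp_sum //; last first.
- by move=> i; rewrite ae' mulrA -exprD.
- by move=> i; rewrite ad' mulrA -exprD.
- move=> i; have -> : q ^+ i * (a' * q) = q ^+ (i + 2 * j).+1 * a.
    by rewrite /a' exprSr exprD; ring.
  exact: ha.
- by rewrite mulf_neq0.
- by rewrite mulf_neq0.
rewrite ade' ad' ae'.
have E4 : qp a (2 * j) * ((1 - a') * qp (a' * q) (L - j))
    = (1 - a) * qp (a * q) L * qp (a * q * q ^+ L) j.
  rewrite (mulrC a' q) -qpochSl (mulrC (a * q)) -mulrA -qpochD (mulrC a q) -qpochSl.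
  rewrite /a' (mulrC a) -qpochD; congr (qp _ _); nlia.
have E5 := qpoch_invX jL; rewrite -/sg in E5.
have E6 : qp (a * q / d) L = qp (a * q / d) j * qp (q ^+ j * (a * q / d)) (L - j).
  by rewrite -qpochD subnKC.
have E7 : qp (a * q / e) L = qp (a * q / e) j * qp (q ^+ j * (a * q / e)) (L - j).
  by rewrite -qpochD subnKC.
have {}E5 : qp (q ^- L) j = sg / q ^+ (L * j) * qp q L / qp q (L - j).
  by rewrite -E5 mulfK.
have E8 : X ^+ j = x ^+ j * q ^+ (L * j) by rewrite exprM -exprMn; congr (_ ^+ _); rewrite /X /x; ring.
have qLj0 : q ^+ (L * j) != 0 by rewrite expf_neq0.
transitivity ((qp a (2 * j) * ((1 - a') * qp (a' * q) (L - j))) *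
  (G j * qp d j * qp e j * qp (q ^- L) j * (sg / q ^+ (j * j)) * X ^+ j
   * qp x (L - j) / qp (a * q * q ^+ L) j)
   / ((qp (a * q / d) j * qp (q ^+ j * (a * q / d)) (L - j)) *
      (qp (a * q / e) j * qp (q ^+ j * (a * q / e)) (L - j)))).
  by rewrite /C !invfM; ring.
rewrite E4 -E6 -E7 E5 E8 /G -sg2.
have sg0 : sg != 0 by rewrite mulf_neq0 ?expf_neq0 // oppr_eq0 oner_neq0.
have h0 := pL 0%N j; rewrite expr0 mul1r in h0.
move: (pd L) (pe L) (pq j) (pb j) (pc j) (pq (L - j)%N) h0 => h1 h2 h3 h4 h5 h6 h0.
by field; nz.
Qed.
End Watson.

(** * The branching coefficients *)

Section Branching.
Variables (K : fieldType) (q t : K).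
Hypotheses (q0 : q != 0) (t0 : t != 0).
Hypothesis hq : forall i, 1 - q ^+ i * q != 0.
Hypothesis ht : forall i j, q ^+ j - q ^+ i * t != 0.
Local Notation qp := (qpoch q).

Definition row_coef (k : nat) : K := qp t k / qp q k.

(* [z] stands for [t * c / q]. *)
Definition branch_coef (c z : K) (a b : nat) : K :=
  qp c (a + b) / (qp c a * qp c b) * (qp z a * qp z b / qp z (a + b)).

(** The coefficient of u^(2j) in the 2phi1 with upper parameters q / t and c, lower parameter t c
    and argument t^2 u^2 / q; times u^R it is psi_R. *)
Definition psi_coef (c : K) (j : nat) : K :=
  qp (q / t) j * qp c j / (qp q j * qp (t * c) j) * (t ^+ 2 / q) ^+ j.

Lemma branch_coefC c z a b : branch_coef c z a b = branch_coef c z b a.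
Proof.
by rewrite /branch_coef (addnC a) (mulrC (qp c a)) (mulrC (qp z a)).
Qed.

Let pq k : qp q k != 0. Proof. exact: qpoch_neq0. Qed.

Let htV i j : 1 - q ^+ i * (t * q ^- j) != 0.
Proof.
have qj0 : q ^+ j != 0 by rewrite expf_neq0.
have -> : 1 - q ^+ i * (t * q ^- j) = (q ^+ j - q ^+ i * t) / q ^+ j by field.
by rewrite mulf_neq0 ?invr_eq0.
Qed.

(** The coefficient form of one branching step. On the left stands [psi_coef] at c / t, that is,
    before a new variable is added, and on the right the same series at c shifted by the degree of
    the new terms. After reversing the summation, the left side is a balanced 4phi3 and the right
    side a very-well-poised 8phi7. *)
Lemma branching_identity c p p' :
  c != 0 -> (forall i, 1 - q ^+ i * c != 0) ->
  (forall i, 1 - q ^+ i * (t * c / q) != 0) ->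
  \sum_(j < (minn p p').+1) row_coef (p - j) * row_coef (p' - j) *
     (qp (q / t) j * qp (c / t) j / (qp q j * qp c j) * (t ^+ 2 / q) ^+ j) =
  \sum_(j < (minn p p').+1) row_coef (p - j) * row_coef (p' - j) *
     (branch_coef c (t * c / q) (p - j) (p' - j) * psi_coef (c * q ^+ (p + p' - 2 * j)) j).
Proof.
move=> c0 hc hz.
wlog le_pp : p p' / (p' <= p)%N => [W|].
  have [/W//|] := boolP (p' <= p)%N; rewrite -ltnNge => /ltnW/W.
  rewrite minnC (addnC p') => E.
  under eq_bigr do rewrite (mulrC (row_coef _)).
  by rewrite E; apply: eq_bigr => j _; rewrite branch_coefC (mulrC (row_coef _)).
rewrite (minn_idPr le_pp); set m := (p - p')%N; set L := p'.
set z := t * c / q.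
have zq : z * q = t * c by rewrite /z; field.
have z0 : z != 0 by rewrite /z !mulf_neq0 ?invr_eq0.
have pc k : qp c k != 0 by apply: qpoch_neq0.
have pz k : qp z k != 0 by apply: qpoch_neq0.
have pcX i k : qp (q ^+ i * c) k != 0.
  by apply: qpoch_neq0 => j _; rewrite mulrA -exprD.
have pzX i k : qp (q ^+ i * z) k != 0.
  by apply: qpoch_neq0 => j _; rewrite mulrA -exprD.
have pqX i k : qp (q ^+ i * q) k != 0.
  by apply: qpoch_neq0 => j _; rewrite mulrA -exprD.
have ptV k : qp (t * q ^- L) k != 0 by apply: qpoch_neq0.
have qm0 : q ^+ m != 0 by rewrite expf_neq0.
have qL0 : q ^+ L != 0 by rewrite expf_neq0.
have a0 : q ^+ m * z != 0 by rewrite mulf_neq0.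
have tm0 : q ^+ m * t != 0 by rewrite mulf_neq0.
have cm0 : q ^+ (m + L) * c != 0 by rewrite mulf_neq0 ?expf_neq0.
have zqm : q ^+ m * z * q = q ^+ m * (t * c) by rewrite -mulrA zq.
(* Watson's transformation is used with a = q^m z, b = z, c replaced by q^(m+L) c, d = t and e = q^m
   t; these equations evaluate the parameters it produces. *)
have e1 : q ^+ m * z * q / z = q ^+ m * q by field; nz.
have e2 : q ^+ m * z * q / (q ^+ (m + L) * c) = t * q ^- L.
  by rewrite zqm exprD; field; nz.
have e3 : q ^+ m * z * q / t = q ^+ m * c by rewrite zqm; field; nz.
have e4 : q ^+ m * z * q / (q ^+ m * t) = c by rewrite zqm; field; nz.
have e5 : q ^+ m * z * q / (z * (q ^+ (m + L) * c)) = q / c * q ^- L.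
  by rewrite exprD; field; nz.
have e6 : q ^+ m * z * q / (t * (q ^+ m * t)) = c / t by rewrite zqm; field; nz.
have e7 : q / c * q ^- L * (q ^+ m * z * q * q ^+ L / (t * (q ^+ m * t))) = q / t.
  by rewrite zqm; field; nz.
have haW i : 1 - q ^+ i * (q ^+ m * z) != 0 by rewrite mulrA -exprD.
have hbW i : 1 - q ^+ i * (q ^+ m * q) != 0 by rewrite mulrA -exprD.
have hdW i : 1 - q ^+ i * (q ^+ m * c) != 0 by rewrite mulrA -exprD.
have W : forall k, _ := watson q0 hq a0 z0 cm0 t0 tm0 haW _ _ _ _.
rewrite e1 e2 e3 e4 e5 e6 in W.
have {W} := W hbW (htV^~ L) hdW hc L; rewrite e7 => W.
(* With j replaced by L - j, the left summand is a constant times the 4phi3 summand. *)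
have cstL j : (j <= L)%N -> row_coef (m + j) * row_coef j *
   (qp (q / t) (L - j) * qp (c / t) (L - j) / (qp q (L - j) * qp c (L - j))
    * (t ^+ 2 / q) ^+ (L - j)) =
   row_coef m * qp (q / t) L / qp c L * (t ^+ 2 / q) ^+ L *
   (qp (q / c * q ^- L) j * qp t j * qp (q ^+ m * t) j /
    (qp q j * qp (q ^+ m * q) j * qp (t * q ^- L) j)
    * (qp (c / t) (L - j) / qp q (L - j)) * (c / t) ^+ j).
  move=> jL; have qt0 : q / t != 0 by rewrite mulf_neq0 ?invr_eq0.
  have tt0 : t ^+ 2 / q != 0 by rewrite mulf_neq0 ?invr_eq0 ?expf_neq0.
  have := @qpoch_sub_ratio K q q0 (q / t) c L j qt0 c0 jL (pc L).
  have -> : q / (q / t) = t by field; nz.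
  have -> : c / (q / t) = c * t / q by field; nz.
  move=> /(_ (ptV j)) E.
  have E2 : (t ^+ 2 / q) ^+ (L - j) = (t ^+ 2 / q) ^+ L / (t ^+ 2 / q) ^+ j.
    by rewrite -{2}(subnK jL) exprD mulfK // expf_neq0.
  have E3 : (c * t / q) ^+ j / (t ^+ 2 / q) ^+ j = (c / t) ^+ j.
    by rewrite -exprVn -exprMn; congr (_ ^+ _); field; nz.
  transitivity (row_coef (m + j) * row_coef j * (qp (q / t) (L - j) / qp c (L - j))
    * (qp (c / t) (L - j) / qp q (L - j)) * (t ^+ 2 / q) ^+ (L - j)).
    by rewrite !invfM; ring.
  rewrite E E2 -E3 /row_coef !qpochD !invfM; ring.
(* In the same way the right summand is a constant times the 8phi7 summand. *)
have cstR k : (k <= L)%N -> row_coef (m + k) * row_coef k *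
   (branch_coef c z (m + k) k * psi_coef (c * q ^+ (m + 2 * k)) (L - k)) =
   row_coef m * qp (q ^+ m * c) L / ((1 - q ^+ m * z) * qp (q ^+ m * z * q) L)
    * qp (q / t) L / qp q L * (t ^+ 2 / q) ^+ L *
   ((1 - q ^+ m * z * q ^+ (2 * k)) *
    (qp (q ^+ m * z) k * qp z k * qp (q ^+ (m + L) * c) k * qp t k *
     qp (q ^+ m * t) k * qp (q ^- L) k /
     (qp q k * qp (q ^+ m * q) k * qp (t * q ^- L) k * qp (q ^+ m * c) k *
      qp c k * qp (q ^+ m * z * q * q ^+ L) k) * (q / t) ^+ k)).
  move=> kL; have qt0 : q / t != 0 by rewrite mulf_neq0 ?invr_eq0.
  have tt0 : t ^+ 2 / q != 0 by rewrite mulf_neq0 ?invr_eq0 ?expf_neq0.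
  have := @qpoch_sub_ratio K q q0 (q / t) q L k qt0 q0 kL (pq L).
  have -> : q / (q / t) = t by field; nz.
  rewrite divff // mul1r => /(_ (ptV k)) E.
  have E2 : (t ^+ 2 / q) ^+ (L - k) = (t ^+ 2 / q) ^+ L / (t ^+ 2 / q) ^+ k.
    by rewrite -{2}(subnK kL) exprD mulfK // expf_neq0.
  have E3 : t ^+ k / (t ^+ 2 / q) ^+ k = (q / t) ^+ k.
    by rewrite -exprVn -exprMn; congr (_ ^+ _); field; nz.
  have E4 : qp c (m + k + k) * qp (c * q ^+ (m + 2 * k)) (L - k) =
      qp c m * qp (q ^+ m * c) L * qp (q ^+ (m + L) * c) k.
    rewrite (mulrC c (q ^+ (m + 2 * k))) -!qpochD.
    have -> : (m + k + k = m + 2 * k)%N by nlia.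
    by rewrite -qpochD; congr (qp _ _); nlia.
  (* The symbols (z)_(m+2k) and (q^(m+2k+1) z)_(L-k) lack exactly one factor to merge into a single
     symbol. That factor is the very-well-poised one. *)
  have E5 : qp z (m + k + k) * (1 - q ^+ m * z * q ^+ (2 * k)) *
       qp (t * (c * q ^+ (m + 2 * k))) (L - k) =
      qp z m * (1 - q ^+ m * z) * qp (q ^+ m * z * q) L * qp (q ^+ m * z * q * q ^+ L) k.
    have -> : t * (c * q ^+ (m + 2 * k)) = q ^+ (m + 2 * k).+1 * z.
      by rewrite mulrA -zq exprS; ring.
    have -> : q ^+ m * z * q ^+ (2 * k) = q ^+ (m + 2 * k) * z by rewrite exprD; ring.
    have -> : (m + k + k = m + 2 * k)%N by nlia.
    have -> : q ^+ m * z * q * q ^+ L = q ^+ (m.+1 + L) * z.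
      by rewrite exprD exprS; ring.
    have -> : q ^+ m * z * q = q ^+ m.+1 * z by rewrite exprS; ring.
    rewrite -!qpochS -!qpochD.
    by congr (qp _ _); nlia.
  have nz1 : 1 - q ^+ m * z * q ^+ (2 * k) != 0.
    have -> : q ^+ m * z * q ^+ (2 * k) = q ^+ (m + 2 * k) * z by rewrite exprD; ring.
    exact: hz.
  have nz2 : qp (t * (c * q ^+ (m + 2 * k))) (L - k) != 0.
    rewrite mulrA -zq -mulrA -exprS mulrC; exact: pzX.
  have nz3 : 1 - q ^+ m * z != 0 by exact: hz.
  have nz4 : qp (q ^+ m * z * q) L != 0.
    have -> : q ^+ m * z * q = q ^+ m.+1 * z by rewrite exprS; ring.
    exact: pzX.
  have nz5 : qp (q ^+ m * z * q * q ^+ L) k != 0.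
    have -> : q ^+ m * z * q * q ^+ L = q ^+ (m.+1 + L) * z by rewrite exprD exprS; ring.
    exact: pzX.
  transitivity (row_coef (m + k) * row_coef k * (qp z (m + k) * qp z k)
    / (qp c (m + k) * qp c k) * (qp (q / t) (L - k) / qp q (L - k))
    * (t ^+ 2 / q) ^+ (L - k) * (1 - q ^+ m * z * q ^+ (2 * k)) *
    (qp c (m + k + k) * qp (c * q ^+ (m + 2 * k)) (L - k)) /
    (qp z (m + k + k) * (1 - q ^+ m * z * q ^+ (2 * k)) *
       qp (t * (c * q ^+ (m + 2 * k))) (L - k))).
    have := pz (m + k + k)%N; have := pc (m + k)%N; have := pc k; have := pq (L - k)%N.
    rewrite /branch_coef /psi_coef => h1 h2 h3 h4; field; nz.
  rewrite E4 E5 E E2 -E3 /row_coef !qpochD.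
  have h1 := pz m; have h2 := pc m; have h3 := pc k; have h4 := pq m.
  have h5 := pq L; have h6 := pq k; have h7 := pqX m k; have h8 := pcX m k.
  have h9 := ptV k; have h10 : (t ^+ 2 / q) ^+ k != 0 by rewrite expf_neq0.
  move: ((t ^+ 2 / q) ^+ k) ((t ^+ 2 / q) ^+ L) (t ^+ k) h10 => u1 u2 u3 h10.
  field; nz.
have rev (F : nat -> nat -> nat -> K) : \sum_(j < L.+1) F j (p - j)%N (L - j)%N =
    \sum_(k < L.+1) F (L - k)%N (m + k)%N k.
  rewrite (reindex_inj rev_ord_inj) /=; apply: eq_bigr => -[k /= kL] _.
  by rewrite subSS subKn //; congr F; rewrite /m -/L; nlia.
pose F1 j u v := row_coef u * row_coef v *
     (qp (q / t) j * qp (c / t) j / (qp q j * qp c j) * (t ^+ 2 / q) ^+ j).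
pose F2 j u v := row_coef u * row_coef v *
     (branch_coef c z u v * psi_coef (c * q ^+ (p + L - 2 * j)) j).
rewrite (rev F1) (rev F2) /F1 /F2.
under eq_bigr => j _ do rewrite cstL -1?ltnS ?ltn_ord //.
under [RHS]eq_bigr => k _.
  have -> : (p + L - 2 * (L - k) = m + 2 * k)%N.
    by have := ltn_ord k; rewrite /m -/L; nlia.
  rewrite cstR -1?ltnS ?ltn_ord //.
  over.
rewrite -!mulr_sumr W.
have h1 := pc L; have h2 := pcX m L; have h3 := pq L; have h4 := haW 0%N.
rewrite expr0 mul1r in h4.
have h5 : qp (q ^+ m * z * q) L != 0.
  have -> : q ^+ m * z * q = q ^+ m.+1 * z by rewrite exprS; ring.
  exact: pzX.
by move: (\sum_(_ < _) _) => S; field; nz.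
Qed.

(* At [z = 1] the quotient of Pochhammer symbols in [branch_coef] is [0 / 0],
   to be read as [1] if [a] or [b] vanishes, and as [0] otherwise. *)
Definition branch_weight (c z : K) (a b : nat) : K :=
  if (a == 0)%N || (b == 0)%N then 1 else branch_coef c z a b.

Lemma branch_weightE c z a b :
  (forall i, 1 - q ^+ i * c != 0) -> (forall i, 1 - q ^+ i * z != 0) ->
  branch_weight c z a b = branch_coef c z a b.
Proof.
move=> hc hz; rewrite /branch_weight /branch_coef.
have pc k : qp c k != 0 by exact: qpoch_neq0.
have pz k : qp z k != 0 by exact: qpoch_neq0.
by case: a b => [|a] [|b] //=; rewrite ?addn0 ?add0n !qpoch0 ?mulr1 ?mul1r ?divff ?invr1 ?mulr1.
Qed.

Lemma branch_weight1 c a b : branch_weight c 1 a b = ((a == 0%N) || (b == 0%N))%:R.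
Proof.
rewrite /branch_weight /branch_coef; case: a b => [|a] [|b] //=.
by rewrite qpoch1_eq0 !mul0r mulr0.
Qed.

(** The case c = q / t of the branching step, where z = 1 and the symbols (z)_k in denominators
    vanish. On the left (q / t)_j cancels, so the 4phi3 drops to a balanced 3phi2, which Saalschuetz
    sums; on the right a single term remains. *)
Lemma branching_identity_z1 p p' :
  \sum_(j < (minn p p').+1) row_coef (p - j) * row_coef (p' - j) *
     (qp (q / t) j * qp (q / t / t) j / (qp q j * qp (q / t) j) * (t ^+ 2 / q) ^+ j) =
  \sum_(j < (minn p p').+1) row_coef (p - j) * row_coef (p' - j) *
     (branch_weight (q / t) 1 (p - j) (p' - j)
      * psi_coef (q / t * q ^+ (p + p' - 2 * j)) j).
Proof.
wlog le_pp : p p' / (p' <= p)%N => [W|].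
  have [/W//|] := boolP (p' <= p)%N; rewrite -ltnNge => /ltnW/W.
  rewrite minnC (addnC p') => E.
  under eq_bigr do rewrite (mulrC (row_coef _)).
  by rewrite E; apply: eq_bigr => j _; rewrite !branch_weight1 orbC (mulrC (row_coef _)).
rewrite (minn_idPr le_pp); set L := p'; set m := (p - L)%N.
have pE : p = (m + L)%N by rewrite subnK.
have qX0 i : q ^+ i != 0 by rewrite expf_neq0.
have hqt i j : 1 - q ^+ i * (q / t * q ^- j) != 0.
  have -> : 1 - q ^+ i * (q / t * q ^- j) = - (q ^+ i.+1 - q ^+ j * t) / (t * q ^+ j).
    by have := qX0 j; rewrite exprS => ?; field; nz.
  by rewrite mulf_neq0 ?invr_eq0 ?mulf_neq0 ?oppr_eq0.
have hqt0 i : 1 - q ^+ i * (q / t) != 0.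
  by have := hqt i 0%N; rewrite expr0 divr1.
have pqt k : qp (q / t) k != 0 by exact: qpoch_neq0.
have pt k : qp t k != 0.
  by apply: qpoch_neq0 => i _; have := ht i 0; rewrite expr0.
have pqtX k j : qp (q / t * q ^- j) k != 0 by exact: qpoch_neq0.
have qt0 : q / t != 0 by rewrite mulf_neq0 ?invr_eq0.
(* Only the last term of the right-hand side survives. *)
rewrite [RHS]big_ord_recr /= [X in _ = X + _]big1 ?add0r; last first.
  move=> -[j /= jL] _; rewrite branch_weight1.
  by rewrite (_ : _ || _ = false) ?mul0r ?mulr0 //; nlia.
rewrite branch_weight1 subnn eqxx orbT mul1r.
have -> : (p + L - 2 * L = m)%N by nlia.
have w_sub k j : (j <= k)%N -> row_coef (k - j) =
    row_coef k * (qp (q ^- k) j / qp (q / t * q ^- k) j) * (q / t) ^+ j.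
  move=> jk; rewrite /row_coef (qpoch_sub_ratio q0 t0 q0 jk) ?divff ?mul1r //.
(* With this [a] the parameter a q^L of [saalschutz] is q^(-p), the second terminating parameter. *)
pose a := q ^- (p + L); pose B := q / t * q ^- p; pose C := q / t * q ^- L.
have a0 : a != 0 by rewrite invr_eq0.
have gE : B * C / (a * q) = q / t / t.
  by rewrite /a /B /C exprD; have := qX0 p; have := qX0 L => ? ?; field; nz.
have aqL : a * q ^+ L = q ^- p.
  by rewrite /a exprD; have := qX0 p; have := qX0 L => ? ?; field; nz.
have aqB : a * q / B = t * q ^- L.
  by rewrite /a /B exprD; have := qX0 p; have := qX0 L => ? ?; field; nz.
have aqC : a * q / C = t * q ^- p.
  by rewrite /a /C exprD; have := qX0 p; have := qX0 L => ? ?; field; nz.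
have haL i : (i < L)%N -> 1 - a * q ^+ i != 0.
  move=> iL; have -> : a = q ^- i / q ^+ (p + L - i).-1.+1.
    rewrite -invfM -exprD /a; congr (_ ^-1); congr (_ ^+ _); nlia.
  have := hq (p + L - i).-1; rewrite exprSr; set u := q ^+ _ => hu.
  have u0 : u != 0 by exact: qX0.
  have -> : 1 - q ^- i / (u * q) * q ^+ i = - (1 - u * q) / (u * q).
    by have := qX0 i => ?; field; nz.
  by rewrite mulf_neq0 ?invr_eq0 ?mulf_neq0 ?oppr_eq0.
have := saalschutz q0 a0 haL (fun i _ => hq i) (fun i _ => hqt i p)
  (fun i _ => hqt i L) (mulf_neq0 qt0 (invr_neq0 (qX0 p)))
  (mulf_neq0 qt0 (invr_neq0 (qX0 L))).
rewrite -/B -/C aqB aqC gE => S.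
transitivity (row_coef p * row_coef L * \sum_(j < L.+1) saal_term q a B C L j).
  rewrite mulr_sumr; apply: eq_bigr => -[j /= jL] _; rewrite ltnS in jL.
  rewrite /saal_term gE aqL !w_sub // -/B; last by rewrite (leq_trans jL).
  rewrite -/C.
  have -> : (q / t) ^+ j = q ^+ j / t ^+ j by rewrite exprMn exprVn.
  have -> : (t ^+ 2 / q) ^+ j = t ^+ j * t ^+ j / q ^+ j.
    by rewrite exprMn exprVn -exprM mulnC exprM expr2.
  have h1 := qX0 j; have h2 := pqtX j p; have h3 := pqtX j L.
  have h4 : t ^+ j != 0 by rewrite expf_neq0.
  have h5 := pqt j; have h6 := pq j; rewrite -/B -/C in h2 h3 *.
  by field; nz.
rewrite S.
have E1 := @qpoch_sub_ratio K q q0 t (q / t) p L t0 qt0 le_pp (pqt p) (pqtX L p).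
have E2 := @qpoch_sub_ratio K q q0 t (q / t) L L t0 qt0 (leqnn L) (pqt L) (pqtX L L).
have ttq : q / (q / t) = t by field; nz.
rewrite ttq -/B -/C subnn !qpoch0 divr1 in E1 E2.
rewrite /psi_coef.
have -> : q / t * q ^+ m = q ^+ m * (q / t) by rewrite mulrC.
have -> : t * (q ^+ m * (q / t)) = q ^+ m * q by field.
have E3 : qp (q / t) p = qp (q / t) m * qp (q ^+ m * (q / t)) L by rewrite -qpochD -pE.
have E4 : qp q p = qp q m * qp (q ^+ m * q) L by rewrite -qpochD -pE.
have h1 := pqt m; have h2 := pt m; have h3 := pt p; have h4 := pqt L; have h5 := pt L.
have h6 := pqtX L p; have h7 := pqtX L L; have h8 := pqt p; have h9 := pq L.
have h10 := pq m; have h11 := pq p; rewrite -/B -/C in h6 h7.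
have g0 : q / t / t != 0 by rewrite mulf_neq0 ?invr_eq0.
have g0' : (q / t / t) ^+ L != 0 by rewrite expf_neq0.
have gL : (t ^+ 2 / q) ^+ L = (q / t / t) ^- L.
  by rewrite -exprVn; congr (_ ^+ _); field; nz.
rewrite -/m in E1.
have h12 : qp (q ^+ m * (q / t)) L != 0.
  by apply: qpoch_neq0 => i _; rewrite mulrA -exprD.
have h13 : qp (q ^+ m * q) L != 0 by apply: qpoch_neq0 => i _; rewrite mulrA -exprD.
rewrite gL -/m /row_coef !qpoch0 E4; rewrite E3 in E1.
move: (qp (t / q ^+ L) L) (qp (t / q ^+ p) L) E1 E2 => X1 X2.
move: ((q / t / t) ^+ L) g0' h1 h2 h3 h4 h5 h6 h7 h9 h10 h12 h13 => G G0.
move: (qp (q / t) m) (qp t m) (qp t p) (qp (q / t) L) (qp t L) (qp B L) (qp C L)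
  (qp q L) (qp q m) (qp (q ^+ m * (q / t)) L) (qp (q ^+ m * q) L).
move=> y1 y2 y3 y4 y5 y6 y7 y9 y10 y12 y13 h1 h2 h3 h4 h5 h6 h7 h9 h10 h12 h13 E1 E2.
have -> : X1 = y4 * y7 / (y5 * G).
  have -> : X1 = (y5 / y4 * (X1 / y7) * G) * (y4 * y7 / (y5 * G)) by field; nz.
  by rewrite -E2 mul1r.
have -> : X2 = (y2 / y1) * (y1 * y12 * y6 / (y3 * G)).
  by rewrite E1; field; nz.
by field; nz.
Qed.
End Branching.

(** * Formal power series in one variable *)

Record fps (K : fieldType) := Fps { fcoef :> nat -> K }.

Section PowerSeries.
Variable K : fieldType.
Implicit Types f g h : fps K.

(** Coefficient sequences have no decidable equality; the classical mixins provide the equality and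
    choice structures on which the ring structure is built. *)
HB.instance Definition _ := boolp.gen_eqMixin (fps K).
HB.instance Definition _ := boolp.gen_choiceMixin (fps K).

Lemma fpsP f g : (forall n, f n = g n) -> f = g.
Proof. by case: f g => f [g] /= /boolp.funext ->. Qed.

Definition fps_add f g := Fps (fun n => f n + g n).
Definition fps_opp f := Fps (fun n => - f n).
Definition fps_zero : fps K := Fps (fun => 0).

Fact fps_addA : associative fps_add.
Proof. by move=> f g h; apply: fpsP => n /=; rewrite addrA. Qed.
Fact fps_addC : commutative fps_add.
Proof. by move=> f g; apply: fpsP => n /=; rewrite addrC. Qed.
Fact fps_add0 : left_id fps_zero fps_add.
Proof. by move=> f; apply: fpsP => n /=; rewrite add0r. Qed.
Fact fps_addN : left_inverse fps_zero fps_opp fps_add.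
Proof. by move=> f; apply: fpsP => n /=; rewrite addNr. Qed.

HB.instance Definition _ :=
  GRing.isZmodule.Build (fps K) fps_addA fps_addC fps_add0 fps_addN.

Definition fps_mul f g := Fps (fun n => \sum_(i < n.+1) f i * g (n - i)%N).
Definition fps_of_poly (p : {poly K}) : fps K := Fps (fun n => p`_n).

(* Ring identities of power series are inherited from polynomials by truncation. *)
Let trunc N f : {poly K} := \poly_(i < N) f i.

Let fps_mul_trunc N f g n : (n < N)%N -> fps_mul f g n = (trunc N f * trunc N g)`_n.
Proof.
move=> nN; rewrite coefM; apply: eq_bigr => -[i /= iN] _.
by rewrite !coef_poly !(leq_ltn_trans _ nN) ?leq_subr // -ltnS.
Qed.

Let fps_mul_poly N f g (p r : {poly K}) :
  (forall n, (n < N)%N -> f n = p`_n) -> (forall n, (n < N)%N -> g n = r`_n) ->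
  forall n, (n < N)%N -> fps_mul f g n = (p * r)`_n.
Proof.
move=> hf hg n nN; rewrite coefM; apply: eq_bigr => -[i /= iN] _.
by rewrite hf ?hg // (leq_ltn_trans _ nN) ?leq_subr // -ltnS.
Qed.

Let truncE N f n : (n < N)%N -> f n = (trunc N f)`_n.
Proof. by move=> nN; rewrite coef_poly nN. Qed.

Fact fps_mulA : associative fps_mul.
Proof.
move=> f g h; apply: fpsP => n.
have T k := @truncE n.+1 k; have M := @fps_mul_poly n.+1.
rewrite (M _ _ _ _ (T f) (M _ _ _ _ (T g) (T h))) //.
by rewrite (M _ _ _ _ (M _ _ _ _ (T f) (T g)) (T h)) // mulrA.
Qed.

Fact fps_mulC : commutative fps_mul.
Proof.
by move=> f g; apply: fpsP => n; rewrite !(fps_mul_trunc _ _ (ltnSn n)) mulrC.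
Qed.

Fact fps_mul1 : left_id (fps_of_poly 1) fps_mul.
Proof.
move=> f; apply: fpsP => n.
by rewrite (fps_mul_poly (p := 1) _ (@truncE n.+1 f)) // mul1r -truncE.
Qed.

Fact fps_mulDl : left_distributive fps_mul fps_add.
Proof.
move=> f g h; apply: fpsP => n /=; rewrite -big_split /=.
by apply: eq_bigr => i _; rewrite mulrDl.
Qed.

Fact fps_one_neq0 : fps_of_poly 1 != fps_zero.
Proof. by apply/eqP => -[] /(congr1 (@^~ 0%N)) /eqP; rewrite coefC oner_eq0. Qed.

HB.instance Definition _ := GRing.Zmodule_isComNzRing.Build (fps K)
  fps_mulA fps_mulC fps_mul1 fps_mulDl fps_one_neq0.

Lemma fcoefD f g n : (f + g) n = f n + g n. Proof. by []. Qed.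
Lemma fcoefB f g n : (f - g) n = f n - g n. Proof. by []. Qed.
Lemma fcoef_sum (I : Type) (r : seq I) (P : pred I) (F : I -> fps K) n :
  (\sum_(i <- r | P i) F i) n = \sum_(i <- r | P i) F i n.
Proof. exact: (big_morph (fun f : fps K => f n)). Qed.

Lemma fcoefM f g n : (f * g) n = \sum_(i < n.+1) f i * g (n - i)%N.
Proof. by []. Qed.

Fact fps_of_poly_additive : zmod_morphism fps_of_poly.
Proof. by move=> p r; apply: fpsP => n /=; rewrite coefB. Qed.

Fact fps_of_poly_multiplicative : monoid_morphism fps_of_poly.
Proof. by split=> // p r; apply: fpsP => n /=; rewrite coefM. Qed.

HB.instance Definition _ := GRing.isZmodMorphism.Build {poly K} (fps K)
  fps_of_poly fps_of_poly_additive.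
HB.instance Definition _ := GRing.isMonoidMorphism.Build {poly K} (fps K)
  fps_of_poly fps_of_poly_multiplicative.

Lemma fps_mulI f g h : h 0%N != 0 -> f * h = g * h -> f = g.
Proof.
move=> h0 E; apply: fpsP; suff H n : (f - g) n = 0.
  by move=> n; apply/eqP; rewrite -subr_eq0 -fcoefB H.
have {}E : (f - g) * h = 0 by rewrite mulrBl E subrr.
move: (f - g) E => d E.
elim/ltn_ind: n => n IH; have := congr1 (fun u : fps K => u n) E.
rewrite fcoefM big_ord_recr /= subnn big1 ?add0r.
  by move/eqP; rewrite mulf_eq0 (negPf h0) orbF => /eqP.
by move=> -[i /= iN] _; rewrite IH ?mul0r.
Qed.

(** The substitution of c u for u; at c = q and 1 / q these are the shifts of the operator in u. *)
Definition dil (c : K) f : fps K := Fps (fun n => c ^+ n * f n).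

Fact dil_additive c : zmod_morphism (dil c).
Proof. by move=> f g; apply: fpsP => n /=; rewrite mulrBr. Qed.

Fact dil_multiplicative c : monoid_morphism (dil c).
Proof.
split=> [|f g]; apply: fpsP => n /=.
  by rewrite coefC; case: n => [|n] /=; rewrite ?mul1r ?mulr0.
rewrite mulr_sumr; apply: eq_bigr => -[i /= iN] _.
by rewrite -{1}(subnKC (iN : (i <= n)%N)) exprD; ring.
Qed.

HB.instance Definition _ c := GRing.isZmodMorphism.Build (fps K) (fps K)
  (dil c) (dil_additive c).
HB.instance Definition _ c := GRing.isMonoidMorphism.Build (fps K) (fps K)
  (dil c) (dil_multiplicative c).

Definition lin (c : K) : {poly K} := 1 - c *: 'X.

Lemma lin_eval c z : (lin c).[z] = 1 - c * z.
Proof. by rewrite /lin !hornerE. Qed.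

Lemma fcoef_lin c f n :
  (fps_of_poly (lin c) * f) n = f n - (if n is m.+1 then c * f m else 0).
Proof.
rewrite fcoefM; case: n => [|n]; rewrite big_ord_recl /= /lin.
  by rewrite big_ord0 !coefB coefZ coefX coefC mulr0 !subr0 mul1r addr0.
rewrite big_ord_recl /= big1 ?addr0 ?subn0.
  by rewrite !coefB !coefZ !coefX !coefC /= subn1 /=; ring.
move=> i _; rewrite !coefB coefZ coefX coefC /= /bump /= ?add1n.
by rewrite mulr0 subrr mul0r.
Qed.

End PowerSeries.

(** * Rational functions and their expansions *)

(** Identities of rational functions are stated off the zeros of a nonzero polynomial, because
    division in K is total and gives meaningless values at poles. *)
Definition generically (K : fieldType) (P : K -> Prop) : Prop :=
  exists2 w : {poly K}, w != 0 & forall z, w.[z] != 0 -> P z.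

Section Germs.
Variables (K : fieldType) (q : K).
Hypothesis qinj : injective (fun i => q ^+ i).

Lemma gen_imp (P Q : K -> Prop) :
  generically P -> (forall z, P z -> Q z) -> generically Q.
Proof. by case=> w w0 h PQ; exists w => // z /h/PQ. Qed.

Lemma gen_true (P : K -> Prop) : (forall z, P z) -> generically P.
Proof. by move=> h; exists 1; rewrite ?oner_neq0. Qed.

Lemma gen_and (P Q : K -> Prop) :
  generically P -> generically Q -> generically (fun z => P z /\ Q z).
Proof.
case=> v v0 hP [w w0 hQ]; exists (v * w); first by rewrite mulf_neq0.
by move=> z; rewrite hornerM mulf_eq0 negb_or => /andP[/hP ? /hQ ?].
Qed.

Lemma gen_neq0 (p : {poly K}) : p != 0 -> generically (fun z => p.[z] != 0).
Proof. by move=> p0; exists p. Qed.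

Lemma gen_forall (I : finType) (P : I -> K -> Prop) :
  (forall i, generically (P i)) -> generically (fun z => forall i, P i z).
Proof.
move=> h; suff: generically (fun z => forall i, i \in enum I -> P i z).
  by move=> H; apply: gen_imp H _ => z H i; apply: H; rewrite mem_enum.
elim: (enum I) => [|i s IH]; first by apply: gen_true.
apply: gen_imp (gen_and (h i) IH) _ => z [Hi Hs] j.
by rewrite inE => /predU1P[->|/Hs].
Qed.

Lemma gen_poly_eq0 (p : {poly K}) : generically (fun z => p.[z] = 0) -> p = 0.
Proof.
case=> w w0 h; apply/eqP; apply: contraT => p0.
have pw0 : p * w != 0 by rewrite mulf_neq0.
(* The powers of q are distinct, so [p * w] has more roots than its degree allows. *)
pose rs := [seq q ^+ i | i <- iota 0 (size (p * w))].
have: (size rs < size (p * w)%R)%N.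
  apply: max_poly_roots => //; last by rewrite map_inj_uniq ?iota_uniq.
  apply/allP => z _; rewrite rootE hornerM.
  have [->|/h ->] := eqVneq w.[z] 0; by rewrite ?mulr0 ?mul0r.
by rewrite size_map size_iota ltnn.
Qed.

Lemma gen_poly_eq (p r : {poly K}) : generically (fun z => p.[z] = r.[z]) -> p = r.
Proof.
move=> h; apply/eqP; rewrite -subr_eq0; apply/eqP/gen_poly_eq0.
by apply: gen_imp h _ => z h; rewrite hornerD hornerN h subrr.
Qed.

(* [g / Phi] is the Taylor expansion at [0] of the rational function [f]. *)
Definition expands (Phi : fps K) (f : K -> K) (g : fps K) : Prop :=
  exists p s : {poly K}, [/\ s.[0] != 0, generically (fun z => f z * s.[z] = p.[z])
    & g * fps_of_poly s = fps_of_poly p * Phi].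

Lemma fps_of_poly_coef0 (s : {poly K}) : fps_of_poly s 0%N = s.[0].
Proof. by rewrite horner_coef0. Qed.

Lemma expands_gen_eq Phi f f' g :
  expands Phi f g -> generically (fun z => f z = f' z) -> expands Phi f' g.
Proof.
case=> p [s [s0 h E]] e; exists p, s; split=> //.
by apply: gen_imp (gen_and h e) _ => z [<- ->].
Qed.

(** This transfers identities between values at generic points to formal series: denominators have a
    nonzero constant term and can therefore be cancelled. *)
Lemma expands_uniq Phi f g g' : expands Phi f g -> expands Phi f g' -> g = g'.
Proof.
case=> p [s [s0 h E]] [p' [s' [s'0 h' E']]].
have ps : p * s' = p' * s.
  apply: gen_poly_eq; apply: gen_imp (gen_and h h') _ => z [e1 e2].
  by rewrite !hornerM -e1 -e2; ring.
apply: (@fps_mulI _ _ _ (fps_of_poly (s * s'))).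
  by rewrite fps_of_poly_coef0 hornerM mulf_neq0.
rewrite rmorphM; transitivity (fps_of_poly (p * s') * Phi).
  by rewrite mulrA E rmorphM /=; ring.
by rewrite ps mulrCA E' rmorphM /=; ring.
Qed.

Lemma expands_add Phi f f' g g' :
  expands Phi f g -> expands Phi f' g' -> expands Phi (fun z => f z + f' z) (g + g').
Proof.
case=> p [s [s0 h E]] [p' [s' [s'0 h' E']]].
exists (p * s' + p' * s), (s * s'); split.
- by rewrite hornerM mulf_neq0.
- apply: gen_imp (gen_and h h') _ => z [e1 e2].
  by rewrite ?hornerD !hornerM -e1 -e2; ring.
- rewrite rmorphD !rmorphM /= !mulrDl; congr (_ + _).
    by rewrite mulrA E; ring.
  by rewrite mulrCA E'; ring.
Qed.

Lemma expands_polyM Phi f g (r : {poly K}) :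
  expands Phi f g -> expands Phi (fun z => r.[z] * f z) (fps_of_poly r * g).
Proof.
case=> p [s [s0 h E]]; exists (r * p), s; split=> //.
  by apply: gen_imp h _ => z e1; rewrite hornerM -e1; ring.
by rewrite -mulrA E rmorphM mulrA.
Qed.

Lemma expands_scale Phi f g (c : K) :
  expands Phi f g -> expands Phi (fun z => c * f z) (fps_of_poly c%:P * g).
Proof.
by move=> /(@expands_polyM _ _ _ c%:P) h; apply: expands_gen_eq h _;
  apply: gen_true => z; rewrite hornerC.
Qed.

Lemma expands_id Phi : expands Phi (fun=> 1) Phi.
Proof.
exists 1, 1; split; rewrite ?hornerC ?oner_neq0 //; last exact: mulrC.
by apply: gen_true => z; rewrite mul1r.
Qed.

Lemma expands_sum (I : finType) Phi (F : I -> K -> K) (G : I -> fps K) :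
  (forall i, expands Phi (F i) (G i)) ->
  expands Phi (fun z => \sum_i F i z) (\sum_i G i).
Proof.
move=> h.
have : expands Phi (fun z => \sum_(i <- index_enum I) F i z) (\sum_(i <- index_enum I) G i).
  elim: (index_enum I) => [|i s IH].
    rewrite big_nil; exists 0, 1; split.
    - by rewrite hornerC oner_neq0.
    - by apply: gen_true => z; rewrite big_nil mul0r horner0.
    - by rewrite rmorph0 !mul0r.
  rewrite big_cons; apply: expands_gen_eq (expands_add (h i) IH) _.
  by apply: gen_true => z; rewrite big_cons.
by [].
Qed.

(* The value at [0] of a rational function that agrees generically with [f]. *)
Definition lim0 (f : K -> K) (c : K) : Prop :=
  exists p s : {poly K}, [/\ s.[0] != 0, p.[0] = c * s.[0]
    & generically (fun z => f z * s.[z] = p.[z])].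

Lemma lim0_gen_eq f f' c :
  lim0 f c -> generically (fun z => f z = f' z) -> lim0 f' c.
Proof.
case=> p [s [s0 E h]] e; exists p, s; split=> //.
by apply: gen_imp (gen_and h e) _ => z [<- ->].
Qed.

Lemma lim0_uniq f c c' : lim0 f c -> lim0 f c' -> c = c'.
Proof.
case=> p [s [s0 E h]] [p' [s' [s'0 E' h']]].
have ps : p * s' = p' * s.
  apply: gen_poly_eq; apply: gen_imp (gen_and h h') _ => z [e1 e2].
  by rewrite !hornerM -e1 -e2; ring.
move/(congr1 (fun r => r.[0])): ps; rewrite !hornerM E E' => H.
by apply: (mulIf s0); apply: (mulIf s'0); rewrite H; ring.
Qed.

Lemma lim0_cst c : lim0 (fun=> c) c.
Proof.
exists c%:P, 1; split; rewrite ?hornerC ?oner_neq0 ?mulr1 //.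
by apply: gen_true => z; rewrite !hornerC mulr1.
Qed.

Lemma lim0_add f f' c c' : lim0 f c -> lim0 f' c' -> lim0 (fun z => f z + f' z) (c + c').
Proof.
case=> p [s [s0 E h]] [p' [s' [s'0 E' h']]].
exists (p * s' + p' * s), (s * s'); split.
- by rewrite hornerM mulf_neq0.
- by rewrite ?hornerD !hornerM E E'; ring.
- apply: gen_imp (gen_and h h') _ => z [e1 e2].
  by rewrite ?hornerD !hornerM -e1 -e2; ring.
Qed.

Lemma lim0_mul f f' c c' : lim0 f c -> lim0 f' c' -> lim0 (fun z => f z * f' z) (c * c').
Proof.
case=> p [s [s0 E h]] [p' [s' [s'0 E' h']]].
exists (p * p'), (s * s'); split.
- by rewrite hornerM mulf_neq0.
- by rewrite ?hornerD !hornerM E E'; ring.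
- apply: gen_imp (gen_and h h') _ => z [e1 e2].
  by rewrite ?hornerD !hornerM -e1 -e2; ring.
Qed.

Lemma lim0_sum (I : Type) (r : seq I) (P : pred I) (F : I -> K -> K) c :
  (forall i, P i -> lim0 (F i) (c i)) ->
  lim0 (fun z => \sum_(i <- r | P i) F i z) (\sum_(i <- r | P i) c i).
Proof.
move=> h; elim: r => [|i r IH].
  rewrite big_nil; apply: lim0_gen_eq (lim0_cst 0) _.
  by apply: gen_true => z; rewrite big_nil.
rewrite big_cons; case: ifP => Pi.
  apply: lim0_gen_eq (lim0_add (h i Pi) IH) _.
  by apply: gen_true => z; rewrite big_cons Pi.
apply: lim0_gen_eq IH _.
by apply: gen_true => z; rewrite big_cons Pi.
Qed.

Lemma lim0_prod (I : Type) (r : seq I) (P : pred I) (F : I -> K -> K) c :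
  (forall i, P i -> lim0 (F i) (c i)) ->
  lim0 (fun z => \prod_(i <- r | P i) F i z) (\prod_(i <- r | P i) c i).
Proof.
move=> h; elim: r => [|i r IH].
  rewrite big_nil; apply: lim0_gen_eq (lim0_cst 1) _.
  by apply: gen_true => z; rewrite big_nil.
rewrite big_cons; case: ifP => Pi.
  apply: lim0_gen_eq (lim0_mul (h i Pi) IH) _.
  by apply: gen_true => z; rewrite big_cons Pi.
apply: lim0_gen_eq IH _.
by apply: gen_true => z; rewrite big_cons Pi.
Qed.

End Germs.

(** The top coefficient of the Lagrange interpolation formula. It plays the role of the residue
    theorem in the partial fraction argument. *)
Lemma lagrange_lead_coef (K : fieldType) (s : seq K) (p : {poly K}) :
  uniq s -> (size p <= size s)%N ->
  \sum_(y <- s) p.[y] / \prod_(z <- s | z != y) (y - z) = p`_(size s).-1.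
Proof.
move=> us sp; pose D y := \prod_(z <- s | z != y) (y - z).
pose L y := \prod_(z <- s | z != y) ('X - z%:P).
have size_L y : y \in s -> size (L y) = size s.
  move=> ys; rewrite /L -big_filter size_prod_XsubC.
  have -> : [seq i <- s | i != y] = rem y s by rewrite rem_filter.
  by rewrite size_rem // prednK //; case: (s) ys.
have L_lead y : y \in s -> (L y)`_(size s).-1 = 1.
  move=> ys; rewrite -(size_L _ ys) -lead_coefE.
  by apply/eqP; rewrite -monicE /L monic_prod_XsubC.
have L_eval y z : (L y).[z] = \prod_(w <- s | w != y) (z - w).
  by rewrite /L horner_prod; apply: eq_bigr => w _; rewrite hornerXsubC.
have D0 y : D y != 0.
  by rewrite /D prodf_seq_neq0; apply/allP => z _; rewrite subr_eq0 eq_sym; apply/implyP.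
suff E : p = \sum_(y <- s) (p.[y] / D y) *: L y.
  rewrite [in RHS]E coef_sum; apply: eq_big_seq => y ys.
  by rewrite coefZ L_lead // mulr1.
apply/eqP; rewrite -subr_eq0; apply: contraT => d0.
have: (size s < size (p - \sum_(y <- s) (p.[y] / D y) *: L y)%R)%N.
  apply: max_poly_roots => //; apply/allP => y ys.
  rewrite rootE hornerD hornerN horner_sum (bigD1_seq y) //= hornerZ L_eval divfK //.
  rewrite big1_seq ?addr0 ?subrr // => z /andP[zy zs].
  rewrite hornerZ L_eval; apply/eqP; rewrite mulf_eq0 prodf_seq_eq0.
  by apply/orP; right; apply/hasP; exists y; rewrite // eq_sym zy subrr eqxx.
rewrite ltnNge (leq_trans (size_polyD _ _)) // geq_max sp size_polyN.
apply: (leq_trans (size_sum _ _ _)); apply/bigmax_leqP_seq => y ys _.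
by rewrite (leq_trans (size_scale_leq _ _)) // size_L.
Qed.

Definition lin2 (K : fieldType) (c : K) : {poly K} := 1 - c%:P * 'X^2.

Lemma lin2_eval (K : fieldType) (c z : K) : (lin2 c).[z] = 1 - c * z ^+ 2.
Proof. by rewrite /lin2 !hornerE. Qed.

Section PolynomialSizes.
Variable K : fieldType.

Lemma lin2_neq0 (c : K) : lin2 c != 0.
Proof.
apply/eqP => /(congr1 (fun p => p.[0])) /eqP.
by rewrite lin2_eval horner0 expr0n mulr0 subr0 oner_eq0.
Qed.

Lemma size_lin2 (c : K) : c != 0 -> size (lin2 c) = 3.
Proof.
move=> c0; rewrite /lin2 addrC size_polyDl size_polyN mul_polyC size_scale // size_polyXn //.
by rewrite size_polyC oner_neq0.
Qed.

Lemma coef_lin2M (c : K) (p : {poly K}) k : (p * lin2 c)`_k.+2 = p`_k.+2 - c * p`_k.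
Proof.
by rewrite /lin2 mulrBr mulr1 coefB mulrCA coefCM coefMXn subn2.
Qed.

Lemma size_lin_le (c : K) : (size (lin c) <= 2)%N.
Proof.
rewrite (leq_trans (size_polyD _ _)) // geq_max size_polyC oner_neq0 size_polyN.
by rewrite (leq_trans (size_scale_leq _ _)) ?size_polyX.
Qed.

Lemma coefM_top (p r : {poly K}) m k : (size p <= m.+1)%N -> (size r <= k.+1)%N ->
  (p * r)`_(m + k) = p`_m * r`_k.
Proof.
move=> sp sr; have mk : (m < (m + k).+1)%N by rewrite ltnS leq_addr.
rewrite coefM (bigD1 (Ordinal mk)) //= addKn big1 ?addr0 // => -[i /= ik].
rewrite -val_eqE /= neq_ltn => /orP[im|mi].
  by rewrite [r`__]nth_default ?mulr0 // (leq_trans sr) //; nlia.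
by rewrite nth_default ?mul0r // (leq_trans sp).
Qed.

Lemma size_coef_prod (I : Type) (r : seq I) (f : I -> {poly K}) :
  (forall j, (size (f j) <= 3)%N) ->
  (size (\prod_(j <- r) f j)%R <= (2 * size r).+1)%N /\
  (\prod_(j <- r) f j)`_(2 * size r) = \prod_(j <- r) (f j)`_2.
Proof.
move=> h; elim: r => [|j r [IHs IHc]].
  by rewrite !big_nil size_poly1 coefC.
rewrite !big_cons /= mulnS; split; last by rewrite coefM_top // IHc.
by rewrite (leq_trans (size_polyMleq _ _)) // -subn1 leq_subLR (leq_trans (leq_add (h j) IHs)).
Qed.

End PolynomialSizes.

Section QuotientPoly.
Variables (K : fieldType) (t : K).
Hypothesis t0 : t != 0.
Variable n : nat.
Variable x : 'I_n -> K.
Hypothesis x0 : forall i, x i != 0.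

Let a_ j : {poly K} := lin (t * x j) * lin (t / x j).
Let b_ j : {poly K} := lin (x j) * lin (x j)^-1.

(** Modulo 1 - t X^2 the polynomial [a_ j] is t times [b_ j]. Hence the product of all [a_ j] minus
    t^n times that of all [b_ j] is divisible by 1 - t X^2. *)
Let a_sub_b j : a_ j = (1 - t%:P) * lin2 t + t%:P * b_ j.
Proof.
rewrite /a_ /b_ /lin /lin2 -!mul_polyC !rmorphM; set y := (x j)%:P; set y' := ((x j)^-1)%:P.
have E : y * y' = 1 by rewrite -rmorphM mulfV.
transitivity (1 - t%:P * (y + y') * 'X + t%:P ^+ 2 * 'X^2 * (y * y')); first by ring.
transitivity (1 - t%:P * (y + y') * 'X + t%:P ^+ 2 * 'X^2
  + t%:P * 'X^2 * (y * y' - 1)); last by ring.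
by rewrite E; ring.
Qed.

Let quot (r : seq 'I_n) : exists M : {poly K}, M * lin2 t =
  \prod_(j <- r) a_ j - (t ^+ size r)%:P * \prod_(j <- r) b_ j.
Proof.
elim: r => [|j r [M E]].
  by exists 0; rewrite !big_nil mul0r expr0 mul1r subrr.
exists ((1 - t%:P) * \prod_(j <- r) a_ j + t%:P * b_ j * M); rewrite !big_cons /=.
rewrite a_sub_b mulrDl -(mulrA _ M) E exprS rmorphM.
by move: (\prod_(_ <- r) b_ _) (\prod_(_ <- r) a_ _) => B A; ring.
Qed.

Let ab_coef0 j : (a_ j).[0] = 1 /\ (b_ j).[0] = 1.
Proof. by rewrite /a_ /b_ !hornerM !lin_eval !mulr0 !subr0 !mulr1. Qed.

(** The operator's coefficient at a node omits the factor of the node itself, while an interpolated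
    polynomial must be the same for all nodes. At a root of [b_ i] the factor [a_ i] equals (1 -
    t)(1 - t X^2), so dividing by 1 - t X^2 removes it; subtracting the product of the [b_ j] makes
    the division exact without changing the values at the nodes. *)
Lemma quotient_poly : (0 < n)%N -> exists M : {poly K},
  [/\ M * lin2 t = \prod_j a_ j - (t ^+ n)%:P * \prod_j b_ j,
      (size M <= (2 * n).-1)%N, M`_(2 * n).-2 = (t ^+ n - t ^+ (2 * n)) / t,
      M.[0] = 1 - t ^+ n &
      forall i y, (b_ i).[y] = 0 -> M.[y] = (1 - t) * \prod_(j | j != i) (a_ j).[y]].
Proof.
move=> n0.
have [M E] := quot (index_enum 'I_n).
have sz : size (index_enum 'I_n) = n by rewrite /index_enum -enumT size_enum_ord.
rewrite sz in E.
have sa j : (size (a_ j) <= 3)%N.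
  rewrite (leq_trans (size_polyMleq _ _)) //.
  by have := size_lin_le (t * x j); have := size_lin_le (t / x j); nlia.
have sb j : (size (b_ j) <= 3)%N.
  rewrite (leq_trans (size_polyMleq _ _)) //.
  by have := size_lin_le (x j); have := size_lin_le (x j)^-1; nlia.
have [sA cA] := size_coef_prod (index_enum 'I_n) sa.
have [sB cB] := size_coef_prod (index_enum 'I_n) sb.
rewrite sz in sA cA sB cB.
have coef2 u v : (lin u * lin v : {poly K})`_2 = u * v.
  by rewrite (@coefM_top _ _ _ 1 1) ?size_lin_le // /lin !coefB !coefZ !coefX !coefC /=; ring.
have sM : (size M <= (2 * n).-1)%N.
  have [->|M0] := eqVneq M 0; first by rewrite size_poly0.
  have : (size (M * lin2 t)%R <= (2 * n).+1)%N.
    rewrite E (leq_trans (size_polyD _ _)) // geq_max sA /= size_polyN mul_polyC.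
    by rewrite (leq_trans (size_scale_leq _ _)) //.
  rewrite size_mul ?lin2_neq0 // size_lin2 // addn3 /=; move: (size M) => s; nlia.
exists M; split=> //.
- have := congr1 (fun p : {poly K} => p`_(2 * n)) E.
  have -> : (2 * n = (2 * n).-2.+2)%N by nlia.
  rewrite coef_lin2M (nth_default 0 (leq_trans sM _)); last by nlia.
  have -> : ((2 * n).-2.+2 = 2 * n)%N by nlia.
  rewrite coefB coefCM cA cB.
  rewrite (eq_bigr (fun=> t ^+ 2)); last by move=> j _; rewrite coef2; field.
  rewrite [X in _ = _ - _ * X](eq_bigr (fun=> 1)); last by move=> j _; rewrite coef2 mulfV.
  rewrite !prodr_const card_ord expr1n mulr1 -exprM sub0r => H.
  apply: (mulfI t0); apply: oppr_inj; rewrite H; field; nz.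
- have := congr1 (fun p : {poly K} => p.[0]) E.
  rewrite hornerM lin2_eval expr0n mulr0 subr0 mulr1 => ->.
  rewrite hornerD hornerN hornerM hornerC !horner_prod !big1 ?mulr1 //.
    by move=> j _; case: (ab_coef0 j).
  by move=> j _; case: (ab_coef0 j).
- move=> i y biy.
  have [M' E'] := quot [seq j <- index_enum 'I_n | j != i].
  (* Peeling off the factor i exhibits M modulo [b_ i]. *)
  have -> : M = (1 - t%:P) * \prod_(j | j != i) a_ j + t%:P * b_ i * M'.
    apply: (mulIf (lin2_neq0 t)); rewrite E mulrDl -(mulrA _ M') E' !big_filter.
    rewrite (bigD1 i) //= [X in _ - _ * X](bigD1 i) //= a_sub_b.
    have -> : t ^+ n = t ^+ (size [seq j <- index_enum 'I_n | j != i]).+1.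
      congr (_ ^+ _); rewrite -{1}sz size_filter -[in LHS](count_predC (pred1 i)) -addn1 addnC.
      congr (_ + _)%N; rewrite (count_uniq_mem _ (index_enum_uniq _)).
      by rewrite mem_index_enum.
    rewrite exprS rmorphM.
    by move: (\prod_(_ | _) b_ _) (\prod_(_ | _) a_ _) => B A; ring.
  rewrite hornerD [(t%:P * b_ i * M').[y]]hornerM [(t%:P * b_ i).[y]]hornerM biy.
  by rewrite mulr0 mul0r addr0 hornerM horner_prod hornerD hornerN !hornerC.
Qed.

End QuotientPoly.

Lemma mul_lin2_top (K : fieldType) (M : {poly K}) (c d : K) m :
  (0 < m)%N -> (size M <= m.-1)%N -> c != 0 -> d != 0 ->
  (size (M * (lin2 c * lin2 d))%R <= m.+3)%N /\
  (M * (lin2 c * lin2 d))`_m.+2 = M`_m.-2 * (c * d).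
Proof.
move=> m0 sM c0 d0.
have s4 : size (lin2 c * lin2 d) = 5.
  by rewrite size_mul ?lin2_neq0 // !size_lin2.
have sM' : (size M <= m.-2.+1)%N by move: (size M) sM => s; nlia.
split.
  rewrite (leq_trans (size_polyMleq _ _)) // s4; move: (size M) sM => s; nlia.
have [m1|m1] := leqP m 1.
  move: sM'; have -> : (m = 1)%N by nlia.
  move=> _; have -> : M = 0 by apply/eqP; rewrite -size_poly_eq0; move: (size M) sM => s; nlia.
  by rewrite mul0r !coef0 mul0r.
have -> : (m.+2 = m.-2 + 4)%N by nlia.
rewrite coefM_top ?s4 //; congr (_ * _).
rewrite (@coefM_top _ _ _ 2 2) ?size_lin2 // /lin2 !coefB !coefCM !coefXn !coefC /=.
by ring.
Qed.

(** * The kernel identity *)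

Section KernelIdentity.
Variables (K : fieldType) (q t T : K) (n : nat) (x : {ffun 'I_n -> K}).
Hypotheses (q0 : q != 0) (t0 : t != 0) (T0 : T != 0).
Hypotheses (n0 : (0 < n)%N) (hx : regular_point q x).

(** The 2n points x_i and 1 / x_i. The second sum of Koornwinder's operator is the first at inverted
    variables, so one coefficient formula over the nodes covers both. *)
Definition node (k : 'I_n * bool) : K := if k.2 then x k.1 else (x k.1)^-1.

Definition koornwinder_coef (k : 'I_n * bool) : K :=
  (1 - T * node k ^+ 2) * (1 - q * T * node k ^+ 2)
  / (T * t ^+ (n - 1) * (1 - node k ^+ 2) * (1 - q * node k ^+ 2))
  * \prod_(j < n | j != k.1) ((1 - t * node k * x j) * (1 - t * node k / x j)
     / ((1 - node k * x j) * (1 - node k / x j))).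

(* The values at [u] of [T_k Phi / Phi], where [T_k] multiplies the node [k] by
   [q] and [Phi u] is the product of [(t u y)_oo / (u y)_oo] over the nodes [y];
   and those of [Phi (q u) / Phi u] and [Phi (u / q) / Phi u]. *)
Definition shift_ratio (y u : K) : K :=
  (1 - y * u) * (1 - t / (q * y) * u) / ((1 - t * y * u) * (1 - (q * y)^-1 * u)).
Definition dil_ratio (u : K) : K :=
  \prod_j ((1 - x j * u) * (1 - (x j)^-1 * u)
           / ((1 - t * x j * u) * (1 - t / x j * u))).
Definition dilV_ratio (u : K) : K :=
  \prod_j ((1 - t * x j / q * u) * (1 - t / x j / q * u)
           / ((1 - x j / q * u) * (1 - (x j)^-1 / q * u))).

(** The operator in u, cleared of denominators. [kernel_plus] comes from the interpolation point 1 /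
    (t u) and [kernel_minus] from u / q. In [kernel_const] the first summand comes from the leading
    coefficient and the point 0, the others from the term -t^n prod [b_ j] of M at the two points
    just named. *)
Definition kernel_den : {poly K} := lin2 t * lin2 (t / q) * lin2 (t / q ^+ 2).
Definition kernel_plus : {poly K} := (q * T ^+ 2 * t ^+ (2 * n) / t)%:P
  * (lin2 (t ^+ 2 / T) * lin2 (t ^+ 2 / (q * T)) * lin2 (t / q ^+ 2)).
Definition kernel_minus : {poly K} := (q * t)%:P
  * (lin2 (T / q ^+ 2) * lin2 (T / q) * lin2 t).
Definition kernel_const : {poly K} :=
  ((1 - t ^+ n) * (q * T ^+ 2 * t ^+ n / t - q * t))%:P * kernel_den
  - (t ^- n)%:P * kernel_plus - (t ^+ n)%:P * kernel_minus.

Let x0 i : x i != 0. Proof. by case: hx => /(_ i) []. Qed.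
Let y0 k : node k != 0.
Proof. by case: k => i [] /=; rewrite /node /= ?invr_eq0. Qed.

Let node_inj : injective node.
Proof.
have h2 i : x i * x i != 1.
  by case: hx => /(_ i) [_]; rewrite subr_eq0 eq_sym expr2.
have h i j : i != j -> x i != x j /\ x i * x j != 1.
  case: hx => _ hij; rewrite eq_sym => /hij; rewrite !subr_eq0 => -[h1 h3].
  rewrite (eq_sym _ 1); split=> //; apply: contraNneq h3 => ->.
  by rewrite mulfV.
have hV i j : x i = (x j)^-1 -> False.
  move=> E; have E1 : x i * x j = 1 by rewrite E mulVf.
  have [ij|/h[_]] := eqVneq i j; last by rewrite E1 eqxx.
  by have := h2 i; rewrite {2}ij E1 eqxx.
case=> i b [j c]; rewrite /node /=.
have [->|/h[ij _]] := eqVneq i j.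
  by case: b c => -[] // E; [case: (hV j j)|case: (hV j j)].
case: b c => -[] E; first by rewrite E eqxx in ij.
- by case: (hV i j).
- by case: (hV j i).
- by move/invr_inj: E ij => ->; rewrite eqxx.
Qed.

Let prod_nodes (F : K -> K) : \prod_k F (node k) = \prod_j (F (x j) * F (x j)^-1).
Proof.
transitivity (\prod_(j < n) \prod_(b : bool) F (node (j, b))).
  by rewrite pair_big /=; apply: eq_bigr => -[].
by apply: eq_bigr => j _; rewrite big_bool.
Qed.

Let prod_nodesD k (F : K -> K) : \prod_(l | l != k) F (node l) =
  F (node k)^-1 * \prod_(j | j != k.1) (F (x j) * F (x j)^-1).
Proof.
case: k => i b; rewrite (bigD1 (i, ~~ b)) /=; last first.
  by apply/eqP => -[]; case: b.
congr (_ * _); first by congr F; case: b; rewrite /node /= ?invrK.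
transitivity (\prod_(j < n | j != i) \prod_(b : bool) F (node (j, b))).
  rewrite pair_big_dep /=; apply: eq_big => -[j c] //=.
  rewrite andbT !xpair_eqE; case: eqP => //= _.
  by case: b c => -[].
by apply: eq_bigr => j _; rewrite big_bool.
Qed.

Let node_neq1 k : 1 - node k ^+ 2 != 0 /\ 1 - q * node k ^+ 2 != 0.
Proof.
case: k => i b; case: hx => /(_ i) [xi e1 e2 e3] _; rewrite /node /=; case: b => //.
split; last by rewrite exprVn.
have -> : 1 - (x i)^-1 ^+ 2 = - (1 - x i ^+ 2) / x i ^+ 2 by field; nz.
by rewrite mulf_neq0 ?oppr_eq0 ?invr_eq0 ?expf_neq0.
Qed.

Let node_prod_neq0 k :
  \prod_(j | j != k.1) ((1 - node k * x j) * (1 - node k / x j)) != 0.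
Proof.
rewrite prodf_seq_neq0; apply/allP => j _; apply/implyP => jk.
case: k jk => i b /= ji; case: hx => _ /(_ i j ji) [e1 e2].
have xi := x0 i; have xj := x0 j.
have e3 : x i * x j - 1 != 0 by rewrite -oppr_eq0 opprB.
have e4 : x j - x i != 0.
  have -> : x j - x i = x j * (1 - x i / x j) by field; nz.
  by rewrite mulf_neq0.
case: b; rewrite /node /= mulf_neq0 //.
  have -> : 1 - (x i)^-1 * x j = - (x j - x i) / x i by field; nz.
  by rewrite mulf_neq0 ?oppr_eq0 ?invr_eq0.
have -> : 1 - (x i)^-1 / x j = (x i * x j - 1) / (x i * x j) by field; nz.
by rewrite mulf_neq0 ?invr_eq0 ?mulf_neq0.
Qed.

(** The factor 1 - q y^2 cancels the same factor in the denominator of [koornwinder_coef]; as a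
    function of y, only the poles at u / q and 1 / (t u) are new. *)
Let shift_ratioB1 y u : y != 0 ->
  1 - t * y * u != 0 -> 1 - (q * y)^-1 * u != 0 ->
  shift_ratio y u - 1 = (1 - t) * (1 - q * y ^+ 2) * u
    / (q * y * (1 - t * y * u) * (1 - (q * y)^-1 * u)).
Proof.
move=> yn0 h1 h2; rewrite /shift_ratio.
have e6 : q * y - u != 0.
  have -> : q * y - u = q * y * (1 - (q * y)^-1 * u) by field; nz.
  by rewrite !mulf_neq0.
by field; nz.
Qed.

(** The polynomial M(z) (1 - T z^2)(1 - q T z^2) is interpolated at 0, u / q, 1 / (t u) and the 2n
    nodes. The terms at the nodes make up the left side; the three remaining points and the leading
    coefficient make up the right side. *)
Lemma kernel_identity u : u != 0 ->
  (forall k, 1 - t * node k * u != 0) -> (forall k, 1 - (q * node k)^-1 * u != 0) ->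
  1 - t * u ^+ 2 != 0 -> 1 - t / q * u ^+ 2 != 0 -> 1 - t / q ^+ 2 * u ^+ 2 != 0 ->
  (q * T * t ^+ n * kernel_den.[u])
    * \sum_k koornwinder_coef k * (shift_ratio (node k) u - 1)
  = kernel_plus.[u] * dil_ratio u + kernel_minus.[u] * dilV_ratio u + kernel_const.[u].
Proof.
move=> u0 hb ha h1 h2 h3.
pose a := u / q; pose b := (t * u)^-1.
have a0 : a != 0 by rewrite mulf_neq0 ?invr_eq0.
have b0 : b != 0 by rewrite invr_eq0 mulf_neq0.
have ab : a != b.
  rewrite -subr_eq0; have -> : a - b = - (1 - t / q * u ^+ 2) / (t * u).
    by rewrite /a /b; field; nz.
  by rewrite mulf_neq0 ?oppr_eq0 ?invr_eq0 ?mulf_neq0.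
have ya k : node k != a.
  rewrite -subr_eq0; have -> : node k - a = node k * (1 - (q * node k)^-1 * u).
    by have := y0 k; rewrite /a => ?; field; nz.
  by rewrite mulf_neq0.
have yb k : node k != b.
  rewrite -subr_eq0; have -> : node k - b = - (1 - t * node k * u) / (t * u).
    by rewrite /b; field; nz.
  by rewrite mulf_neq0 ?oppr_eq0 ?invr_eq0 ?mulf_neq0.
have [M [ME sM cM M0 My]] := quotient_poly t0 x0 n0.
pose D z : K := \prod_k (z - node k).
pose ys := [seq node k | k <- index_enum ('I_n * bool)%type].
pose p := M * (lin2 T * lin2 (q * T)).
have sz : size ys = (2 * n)%N.
  by rewrite size_map /index_enum -enumT -cardE card_prod card_ord card_bool mulnC.
have un : uniq (0 :: a :: b :: ys).
  rewrite /= !inE !negb_or ![0 == _]eq_sym a0 b0 ab /=.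
  rewrite map_inj_uniq ?index_enum_uniq // andbT.
  apply/and3P; split; apply/mapP => -[k _ E].
  - by have := y0 k; rewrite -E eqxx.
  - by have := ya k; rewrite -E eqxx.
  - by have := yb k; rewrite -E eqxx.
have T20 : q * T != 0 by rewrite mulf_neq0.
have [sp cp] : (size p <= (2 * n).+3)%N /\
    p`_(2 * n).+2 = (t ^+ n - t ^+ (2 * n)) / t * (T * (q * T)).
  by rewrite -cM /p; apply: mul_lin2_top; rewrite ?muln_gt0.
have sp' : (size p <= size [:: 0%R, a, b & ys])%N by rewrite /= sz.
have ltop := lagrange_lead_coef un sp'.
rewrite [size _]/= sz cp in ltop.
have DE z : D z = \prod_j ((1 - x j * z) * (1 - (x j)^-1 * z)).
  rewrite /D (prod_nodes (fun y => z - y)); apply: eq_bigr => j _.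
  by have := x0 j => ?; field; nz.
have D0 : D 0 = 1 by rewrite DE big1 // => j _; rewrite !mulr0 subr0 mulr1.
have Dys z : z \notin ys -> \prod_(w <- ys | w != z) (z - w) = D z.
  move=> zys; rewrite big_seq_cond /D -(big_map node xpredT (fun w => z - w)) -/ys big_seq.
  apply: eq_bigl => w; case wys: (w \in ys) => //=.
  by apply/eqP => wz; rewrite -wz wys in zys.
have [ny0 nya nyb] : [/\ 0 \notin ys, a \notin ys & b \notin ys].
  by move: un; rewrite /= !inE !negb_or => /and4P[/and3P[_ _ ->] /andP[_ ->] -> _].
have P0 : \prod_(z <- 0 :: a :: b :: ys | z != 0) (0 - z) = a * b.
  by rewrite !big_cons eqxx a0 b0 /= Dys // D0; ring.
have Pa : \prod_(z <- 0 :: a :: b :: ys | z != a) (a - z) = a * (a - b) * D a.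
  by rewrite !big_cons eqxx /= (eq_sym 0) a0 (eq_sym b) ab /= Dys // subr0; ring.
have Pb : \prod_(z <- 0 :: a :: b :: ys | z != b) (b - z) = b * (b - a) * D b.
  by rewrite !big_cons eqxx /= (eq_sym 0) b0 ab /= Dys // subr0; ring.
have Pk k : \prod_(z <- 0 :: a :: b :: ys | z != node k) (node k - z) =
    node k * (node k - a) * (node k - b) * ((node k - (node k)^-1)
     * \prod_(j | j != k.1) ((1 - node k * x j) * (1 - node k / x j))).
  rewrite !big_cons (eq_sym 0) y0 (eq_sym a) ya (eq_sym b) yb /= subr0 big_map.
  rewrite (eq_bigl (fun l => l != k)); last by move=> l; rewrite /= (inj_eq node_inj).
  rewrite (prod_nodesD k (fun y => node k - y)) !mulrA; congr (_ * _).
  by apply: eq_bigr => j _; have := x0 j => ?; field; nz.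
have tn0 : t ^+ n != 0 by rewrite expf_neq0.
have term k : koornwinder_coef k * (shift_ratio (node k) u - 1) =
   (q * T * t ^+ n)^-1 * (p.[node k] / \prod_(z <- 0 :: a :: b :: ys | z != node k) (node k - z)).
  rewrite Pk /p !hornerM !lin2_eval (My k.1); last first.
    rewrite hornerM !lin_eval /node; case: k.2; rewrite ?mulVf ?mulfV ?subrr ?mulr0 ?mul0r //.
  have -> : \prod_(j | j != k.1) (lin (t * x j) * lin (t / x j)).[node k] =
     \prod_(j | j != k.1) ((1 - t * node k * x j) * (1 - t * node k / x j)).
    by apply: eq_bigr => j _; rewrite hornerM !lin_eval; ring.
  rewrite /koornwinder_coef prodf_div.
  have := node_prod_neq0 k; have [e1 e2] := node_neq1 k.
  move: (\prod_(_ | _) _) (\prod_(_ | _) _) => A B B0.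
  have -> : t ^+ n = t ^+ (n - 1) * t by rewrite -exprSr subn1 prednK.
  have tn1 : t ^+ (n - 1) != 0 by rewrite expf_neq0.
  have := ha k; have := hb k; have := y0 k.
  rewrite shift_ratioB1 //; move: (node k) e1 e2 => y e1 e2 e3 e4 e5.
  have -> : y - a = y * (1 - (q * y)^-1 * u) by rewrite /a; field; nz.
  have -> : y - b = - (1 - t * y * u) / (t * u) by rewrite /b; field; nz.
  have -> : y - y^-1 = - (1 - y ^+ 2) / y by field; nz.
  move: (1 - y ^+ 2) (1 - q * y ^+ 2) (1 - t * y * u) (1 - (q * y)^-1 * u)
    (1 - T * y ^+ 2) (1 - q * T * y ^+ 2) e1 e2 e4 e5.
  move=> c1 c2 c3 c4 c5 c6 e1 e2 e4 e5.
  by field; nz.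
have sum_split (f : K -> K) : \sum_(y <- 0 :: a :: b :: ys) f y =
    f 0 + (f a + (f b + \sum_k f (node k))) by rewrite !big_cons big_map.
have sum_terms : \sum_(y <- 0 :: a :: b :: ys)
    p.[y] / \prod_(z <- 0 :: a :: b :: ys | z != y) (y - z) =
  p.[0] / (a * b) + p.[a] / (a * (a - b) * D a) + p.[b] / (b * (b - a) * D b)
  + q * T * t ^+ n * \sum_k koornwinder_coef k * (shift_ratio (node k) u - 1).
  rewrite sum_split P0 Pa Pb -!addrA; do 3 congr (_ + _).
  rewrite mulr_sumr; apply: eq_bigr => k _.
  by rewrite term mulrA mulfV ?mul1r // mulf_neq0 // mulf_neq0.
have {ltop sum_terms} : q * T * t ^+ n * \sum_k koornwinder_coef k * (shift_ratio (node k) u - 1)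
   = (t ^+ n - t ^+ (2 * n)) / t * (T * (q * T)) - (p.[0] / (a * b)
      + p.[a] / (a * (a - b) * D a) + p.[b] / (b * (b - a) * D b)).
  by rewrite -ltop sum_terms [RHS]addrC addKr.
have MD z : 1 - t * z ^+ 2 != 0 -> M.[z] =
    (\prod_j ((1 - t * x j * z) * (1 - t / x j * z)) - t ^+ n * D z) / (1 - t * z ^+ 2).
  move=> hz; apply: (mulIf hz); rewrite divfK // -lin2_eval -hornerM ME.
  rewrite hornerD hornerN hornerM hornerC !horner_prod DE.
  by congr (_ - _ * _); apply: eq_bigr => j _; rewrite hornerM !lin_eval.
have hta : 1 - t * a ^+ 2 != 0.
  have -> : 1 - t * a ^+ 2 = 1 - t / q ^+ 2 * u ^+ 2 by rewrite /a; field; nz.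
  by [].
have htb : 1 - t * b ^+ 2 != 0.
  have -> : 1 - t * b ^+ 2 = - (1 - t * u ^+ 2) / (t * u ^+ 2) by rewrite /b; field; nz.
  by rewrite mulf_neq0 ?oppr_eq0 ?invr_eq0 ?mulf_neq0 ?expf_neq0.
have Da : D a != 0.
  by rewrite /D prodf_seq_neq0; apply/allP => k _ /=; rewrite subr_eq0 eq_sym.
have Db : D b != 0.
  by rewrite /D prodf_seq_neq0; apply/allP => k _ /=; rewrite subr_eq0 eq_sym.
have Ea : \prod_j ((1 - t * x j * a) * (1 - t / x j * a)) = dilV_ratio u * D a.
  rewrite -[LHS](divfK Da); congr (_ * _); rewrite DE -prodf_div; apply: eq_bigr => j _.
  by congr (_ * _ / (_ * _)); rewrite /a; ring.
have Eb : \prod_j ((1 - t * x j * b) * (1 - t / x j * b)) = t ^+ (2 * n) * dil_ratio u * D b.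
  have -> : t ^+ (2 * n) = \prod_(j < n) t ^+ 2 by rewrite prodr_const card_ord exprM.
  rewrite DE -!big_split /=; apply: eq_bigr => j _.
  have := hb (j, true); have := hb (j, false); rewrite /node /= => g1 g2.
  have g3 : x j - t * u != 0.
    have -> : x j - t * u = x j * (1 - t / x j * u) by field; exact: x0.
    by rewrite mulf_neq0.
  by have g4 := x0 j; rewrite /b; field; nz.
move=> H; rewrite [LHS]mulrAC H /p !hornerM !lin2_eval M0 (MD a hta) (MD b htb) Ea Eb.
rewrite /kernel_plus /kernel_minus /kernel_const /kernel_den.
rewrite !(lin2_eval, hornerD, hornerN, hornerM, hornerC) (mulnC 2%N) exprM.
move: (D a) (D b) Da Db (dil_ratio u) (dilV_ratio u) (t ^+ n) tn0 => Na Nb Na0 Nb0 X Y s s0.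
rewrite /a /b.
have f1 : q - t * u ^+ 2 != 0.
  have -> : q - t * u ^+ 2 = q * (1 - t / q * u ^+ 2) by field; nz.
  by rewrite mulf_neq0.
have f2 : q ^+ 2 - t * u ^+ 2 != 0.
  have -> : q ^+ 2 - t * u ^+ 2 = q ^+ 2 * (1 - t / q ^+ 2 * u ^+ 2) by field; nz.
  by rewrite mulf_neq0 ?expf_neq0.
by field; nz.
Qed.
End KernelIdentity.

(** * The generating function as a formal series *)

Section GeneratingFunction.
Variables (K : fieldType) (q t : K).
Hypotheses (q0 : q != 0) (t0 : t != 0).
Hypothesis hq : forall i, 1 - q ^+ i * q != 0.
Hypothesis qinj : injective (fun i => q ^+ i).
Local Notation poly := fps_of_poly.

(* The expansion in [u] of [(t y u)_oo / (y u)_oo]. *)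
Definition row_series (y : K) : fps K := Fps (fun k => row_coef q t k * y ^+ k).

Lemma row_coefS k : row_coef q t k.+1 * (1 - q ^+ k * q) = row_coef q t k * (1 - q ^+ k * t).
Proof.
rewrite /row_coef !qpochS.
have pk : qpoch q q k != 0 by exact: qpoch_neq0.
by have := hq k => ?; field; nz.
Qed.

Lemma dil_row_series c y : dil c (row_series y) = row_series (c * y).
Proof. by apply: fpsP => n /=; rewrite exprMn; ring. Qed.

Lemma row_series_funeq y :
  row_series (q * y) * poly (lin (t * y)) = row_series y * poly (lin y).
Proof.
apply: fpsP => n; rewrite ![row_series _ * _]mulrC !fcoef_lin.
case: n => [|n] /=; first by rewrite !mulr1.
have := row_coefS n; set w := row_coef _ _ n; set w' := row_coef _ _ n.+1 => E.
have {}E : w' = w' * (q ^+ n * q) + w * (1 - q ^+ n * t) by rewrite -E; ring.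
rewrite [in RHS]E !exprMn !exprS; ring.
Qed.

Section Product.
Variable n : nat.
Implicit Types x : {ffun 'I_n -> K}.

Definition gen_series x : fps K := \prod_i (row_series (x i) * row_series (x i)^-1).

Definition node_shift (k : 'I_n * bool) x : {ffun 'I_n -> K} :=
  scale_var (if k.2 then q else q^-1) k.1 x.

Lemma gen_series_shift k x : (forall i, x i != 0) ->
  gen_series (node_shift k x) * poly (lin (t * node x k) * lin (q * node x k)^-1)
  = poly (lin (node x k) * lin (t / (q * node x k))) * gen_series x.
Proof.
move=> x0; case: k => i b.
have y0 : node x (i, b) != 0 by rewrite /node /=; case: b; rewrite ?invr_eq0.
pose B := \prod_(j | j != i) (row_series (x j) * row_series (x j)^-1).
have E1 : gen_series x = row_series (node x (i, b)) * row_series (node x (i, b))^-1 * B.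
  rewrite /gen_series (bigD1 i) //=; congr (_ * _).
  by rewrite /node /=; case: b {y0}; rewrite // invrK mulrC.
have E2 : gen_series (node_shift (i, b) x) =
    row_series (q * node x (i, b)) * row_series (q * node x (i, b))^-1 * B.
  rewrite /gen_series (bigD1 i) //=; congr (_ * _).
    rewrite /node_shift /scale_var ffunE eqxx /= /node /=.
    by case: b {y0 E1} => //; rewrite !invfM !invrK mulrC.
  by apply: eq_bigr => j ji; rewrite /node_shift /scale_var ffunE (negPf ji).
move: (node x (i, b)) y0 E1 E2 => y y0 E1 E2.
have E3 := row_series_funeq y; have := row_series_funeq (q * y)^-1.
have -> : q * (q * y)^-1 = y^-1 by field; nz.
rewrite E1 E2 !rmorphM /= => E4.
transitivity (row_series (q * y) * poly (lin (t * y))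
   * (row_series (q * y)^-1 * poly (lin (q * y)^-1)) * B); first by ring.
by rewrite E3 -E4; ring.
Qed.

Lemma gen_series_dil x :
  dil q (gen_series x) * poly (\prod_j (lin (t * x j) * lin (t / x j)))
  = poly (\prod_j (lin (x j) * lin (x j)^-1)) * gen_series x.
Proof.
rewrite !rmorph_prod -!big_split /=; apply: eq_bigr => j _.
rewrite !rmorphM /= !dil_row_series.
have E1 := row_series_funeq (x j); have E2 := row_series_funeq (x j)^-1.
transitivity (row_series (q * x j) * poly (lin (t * x j))
  * (row_series (q / x j) * poly (lin (t / x j)))); first by ring.
by rewrite E1 E2; ring.
Qed.

Lemma gen_series_dilV x :
  dil q^-1 (gen_series x) * poly (\prod_j (lin (x j / q) * lin ((x j)^-1 / q)))
  = poly (\prod_j (lin (t * x j / q) * lin (t / x j / q))) * gen_series x.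
Proof.
rewrite !rmorph_prod -!big_split /=; apply: eq_bigr => j _.
rewrite !rmorphM /= !dil_row_series !(mulrC q^-1).
have E1 := row_series_funeq (x j / q); have E2 := row_series_funeq ((x j)^-1 / q).
have qq z : q * (z / q) = z by field; nz.
rewrite !qq !mulrA in E1 E2.
transitivity (row_series (x j / q) * poly (lin (x j / q))
  * (row_series ((x j)^-1 / q) * poly (lin ((x j)^-1 / q)))); first by ring.
by rewrite -E1 -E2; ring.
Qed.

Lemma lin_neq0 (c : K) : lin c != 0.
Proof.
apply/eqP => /(congr1 (fun p => p.[0])) /eqP.
by rewrite lin_eval horner0 mulr0 subr0 oner_eq0.
Qed.

Lemma lin_eval0 (c : K) : (lin c).[0] = 1.
Proof. by rewrite lin_eval mulr0 subr0. Qed.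

(* Koornwinder's operator, applied coefficientwise to the generating function,
   acts as a q-difference operator in the expansion variable. *)
Lemma kernel_equation T x : T != 0 -> (0 < n)%N -> regular_point q x ->
  poly ((q * T * t ^+ n)%:P * kernel_den q t) *
    \sum_k poly (koornwinder_coef q t T x k)%:P * (gen_series (node_shift k x) - gen_series x)
  = poly (kernel_plus q t T n) * dil q (gen_series x)
    + poly (kernel_minus q t T) * dil q^-1 (gen_series x)
    + poly (kernel_const q t T n) * gen_series x.
Proof.
move=> T0 n0 hx; have x0 i : x i != 0 by case: hx => /(_ i) [].
have y0 k : node x k != 0 by case: k => i []; rewrite /node /= ?invr_eq0.
set Phi := gen_series x.
have e_shift k : expands Phi (shift_ratio q t (node x k)) (gen_series (node_shift k x)).
  exists (lin (node x k) * lin (t / (q * node x k))).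
  exists (lin (t * node x k) * lin (q * node x k)^-1); split.
  - by rewrite hornerM !lin_eval0 mulr1 oner_neq0.
  - apply: gen_imp (gen_neq0 (mulf_neq0 (lin_neq0 (t * node x k))
      (lin_neq0 (q * node x k)^-1))) _ => z.
    by rewrite /shift_ratio !hornerM !lin_eval => nz0; rewrite divfK.
  - exact: gen_series_shift.
have e_dil : expands Phi (dil_ratio t x) (dil q Phi).
  exists (\prod_j (lin (x j) * lin (x j)^-1)).
  exists (\prod_j (lin (t * x j) * lin (t / x j))); split.
  - by rewrite horner_prod big1 ?oner_neq0 // => j _; rewrite hornerM !lin_eval0 mulr1.
  - have nz0 : \prod_j (lin (t * x j) * lin (t / x j)) != 0.
      by apply/prodf_neq0 => j _; rewrite mulf_neq0 ?lin_neq0.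
    apply: gen_imp (gen_neq0 nz0) _ => z; rewrite !horner_prod => h.
    have pE : \prod_j (lin (t * x j) * lin (t / x j)).[z] =
        \prod_j ((1 - t * x j * z) * (1 - t / x j * z)).
      by apply: eq_bigr => j _; rewrite hornerM !lin_eval.
    rewrite /dil_ratio prodf_div -pE divfK //.
    by apply: eq_bigr => j _; rewrite hornerM !lin_eval.
  - exact: gen_series_dil.
have e_dilV : expands Phi (dilV_ratio q t x) (dil q^-1 Phi).
  exists (\prod_j (lin (t * x j / q) * lin (t / x j / q))).
  exists (\prod_j (lin (x j / q) * lin ((x j)^-1 / q))); split.
  - by rewrite horner_prod big1 ?oner_neq0 // => j _; rewrite hornerM !lin_eval0 mulr1.
  - have nz0 : \prod_j (lin (x j / q) * lin ((x j)^-1 / q)) != 0.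
      by apply/prodf_neq0 => j _; rewrite mulf_neq0 ?lin_neq0.
    apply: gen_imp (gen_neq0 nz0) _ => z; rewrite !horner_prod => h.
    have pE : \prod_j (lin (x j / q) * lin ((x j)^-1 / q)).[z] =
        \prod_j ((1 - x j / q * z) * (1 - (x j)^-1 / q * z)).
      by apply: eq_bigr => j _; rewrite hornerM !lin_eval.
    rewrite /dilV_ratio prodf_div -pE divfK //.
    by apply: eq_bigr => j _; rewrite hornerM !lin_eval.
  - exact: gen_series_dilV.
have e_diff k : expands Phi (fun u => koornwinder_coef q t T x k * (shift_ratio q t (node x k) u - 1))
    (poly (koornwinder_coef q t T x k)%:P * (gen_series (node_shift k x) - Phi)).
  apply: expands_scale.
  have -> : gen_series (node_shift k x) - Phi =
      gen_series (node_shift k x) + poly (-1)%:P * Phi.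
    by rewrite !rmorphN /= mulN1r.
  apply: expands_gen_eq (expands_add (e_shift k) (expands_scale (-1) (expands_id Phi))) _.
  by apply: gen_true => z; rewrite mulr1.
have eL := expands_polyM ((q * T * t ^+ n)%:P * kernel_den q t) (expands_sum e_diff).
have eR := expands_add (expands_add (expands_polyM (kernel_plus q t T n) e_dil)
  (expands_polyM (kernel_minus q t T) e_dilV))
  (expands_polyM (kernel_const q t T n) (expands_id Phi)).
apply: (expands_uniq qinj eL); apply: expands_gen_eq eR _.
have g0 := gen_neq0 (monic_neq0 (monicX K)).
have gh (c : K) : generically (fun u => 1 - c * u ^+ 2 != 0).
  by apply: gen_imp (gen_neq0 (lin2_neq0 c)) _ => z; rewrite lin2_eval.
have gl (c : 'I_n * bool -> K) : generically (fun u => forall k, 1 - c k * u != 0).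
  apply: gen_forall => k.
  by apply: gen_imp (gen_neq0 (lin_neq0 (c k))) _ => z; rewrite lin_eval.
have gall := gen_and g0 (gen_and (gl (fun k => t * node x k))
  (gen_and (gl (fun k => (q * node x k)^-1)) (gen_and (gh t)
  (gen_and (gh (t / q)) (gh (t / q ^+ 2)))))).
apply: (gen_imp gall) => z.
rewrite hornerX => -[h1 [h2 [h3 [h4 [h5 h6]]]]].
rewrite (hornerM _ (kernel_den q t)) hornerC kernel_identity //.
by rewrite mulr1.
Qed.

Lemma koornwinder_opE a b c d T (f : {ffun 'I_n -> K} -> K) x :
  (forall z, (1 - a * z) * (1 - b * z) * (1 - c * z) * (1 - d * z)
             = (1 - T * z ^+ 2) * (1 - q * T * z ^+ 2)) ->
  koornwinder_op a b c d q t T f x =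
  \sum_k koornwinder_coef q t T x k * (f (node_shift k x) - f x).
Proof.
move=> habcd; rewrite /koornwinder_op -big_split /=.
transitivity (\sum_(i < n) \sum_(b0 : bool)
   koornwinder_coef q t T x (i, b0) * (f (node_shift (i, b0) x) - f x)); last first.
  by rewrite pair_big /=; apply: eq_bigr => -[].
apply: eq_bigr => i _; rewrite big_bool /koornwinder_coef /node /node_shift /= !habcd.
congr (_ + _); congr (_ * _ * _).
  by congr (_ / _); rewrite exprVn !div1r.
by apply: eq_bigr => j _; rewrite !div1r; congr (_ * _ / (_ * _)); rewrite ?invfM; ring.
Qed.

End Product.
End GeneratingFunction.

(** * Series in the square of the variable, and the equation satisfied by psi *)

Section EvenSeries.
Variables (K : fieldType) (R : nat).
Implicit Types f g : nat -> K.

(* The series [u ^ R * sum_j f j * u ^ (2 j)]. *)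
Definition even_series f : fps K :=
  Fps (fun N => if (R <= N)%N && ~~ odd (N - R) then f (N - R)./2 else 0).

Definition lin2_coef (c : K) f j := f j - c * (if j is i.+1 then f i else 0).

Lemma eq_even_series f g : f =1 g -> even_series f = even_series g.
Proof. by move=> fg; apply: fpsP => N /=; rewrite fg. Qed.

Lemma even_seriesD f g :
  even_series f + even_series g = even_series (fun j => f j + g j).
Proof. by apply: fpsP => N /=; case: ifP; rewrite ?addr0. Qed.

Lemma fcoefCM (c : K) (f : fps K) N : (fps_of_poly c%:P * f) N = c * f N.
Proof.
rewrite fcoefM big_ord_recl /= coefC subn0 big1 ?addr0 // => i _.
by rewrite coefC mul0r.
Qed.

Lemma even_seriesZ c f :
  fps_of_poly c%:P * even_series f = even_series (fun j => c * f j).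
Proof. by apply: fpsP => N; rewrite fcoefCM /=; case: ifP; rewrite ?mulr0. Qed.

Lemma dil_even_series c f :
  dil c (even_series f) = even_series (fun j => c ^+ (R + 2 * j) * f j).
Proof.
apply: fpsP => N /=; case: ifP => [/andP[RN oN]|]; rewrite ?mulr0 //.
by rewrite mul2n even_halfK // subnKC.
Qed.

Lemma fcoef_lin2 c (f : fps K) N :
  (fps_of_poly (lin2 c) * f) N = f N - c * (if N is m.+2 then f m else 0).
Proof.
have -> : fps_of_poly (lin2 c) = 1 - fps_of_poly c%:P * fps_of_poly 'X^2.
  by rewrite /lin2 rmorphB rmorphM rmorph1.
rewrite mulrBl mul1r -mulrA fcoefB fcoefCM.
congr (_ - _ * _); rewrite fcoefM; case: N => [|[|N]].
- by rewrite big_ord_recl big_ord0 /= coefXn mul0r addr0.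
- by rewrite !big_ord_recl big_ord0 /= !coefXn !mul0r !addr0.
- rewrite !big_ord_recl big1 ?addr0 => [|i _].
    by rewrite /= !coefXn !mul0r !add0r mul1r /bump /= subn2.
  by rewrite /= coefXn mul0r.
Qed.

Lemma lin2_even_series c f :
  fps_of_poly (lin2 c) * even_series f = even_series (lin2_coef c f).
Proof.
apply: fpsP => N; rewrite fcoef_lin2 /=.
have [RN|NR] /= := leqP R N; last first.
  case: N NR => [|[|N]] NR; rewrite ?mulr0 ?subr0 //.
  have -> : (R <= N)%N = false by nlia.
  by rewrite mulr0 subrr.
rewrite -(subnKC RN) addKn; move: (N - R)%N => j {RN N}.
case: j => [|[|j]].
- rewrite addn0 /lin2_coef; case: (R) => [|[|r]] //=.
  have -> : (r.+1 < r)%N = false by nlia.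
  by [].
- rewrite addn1 /=; case: (R) => [|r]; rewrite /= ?mulr0 ?subrr //.
  have -> : (r < r)%N = false by nlia.
  by rewrite mulr0 subrr.
- rewrite !addnS leq_addr addKn /= negbK /lin2_coef.
  by case: ifP => _; rewrite ?mulr0 ?subr0.
Qed.

Lemma lin2_prod_even_series (k a b c : K) f :
  fps_of_poly (k%:P * (lin2 a * lin2 b * lin2 c)) * even_series f =
  even_series (fun j => k * lin2_coef a (lin2_coef b (lin2_coef c f)) j).
Proof.
by rewrite !(rmorphM (@fps_of_poly K)) -!mulrA !lin2_even_series even_seriesZ.
Qed.

Lemma even_seriesN f : - even_series f = even_series (fun j => - f j).
Proof. by apply: fpsP => N /=; case: ifP; rewrite ?oppr0. Qed.

End EvenSeries.

Section PsiEquation.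
Variables (K : fieldType) (q t : K).
Hypotheses (q0 : q != 0) (t0 : t != 0).
Hypothesis hq : forall i, 1 - q ^+ i * q != 0.

Lemma psi_coefS c j : psi_coef q t c j.+1 = psi_coef q t c j *
  ((1 - q ^+ j * (q / t)) * (1 - q ^+ j * c)
   / ((1 - q ^+ j * q) * (1 - q ^+ j * (t * c))) * (t ^+ 2 / q)).
Proof. by rewrite /psi_coef !qpochS (exprSr _ j) !invfM; ring. Qed.

(** [kernel_plus] and [kernel_minus] after conjugation by h: the factors depending on T are replaced
    by those for T = t^2 / q. *)
Definition hat_plus T n : {poly K} := (q * T ^+ 2 * t ^+ (2 * n) / t)%:P
  * (lin2 1 * lin2 q * lin2 (t / q ^+ 2)).
Definition hat_minus : {poly K} := (q * t)%:P
  * (lin2 (t ^+ 2 / q ^+ 3) * lin2 (t ^+ 2 / q ^+ 2) * lin2 t).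

Definition psi_series c R := even_series R (psi_coef q t c).

(** Each psi_R is an eigenfunction of the operator in u. The coefficient of u^(R+2j) involves at
    most four consecutive coefficients of the 2phi1, and the recurrence [psi_coefS] reduces it to an
    identity of rational functions in q^j. *)
Lemma psi_equation n R T c :
  T = t ^+ 2 / q /\ c = t ^+ n * q ^+ R \/
  T = 1 /\ c = t ^+ n * q ^+ R * q / t ^+ 2 -> (forall i, 1 - q ^+ i * (t * c) != 0) ->
  fps_of_poly (hat_plus T n) * dil q (psi_series c R)
  + fps_of_poly hat_minus * dil q^-1 (psi_series c R)
  + fps_of_poly (kernel_const q t T n) * psi_series c R
  = fps_of_poly ((q * T * t ^+ n
      * (c * t / q + q / (c * t) - (T * t ^+ n / t + t / (T * t ^+ n))))%:P
      * kernel_den q t) * psi_series c R.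
Proof.
move=> hTc htc.
have distB (p r : {poly K}) f : fps_of_poly (p - r) * even_series R f =
    fps_of_poly p * even_series R f - fps_of_poly r * even_series R f.
  by rewrite rmorphB mulrBl.
rewrite /psi_series !dil_even_series /hat_plus /hat_minus /kernel_const /kernel_plus
  /kernel_minus /kernel_den !distB.
rewrite !(mulrA (t ^- n)%:P) !(mulrA (t ^+ n)%:P) -!polyCM !lin2_prod_even_series.
rewrite !even_seriesN !even_seriesD; apply: eq_even_series => j.
have f1 i := psi_coefS c i; move: (psi_coef q t c) f1 => f f1.
have t20 : t ^+ 2 != 0 by rewrite expf_neq0.
have tn0 : t ^+ n != 0 by rewrite expf_neq0.
have qR0 : q ^+ R != 0 by rewrite expf_neq0.
have E2 i : q ^+ (R + 2 * i) = q ^+ R * (q ^+ i) ^+ 2 by rewrite exprD mulnC exprM.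
(* Three quadratic factors reach back three coefficients, so j = 0, 1, 2 are boundary cases. *)
case: j => [|[|[|j]]]; rewrite /lin2_coef !(exprVn, E2) (mulnC 2%N n) exprM ?f1 ?exprS ?expr0.
all: move: (t ^+ n) (q ^+ R) tn0 qR0 hTc => s Y s0 Y0 hTc.
(* Here [v] is t^(n-2), possibly with a negative exponent. *)
all: have {}hTc : T = t ^+ 2 / q /\ c = s * Y \/
  exists2 v, v != 0 & [/\ T = 1, s = t ^+ 2 * v & c = v * Y * q].
1,3,5,7: by case: hTc => -[-> ->]; [left | right; exists (s / t ^+ 2);
  rewrite ?mulf_neq0 ?invr_eq0 //; split=> //; field; nz].
- case: hTc => [[-> ->]|[v v0 [-> -> ->]]]; move: (f 0%N) => F; by field; nz.
- have := hq 0%N; have := htc 0%N; rewrite !expr0 !mul1r.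
  by case: hTc => [[-> ->]|[v v0 [-> -> ->]]] h1 h2; move: (f 0%N) => F; field; nz.
- have := hq 0%N; have := htc 0%N; have := hq 1%N; have := htc 1%N.
  rewrite !exprS !expr0 !mul1r.
  by case: hTc => [[-> ->]|[v v0 [-> -> ->]]] h1 h2 h3 h4; move: (f 0%N) => F; field; nz.
- have := hq j; have := htc j; have := hq j.+1; have := htc j.+1.
  have := hq j.+2; have := htc j.+2; rewrite !exprS.
  have x0 : q ^+ j != 0 by rewrite expf_neq0.
  move: (f j) (q ^+ j) x0 => F x x0.
  by case: hTc => [[-> ->]|[v v0 [-> -> ->]]] h1 h2 h3 h4 h5 h6; field; nz.
Qed.
End PsiEquation.

(** * Expansion of the generating function *)

Section BoundedSums.
Variable V : nmodType.

(** Nested sums are brought to one common bound, with the constraints moved into the summands, so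
    that exchanging them involves no dependent ranges. *)
Lemma sum_widen m B (G : nat -> V) : (m <= B)%N ->
  (forall i, (m <= i)%N -> (i < B)%N -> G i = 0) ->
  \sum_(i < m) G i = \sum_(i < B) G i.
Proof.
move=> mB h; rewrite (big_ord_widen _ G mB) big_mkcond /=.
by apply: eq_bigr => -[i /= iB] _; case: ltnP => // /h ->.
Qed.

Lemma sum_only B k (G : nat -> V) : (k < B)%N ->
  \sum_(i < B) (if i == k :> nat then G i else 0) = G k.
Proof. by move=> kB; rewrite -big_mkcond (big_pred1 (Ordinal kB)). Qed.

Lemma sum_shift B j (H : nat -> V) :
  \sum_(p < B) (if (j <= p)%N then H (p - j)%N else 0) =
  \sum_(a < B) (if (a + j < B)%N then H a else 0).
Proof.
rewrite -!big_mkcond.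
rewrite -(big_mkord (fun p => xpredT p && (j <= p)%N) (fun p => H (p - j)%N)).
rewrite -big_nat_widenl // -{1}[j]add0n big_addn big_mkord.
rewrite (big_ord_widen_cond B xpredT (fun i => H (i + j - j)%N) (leq_subr j B)).
by apply: eq_big => [a|a _]; rewrite ?addnK //= ltn_subRL addnC.
Qed.

(* The substitution [p = a + j], [p' = b + j]. *)
Lemma sum_diagonals B s (F : nat -> nat -> nat -> V) : (s < B)%N ->
  \sum_(a < B) \sum_(b < B) \sum_(j < B)
    (if (a + b + 2 * j == s)%N then F a b j else 0) =
  \sum_(p < B) \sum_(p' < B) (if (p + p' == s)%N then
    \sum_(j < (minn p p').+1) F (p - j)%N (p' - j)%N j else 0).
Proof.
move=> sB.
transitivity (\sum_(j < B) \sum_(a < B) \sum_(b < B)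
    (if (a + b + 2 * j == s)%N then F a b j else 0)).
  rewrite [RHS]exchange_big /=; apply: eq_bigr => a _; exact: exchange_big.
transitivity (\sum_(p < B) \sum_(p' < B) \sum_(j < B)
    (if (j <= p)%N then if (j <= p')%N then
     if (p + p' == s)%N then F (p - j)%N (p' - j)%N j else 0 else 0 else 0)); last first.
  apply: eq_bigr => -[p /= pB] _; apply: eq_bigr => -[p' /= p'B] _.
  case: (p + p' =P s)%N => [E|_]; last by rewrite big1 // => j _; do 2 case: ifP => //.
  rewrite -(@sum_widen (minn p p').+1 B (fun j => if (j <= p)%N then if (j <= p')%N
    then F (p - j)%N (p' - j)%N j else 0 else 0)); last first.
  - by move=> i hi _; do 2 case: ifP => //; nlia.
  - by nlia.
  apply: eq_bigr => -[j /= hj] _.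
  by have [-> ->] : (j <= p)%N /\ (j <= p')%N by nlia.
transitivity (\sum_(j < B) \sum_(p < B) \sum_(p' < B)
    (if (j <= p)%N then if (j <= p')%N then
     if (p + p' == s)%N then F (p - j)%N (p' - j)%N j else 0 else 0 else 0)); last first.
  rewrite [LHS]exchange_big /=; apply: eq_bigr => p _; exact: exchange_big.
apply: eq_bigr => -[j /= jB] _.
pose H a := \sum_(b < B) (if (a + b + 2 * j == s)%N then F a b j else 0).
transitivity (\sum_(a < B) (if (a + j < B)%N then H a else 0)).
  apply: eq_bigr => -[a /= aB] _; case: ifP => // ajB.
  by rewrite big1 // => b _; case: eqP => // E; exfalso; nlia.
rewrite -sum_shift; apply: eq_bigr => -[p /= pB] _; case: ifP => jp; last first.
  by rewrite big1.
pose G b := if (p - j + b + 2 * j == s)%N then F (p - j)%N b j else 0.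
transitivity (\sum_(b < B) (if (b + j < B)%N then G b else 0)).
  apply: eq_bigr => -[b /= bB] _; case: (boolP (b + j < B)%N) => // bjB; rewrite /G.
  by case: eqP => // E; exfalso; nlia.
rewrite -sum_shift; apply: eq_bigr => -[p' /= p'B] _; case: ifP => // jp'.
rewrite /G; have -> // : (p - j + (p' - j) + 2 * j = p + p')%N by nlia.
Qed.
End BoundedSums.

Section Convolutions.
Variable K : fieldType.

Lemma fcoefM_bounded B (f g : fps K) r : (r < B)%N -> (f * g) r =
  \sum_(a < B) \sum_(b < B) (if (a + b == r)%N then f a * g b else 0).
Proof.
move=> rB; rewrite fcoefM.
have h a : (a < r.+1)%N ->
    f a * g (r - a)%N = \sum_(b < B) (if (a + b == r)%N then f a * g b else 0).
  move=> ar; rewrite -(@sum_only _ B (r - a) (fun b => f a * g b)); last by nlia.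
  by apply: eq_bigr => b _; have -> : (b == r - a :> nat)%N = (a + b == r)%N by nlia.
rewrite -(@sum_widen _ r.+1 B (fun a => \sum_(b < B) (if (a + b == r)%N then f a * g b else 0))) //.
  by apply: eq_bigr => -[a /= ar] _; exact: h.
by move=> a ra _; rewrite big1 // => b _; case: eqP => // E; exfalso; nlia.
Qed.

Lemma fcoefM3_bounded B (f g h : fps K) r : (r < B)%N -> (f * g * h) r =
  \sum_(a < B) \sum_(b < B) \sum_(N < B)
    (if (a + b + N == r)%N then f a * g b * h N else 0).
Proof.
move=> rB; rewrite -mulrA (fcoefM_bounded _ _ rB); apply: eq_bigr => a _.
transitivity (\sum_(M < B) \sum_(b < B) \sum_(N < B)
  (if (b + N == M)%N then if (a + M == r)%N then f a * g b * h N else 0 else 0)).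
  apply: eq_bigr => M _; case: ifP => _; last first.
    by rewrite big1 // => b _; rewrite big1 // => N _; case: ifP.
  rewrite (fcoefM_bounded _ _ (ltn_ord M)) mulr_sumr; apply: eq_bigr => b _.
  by rewrite mulr_sumr; apply: eq_bigr => N _; case: ifP; rewrite ?mulr0 ?mulrA.
rewrite exchange_big /=; apply: eq_bigr => b _; rewrite exchange_big /=.
apply: eq_bigr => N _; case: (ltnP (b + N) B) => bN.
  have := @sum_only _ B (b + N) (fun M => if (a + M == r)%N then f a * g b * h N else 0) bN.
  by rewrite addnA => <-; apply: eq_bigr => M _; rewrite eq_sym.
rewrite big1 => [|M _]; case: eqP => // E; exfalso.
  by nlia.
by have := ltn_ord M; nlia.
Qed.

Lemma even_series_sum B R (f : nat -> K) N : (N < B)%N ->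
  even_series R f N = \sum_(j < B) (if (R + 2 * j == N)%N then f j else 0).
Proof.
move=> NB /=; case: ifP => [/andP[RN oN]|h].
  rewrite -(@sum_only _ B (N - R)./2 f); last by nlia.
  apply: eq_bigr => j _; have -> // : (j == (N - R)./2 :> nat) = (R + 2 * j == N)%N.
  by nlia.
rewrite big1 // => j _; case: eqP => // E; exfalso; move: h.
by rewrite -E leq_addr addKn mul2n odd_double.
Qed.

End Convolutions.

Section ExpansionStep.
Variables (K : fieldType) (q t x : K).
Hypothesis x0 : x != 0.
Local Notation w := (row_coef q t).

(** One branching step: a and b are the values of theta_1 and theta_(bar 1), and N is the degree in
    the remaining variables. *)
Definition branch_sum (Bw : nat -> nat -> nat -> K) (Q : nat -> K) R : K :=
  \sum_(a < R.+1) \sum_(b < R.+1) \sum_(N < R.+1)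
    (if (a + b + N == R)%N then w a * w b * Bw N a b * (x ^+ a / x ^+ b) * Q N else 0).

Lemma branch_sum_widen Bw Q R B : (R < B)%N -> branch_sum Bw Q R =
  \sum_(a < B) \sum_(b < B) \sum_(N < B)
    (if (a + b + N == R)%N then w a * w b * Bw N a b * (x ^+ a / x ^+ b) * Q N else 0).
Proof.
move=> RB; pose G a b N :=
  if (a + b + N == R)%N then w a * w b * Bw N a b * (x ^+ a / x ^+ b) * Q N else 0.
rewrite /branch_sum -/(G _ _ _).
rewrite (@sum_widen _ R.+1 B (fun a => \sum_(b < R.+1) \sum_(N < R.+1) G a b N)) //; last first.
  move=> a Ra _; rewrite big1 // => b _; rewrite big1 // => N _; rewrite /G.
  by case: eqP => // E; exfalso; nlia.
apply: eq_bigr => a _.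
rewrite (@sum_widen _ R.+1 B (fun b => \sum_(N < R.+1) G a b N)) //; last first.
  move=> b Rb _; rewrite big1 // => N _; rewrite /G.
  by case: eqP => // E; exfalso; nlia.
apply: eq_bigr => b _.
rewrite (@sum_widen _ R.+1 B (G a b)) // => N RN _; rewrite /G.
by case: eqP => // E; exfalso; nlia.
Qed.

(* Both sides of the branching identity count the pairs [(a + j, b + j)]. *)
Lemma expansion_step (Bw : nat -> nat -> nat -> K) (Q : nat -> K) (e e' : nat -> nat -> K)
    (f : fps K) :
  (forall r, f r = \sum_(N < r.+1) Q N * even_series N (e N) r) ->
  (forall N p p', Q N != 0 ->
     \sum_(j < (minn p p').+1) w (p - j) * w (p' - j) * e N j =
     \sum_(j < (minn p p').+1) w (p - j) * w (p' - j)
        * (Bw N (p - j)%N (p' - j)%N * e' (N + (p + p' - 2 * j))%N j)) ->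
  forall r, (row_series q t x * row_series q t x^-1 * f) r =
    \sum_(R < r.+1) branch_sum Bw Q R * even_series R (e' R) r.
Proof.
move=> fE id r; set B := r.+1.
(* A common normal form for both sides: the power of u is N + a + b + 2j, where j counts pairs
   u^2. *)
pose NF (X : nat -> nat -> nat -> nat -> K) := \sum_(N < B) Q N *
  \sum_(a < B) \sum_(b < B) \sum_(j < B)
    (if (a + b + 2 * j == r - N)%N then X N a b j else 0).
transitivity (NF (fun N a b j => w a * w b * (x ^+ a / x ^+ b) * e N j)).
  rewrite (fcoefM3_bounded _ _ _ (ltnSn r)) /NF.
  transitivity (\sum_(a < B) \sum_(b < B) \sum_(N < B) \sum_(j < B)
     (if (a + b + (N + 2 * j) == r)%N then
        w a * x ^+ a * (w b * x^-1 ^+ b) * (Q N * e N j) else 0)).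
    apply: eq_bigr => a _; apply: eq_bigr => b _.
    transitivity (\sum_(M < B) \sum_(N < B) \sum_(j < B) (if (M == N + 2 * j :> nat)%N then
       if (a + b + M == r)%N then w a * x ^+ a * (w b * x^-1 ^+ b) * (Q N * e N j)
       else 0 else 0)).
      apply: eq_bigr => M _; case: ifP => E; last first.
        by rewrite big1 // => N _; rewrite big1 // => j _; case: ifP.
      rewrite fE (@sum_widen _ M.+1 B (fun N => Q N * even_series N (e N) M)) //; last first.
        by move=> N MN _; rewrite /= leqNgt MN mulr0.
      rewrite mulr_sumr; apply: eq_bigr => N _.
      rewrite (even_series_sum _ _ (ltn_ord M)) !mulr_sumr; apply: eq_bigr => j _.
      by rewrite (eq_sym (M : nat)); case: ifP; rewrite ?mulr0.
    rewrite exchange_big /=; apply: eq_bigr => N _; rewrite exchange_big /=.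
    apply: eq_bigr => j _; case: (ltnP (N + 2 * j) B) => NjB.
      exact: (sum_only (fun M => if (a + b + M == r)%N then
        w a * x ^+ a * (w b * x^-1 ^+ b) * (Q N * e N j) else 0) NjB).
    rewrite big1 => [|M _]; case: eqP => // E; exfalso.
      by nlia.
    by have := ltn_ord M; nlia.
  transitivity (\sum_(N < B) \sum_(a < B) \sum_(b < B) \sum_(j < B)
     (if (a + b + (N + 2 * j) == r)%N then
        w a * x ^+ a * (w b * x^-1 ^+ b) * (Q N * e N j) else 0)).
    rewrite [RHS]exchange_big; apply: eq_bigr => a _; exact: exchange_big.
  apply: eq_bigr => N _; rewrite mulr_sumr; apply: eq_bigr => a _.
  rewrite mulr_sumr; apply: eq_bigr => b _; rewrite mulr_sumr; apply: eq_bigr => j _.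
  have -> : (a + b + (N + 2 * j) == r)%N = (a + b + 2 * j == r - N)%N.
    by have := ltn_ord N; nlia.
  by case: ifP; rewrite ?mulr0 // exprVn => _; ring.
transitivity (NF (fun N a b j => w a * w b * (x ^+ a / x ^+ b)
    * (Bw N a b * e' (N + (a + b))%N j))).
  apply: eq_bigr => N _; have [->|QN] := eqVneq (Q N) 0; first by rewrite !mul0r.
  have sB : (r - N < B)%N by rewrite ltnS leq_subr.
  congr (_ * _).
  rewrite (sum_diagonals (fun a b j => w a * w b * (x ^+ a / x ^+ b) * e N j) sB).
  rewrite (sum_diagonals (fun a b j => w a * w b * (x ^+ a / x ^+ b)
    * (Bw N a b * e' (N + (a + b))%N j)) sB).
  apply: eq_bigr => p _; apply: eq_bigr => p' _; case: ifP => // _.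
  have xE j : (j < (minn p p').+1)%N -> x ^+ (p - j) / x ^+ (p' - j) = x ^+ p / x ^+ p'.
    move=> hj; have jp : (j <= p)%N by nlia.
    have jp' : (j <= p')%N by nlia.
    rewrite -{2}(subnK jp) -{2}(subnK jp') !exprD.
    have h1 : x ^+ j != 0 by rewrite expf_neq0.
    have h2 : x ^+ (p' - j) != 0 by rewrite expf_neq0.
    by field; nz.
  transitivity (x ^+ p / x ^+ p' * \sum_(j < (minn p p').+1) w (p - j) * w (p' - j) * e N j).
    by rewrite mulr_sumr; apply: eq_bigr => j _; rewrite xE //; ring.
  rewrite id // mulr_sumr; apply: eq_bigr => j _; rewrite xE //.
  have -> : (p - j + (p' - j) = p + p' - 2 * j)%N by have := ltn_ord j; nlia.
  by ring.
rewrite /NF.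
transitivity (\sum_(N < B) \sum_(a < B) \sum_(b < B) \sum_(j < B)
  (if (a + b + N + 2 * j == r)%N then w a * w b * Bw N a b * (x ^+ a / x ^+ b) * Q N
     * e' (a + b + N)%N j else 0)).
  apply: eq_bigr => N _; rewrite mulr_sumr; apply: eq_bigr => a _.
  rewrite mulr_sumr; apply: eq_bigr => b _; rewrite mulr_sumr; apply: eq_bigr => j _.
  have -> : (a + b + N + 2 * j == r)%N = (a + b + 2 * j == r - N)%N.
    by have := ltn_ord N; nlia.
  by case: ifP; rewrite ?mulr0 // (addnC N) => _; ring.
transitivity (\sum_(a < B) \sum_(b < B) \sum_(N < B) \sum_(j < B)
  (if (a + b + N + 2 * j == r)%N then w a * w b * Bw N a b * (x ^+ a / x ^+ b) * Q N
     * e' (a + b + N)%N j else 0)).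
  rewrite exchange_big; apply: eq_bigr => a _; exact: exchange_big.
symmetry.
transitivity (\sum_(R < B) \sum_(a < B) \sum_(b < B) \sum_(N < B) \sum_(j < B)
  (if (R == a + b + N :> nat)%N then if (R + 2 * j == r)%N then
     w a * w b * Bw N a b * (x ^+ a / x ^+ b) * Q N * e' R j else 0 else 0)).
  apply: eq_bigr => R _; rewrite (branch_sum_widen _ _ (ltn_ord R)).
  rewrite (even_series_sum _ _ (ltnSn r)).
  rewrite mulr_suml; apply: eq_bigr => a _.
  rewrite mulr_suml; apply: eq_bigr => b _.
  rewrite mulr_suml; apply: eq_bigr => N _.
  rewrite mulr_sumr; apply: eq_bigr => j _.
  by rewrite (eq_sym (R : nat)); case: ifP; case: ifP; rewrite ?mulr0 ?mul0r.
rewrite exchange_big /=; apply: eq_bigr => a _; rewrite exchange_big /=.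
apply: eq_bigr => b _; rewrite exchange_big /=; apply: eq_bigr => N _.
rewrite exchange_big /=; apply: eq_bigr => j _.
case: (ltnP (a + b + N) B) => abN.
  exact: (sum_only (fun R => if (R + 2 * j == r)%N then
     w a * w b * Bw N a b * (x ^+ a / x ^+ b) * Q N * e' R j else 0) abN).
rewrite big1 => [|R _]; case: eqP => // E; exfalso.
  by nlia.
by have := ltn_ord R; nlia.
Qed.

End ExpansionStep.

Section RowPolynomials.
Variables (K : fieldType) (q t : K).
Hypotheses (q0 : q != 0) (t0 : t != 0).
Hypothesis hq : forall i, 1 - q ^+ i * q != 0.
Hypothesis hqt : forall m i j, q ^+ j - q ^+ i * t ^+ m.+1 != 0.
Local Notation qp := (qpoch q).
Local Notation poly := fps_of_poly.

(* [tau] is [1] in type C and [q / t ^ 2] in type D. *)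
Definition level (tau : K) n R : K := t ^+ n * q ^+ R * tau.

(** The value of Q_R at a point, given by the branching recursion. In [level] the length is that of
    the whole list, including x, whereas N is the degree in its tail. *)
Fixpoint row_value (tau : K) (xs : seq K) (R : nat) : K :=
  if xs is x :: xs' then
    branch_sum q t x (fun N a b => let c := level tau (size xs) N in
      branch_weight q c (t * c / q) a b) (row_value tau xs') R
  else (R == 0%N)%:R.

(** By the q-binomial theorem these are the coefficients of h = (tau t^2 u^2 / q)_oo / (t^2 u^2 /
    q)_oo: h is 1 in type C and (u^2)_oo / (t^2 u^2 / q)_oo in type D. *)
Definition hat_coef tau j : K := qp tau j / qp q j * (t ^+ 2 / q) ^+ j.
Definition hat_factor tau : fps K := even_series 0 (hat_coef tau).

Definition hat_series tau (xs : seq K) : fps K :=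
  hat_factor tau * \prod_(x <- xs) (row_series q t x * row_series q t x^-1).

Lemma hat_series_cons tau x xs : hat_series tau (x :: xs) =
  row_series q t x * row_series q t x^-1 * hat_series tau xs.
Proof. by rewrite /hat_series big_cons mulrCA. Qed.

Let ht i j : q ^+ j - q ^+ i * t != 0.
Proof. by have := hqt 0 i j; rewrite expr1. Qed.

Let htq m i : 1 - q ^+ i * t ^+ m.+1 != 0.
Proof. by have := hqt m i 0; rewrite expr0. Qed.

Let htqV m i : 1 - q ^+ i * (t ^+ m.+1 / q) != 0.
Proof.
have -> : 1 - q ^+ i * (t ^+ m.+1 / q) = (q ^+ 1 - q ^+ i * t ^+ m.+1) / q.
  by rewrite expr1; field; nz.
by rewrite mulf_neq0 ?invr_eq0.
Qed.

Lemma levelD tau n N k : level tau n (N + k) = level tau n N * q ^+ k.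
Proof. by rewrite /level exprD; ring. Qed.

Lemma levelS tau n N : level tau n.+1 N / t = level tau n N.
Proof. by rewrite /level exprS; field; nz. Qed.

Let step_identity tau n N p p' : tau != 0 ->
  (forall i, 1 - q ^+ i * level tau n.+1 N != 0) ->
  (forall i, 1 - q ^+ i * (t * level tau n.+1 N / q) != 0) ->
  \sum_(j < (minn p p').+1) row_coef q t (p - j) * row_coef q t (p' - j)
     * psi_coef q t (level tau n N) j =
  \sum_(j < (minn p p').+1) row_coef q t (p - j) * row_coef q t (p' - j)
     * (branch_weight q (level tau n.+1 N) (t * level tau n.+1 N / q) (p - j)%N (p' - j)%N
        * psi_coef q t (level tau n.+1 (N + (p + p' - 2 * j))) j).
Proof.
move=> tau0 hc hz; set c := level tau n.+1 N.
have c0 : c != 0 by rewrite /c /level !mulf_neq0 ?expf_neq0.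
have := @branching_identity K q t q0 t0 hq ht c p p' c0 hc hz.
rewrite /c levelS -/c => E.
transitivity (\sum_(j < (minn p p').+1) row_coef q t (p - j) * row_coef q t (p' - j)
  * (qp (q / t) j * qp (level tau n N) j / (qp q j * qp c j) * (t ^+ 2 / q) ^+ j)).
  apply: eq_bigr => j _; rewrite /psi_coef.
  by have -> : t * level tau n N = c by rewrite /c -(levelS tau n N); field; nz.
rewrite E; apply: eq_bigr => j _.
by rewrite branch_weightE // levelD.
Qed.

Lemma expansionC (xs : seq K) r : (forall x, x \in xs -> x != 0) ->
  hat_series 1 xs r = \sum_(R < r.+1)
    row_value 1 xs R * psi_series q t (level 1 (size xs) R) R r.
Proof.
elim: xs r => [|x xs IH] r hx.
  rewrite big_ord_recl [X in _ + X]big1 => [|i _]; last by rewrite /= mul0r.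
  rewrite (_ : row_value 1 [::] _ = 1) // mul1r addr0 /hat_series big_nil mulr1 /hat_factor /psi_series.
  congr (fcoef _ _); apply: eq_even_series => j.
  (* Without variables c = 1, and both sequences are 1, 0, 0, ... because (1)_j vanishes for j >
     0. *)
  rewrite /hat_coef /psi_coef /level !expr0 !mul1r.
  by case: j => [|j]; rewrite ?qpoch0 ?qpoch1_eq0 ?mulr0 ?mul0r ?mulr1.
rewrite hat_series_cons.
apply: (@expansion_step K q t x _ _ _ (fun N => psi_coef q t (level 1 (size xs) N))
  (fun R => psi_coef q t (level 1 (size xs).+1 R))).
- by apply: hx; rewrite mem_head.
- by move=> r'; apply: IH => y yxs; apply: hx; rewrite inE yxs orbT.
- move=> N p p' _; apply: step_identity.
  + exact: oner_neq0.
  + move=> i; have -> : q ^+ i * level 1 (size xs).+1 N = q ^+ (i + N) * t ^+ (size xs).+1.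
      by rewrite /level exprD; ring.
    exact: htq.
  + move=> i; have -> : q ^+ i * (t * level 1 (size xs).+1 N / q) =
        q ^+ (i + N) * (t ^+ (size xs).+2 / q).
      by rewrite /level exprD !exprS; ring.
    exact: htqV.
Qed.

(** The step from no variable to one is the degenerate case z = 1; from the second variable on, the
    branching step is the same as in type C. *)
Lemma expansionD (xs : seq K) r (tau := q / t ^+ 2) : (forall x, x \in xs -> x != 0) -> xs != [::] ->
  hat_series tau xs r = \sum_(R < r.+1)
    row_value tau xs R * psi_series q t (level tau (size xs) R) R r.
Proof.
have tau0 : tau != 0 by rewrite mulf_neq0 ?invr_eq0 ?expf_neq0.
elim: xs r => [|x xs IH] r hx // _.
rewrite hat_series_cons; case: xs IH hx => [_|y xs IH] hx.
  apply: (@expansion_step K q t x _ (fun N a b => branch_weight q (level tau 1 N)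
    (t * level tau 1 N / q) a b) (row_value tau [::]) (fun N => hat_coef tau)
    (fun R => psi_coef q t (level tau 1 R))).
  - by apply: hx; rewrite mem_head.
  - move=> r'; rewrite big_ord_recl [X in _ + X]big1 => [|i _].
      rewrite (_ : row_value tau [::] _ = 1) // mul1r.
      by rewrite addr0 /hat_series big_nil mulr1.
    by rewrite /= mul0r.
  (* Q_N vanishes for N > 0 when there are no variables, so the identity is required for N = 0
     only. *)
  - move=> N p p'; case: N => [_|N]; last by rewrite /= eqxx.
    have c1 : level tau 1 0 = q / t by rewrite /level /tau expr0 expr1; field; nz.
    have := @branching_identity_z1 K q t q0 t0 hq ht p p'.
    rewrite /= c1; have -> : t * (q / t) / q = 1 by field; nz.
    have pqt j : qp (q / t) j != 0.
      apply: qpoch_neq0 => i _.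
      have -> : 1 - q ^+ i * (q / t) = - (q ^+ i.+1 - q ^+ 0 * t) / t.
        by rewrite exprS expr0; field; nz.
      by rewrite mulf_neq0 ?oppr_eq0 ?invr_eq0.
    have pq j : qp q j != 0 by apply: qpoch_neq0.
    move=> E; transitivity (\sum_(j < (minn p p').+1) row_coef q t (p - j) * row_coef q t (p' - j) *
     (qp (q / t) j * qp (q / t / t) j / (qp q j * qp (q / t) j) * (t ^+ 2 / q) ^+ j)).
      apply: eq_bigr => j _; rewrite /hat_coef /tau.
      have -> : q / t ^+ 2 = q / t / t by field; nz.
      have := pq j; have := pqt j => h1 h2.
      by congr (_ * _); field; nz.
    rewrite E; apply: eq_bigr => j _.
    by rewrite add0n -(add0n (p + p' - 2 * j)%N) levelD c1.
set n := (size xs).+1.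
apply: (@expansion_step K q t x _ _ _ (fun N => psi_coef q t (level tau n N))
  (fun R => psi_coef q t (level tau n.+1 R))).
- by apply: hx; rewrite mem_head.
- by move=> r'; apply: IH => // z zxs; apply: hx; rewrite inE zxs orbT.
- move=> N p p' _; apply: step_identity => // i.
  + have -> : q ^+ i * level tau n.+1 N = q ^+ (i + N).+1 * t ^+ (size xs).
      by rewrite /level /tau /n !exprS exprD; field; nz.
    case: (size xs) => [|m]; last exact: htq.
    by rewrite expr0 mulr1 exprSr.
  + have -> : q ^+ i * (t * level tau n.+1 N / q) = q ^+ (i + N) * t ^+ (size xs).+1.
      by rewrite /level /tau /n !exprS exprD; field; nz.
    exact: htq.
Qed.

End RowPolynomials.

(** * The row polynomials as eigenfunctions *)

Section Eigenfunctions.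
Variables (K : fieldType) (q t tau T : K).
Hypotheses (q0 : q != 0) (t0 : t != 0).
Hypothesis hq : forall i, 1 - q ^+ i * q != 0.
Hypothesis hqt : forall m i j, q ^+ j - q ^+ i * t ^+ m.+1 != 0.
Hypothesis qinj : injective (fun i => q ^+ i).
Hypothesis htype : T = t ^+ 2 / q /\ tau = 1 \/ T = 1 /\ tau = q / t ^+ 2.
Local Notation poly := fps_of_poly.

Let T0 : T != 0.
Proof.
by case: htype => -[-> _]; rewrite ?oner_neq0 // mulf_neq0 ?invr_eq0 ?expf_neq0.
Qed.

Let hat_coefS j : hat_coef q t tau j.+1 = hat_coef q t tau j *
  ((1 - q ^+ j * tau) / (1 - q ^+ j * q) * (t ^+ 2 / q)).
Proof. by rewrite /hat_coef !qpochS exprSr !invfM; ring. Qed.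

(** The first-order q-difference equation of h, which converts [kernel_plus] into [hat_plus]. In
    type C, where h = 1, it only says that the two polynomials coincide. *)
Lemma hat_factor_dil : poly (lin2 (t ^+ 2 / T) * lin2 (t ^+ 2 / (q * T))) * hat_factor q t tau
  = poly (lin2 1 * lin2 q) * dil q (hat_factor q t tau).
Proof.
rewrite /hat_factor dil_even_series !(rmorphM (@fps_of_poly K)) -!mulrA !lin2_even_series.
apply: eq_even_series => j; have f1 i := hat_coefS i.
have f0 : hat_coef q t tau 0 = 1 by rewrite /hat_coef !qpoch0 expr0 divr1 mulr1.
move: (hat_coef q t tau) f0 f1 => f f0 f1.
have E i : q ^+ (0 + 2 * i) = (q ^+ i) ^+ 2 by rewrite add0n mulnC exprM.
case: htype => -[-> e]; rewrite e in f1.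
  have fz i : f i.+1 = 0.
    by elim: i => [|i IHi]; rewrite f1 ?expr0 ?mul1r ?subrr ?IHi ?mul0r ?mulr0.
  by case: j => [|[|[|j]]]; rewrite /lin2_coef !E ?fz ?f0 ?exprS ?expr0; field; nz.
case: j => [|[|j]]; rewrite /lin2_coef !E ?f1 ?f0 ?exprS ?expr0.
- by field; nz.
- by have := hq 0%N; rewrite expr0 mul1r => h; field; nz.
- have := hq j; have := hq j.+1; rewrite !exprS.
  have : q ^+ j != 0 by rewrite expf_neq0.
  by move: (q ^+ j) (f j) => x F x0 h1 h2; field; nz.
Qed.

Lemma hat_factor_dilV : poly (lin2 (T / q ^+ 2) * lin2 (T / q)) * hat_factor q t tau
  = poly (lin2 (t ^+ 2 / q ^+ 3) * lin2 (t ^+ 2 / q ^+ 2)) * dil q^-1 (hat_factor q t tau).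
Proof.
rewrite /hat_factor dil_even_series !(rmorphM (@fps_of_poly K)) -!mulrA !lin2_even_series.
apply: eq_even_series => j; have f1 i := hat_coefS i.
have f0 : hat_coef q t tau 0 = 1 by rewrite /hat_coef !qpoch0 expr0 divr1 mulr1.
move: (hat_coef q t tau) f0 f1 => f f0 f1.
have E i : q ^+ (0 + 2 * i) = (q ^+ i) ^+ 2 by rewrite add0n mulnC exprM.
case: htype => -[-> e]; rewrite e in f1.
  have fz i : f i.+1 = 0.
    by elim: i => [|i IHi]; rewrite f1 ?expr0 ?mul1r ?subrr ?IHi ?mul0r ?mulr0.
  by case: j => [|[|[|j]]]; rewrite /lin2_coef !exprVn !E ?fz ?f0 ?exprS ?expr0;
    try have qj0 := expf_neq0 j q0; field; nz.
case: j => [|[|j]]; rewrite /lin2_coef !exprVn !E ?f1 ?f0 ?exprS ?expr0.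
- by field; nz.
- by have := hq 0%N; rewrite expr0 mul1r => h; field; nz.
- have := hq j; have := hq j.+1; rewrite !exprS.
  have : q ^+ j != 0 by rewrite expf_neq0.
  by move: (q ^+ j) (f j) => x F x0 h1 h2; field; nz.
Qed.

Lemma hat_kernel_equation n (x : {ffun 'I_n -> K}) (xs := fun y : {ffun 'I_n -> K} =>
    [seq y i | i <- enum 'I_n]) (G := fun y => hat_series q t tau (xs y)) :
  (0 < n)%N -> regular_point q x ->
  poly ((q * T * t ^+ n)%:P * kernel_den q t) *
    \sum_k poly (koornwinder_coef q t T x k)%:P * (G (node_shift q k x) - G x)
  = poly (hat_plus q t T n) * dil q (G x) + poly (hat_minus q t) * dil q^-1 (G x)
    + poly (kernel_const q t T n) * G x.
Proof.
move=> n0 hx; set h := hat_factor q t tau.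
have GE y : G y = h * gen_series q t y.
  by rewrite /G /hat_series big_map big_enum.
rewrite GE (rmorphM (dil q)) (rmorphM (dil q^-1)).
under eq_bigr do rewrite GE -mulrBr mulrCA.
rewrite -mulr_sumr mulrCA kernel_equation // !mulrDr.
congr (_ + _ + _); last by rewrite mulrCA.
- have E : poly (kernel_plus q t T n) * h = poly (hat_plus q t T n) * dil q h.
    have := hat_factor_dil; rewrite -/h /kernel_plus /hat_plus.
    rewrite !(rmorphM (@fps_of_poly K)) => {}E.
    set k := poly (q * T ^+ 2 * t ^+ (2 * n) / t)%:P; set l := poly (lin2 (t / q ^+ 2)).
    transitivity (k * l * (poly (lin2 (t ^+ 2 / T)) * poly (lin2 (t ^+ 2 / (q * T))) * h)).
      by ring.
    by rewrite E; ring.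
  by rewrite mulrCA mulrA E mulrA.
- have E : poly (kernel_minus q t T) * h = poly (hat_minus q t) * dil q^-1 h.
    have := hat_factor_dilV; rewrite -/h /kernel_minus /hat_minus.
    rewrite !(rmorphM (@fps_of_poly K)) => {}E.
    set k := poly (q * t)%:P; set l := poly (lin2 t).
    transitivity (k * l * (poly (lin2 (T / q ^+ 2)) * poly (lin2 (T / q)) * h)).
      by ring.
    by rewrite E; ring.
  by rewrite mulrCA mulrA E mulrA.
Qed.

Definition row_eigenvalue n R : K :=
  T * t ^+ n * q ^+ R / t + t / (T * t ^+ n * q ^+ R) - (T * t ^+ n / t + t / (T * t ^+ n)).

Lemma fcoefM_low (p f g : fps K) N :
  (forall M, (M <= N)%N -> f M = g M) -> (p * f) N = (p * g) N.
Proof.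
by move=> fg; rewrite !fcoefM; apply: eq_bigr => i _; rewrite fg ?leq_subr.
Qed.

Lemma row_value_eigen n R (x : {ffun 'I_n -> K}) (xs := fun y : {ffun 'I_n -> K} =>
    [seq y i | i <- enum 'I_n]) (P := fun y => row_value q t tau (xs y) R) :
  (0 < n)%N -> regular_point q x ->
  \sum_k koornwinder_coef q t T x k * (P (node_shift q k x) - P x) =
  row_eigenvalue n R * P x.
Proof.
move=> n0 hx; pose Q y R := row_value q t tau (xs y) R.
pose D R := \sum_k koornwinder_coef q t T x k * (Q (node_shift q k x) R - Q x R).
pose c := level q t tau n; pose psi R := psi_series q t (c R) R.
pose G y := hat_series q t tau (xs y).
have x0 i : x i != 0 by case: hx => /(_ i) [].
have sz y : size (xs y) = n by rewrite size_map size_enum_ord.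
have expand (y : {ffun 'I_n -> K}) : (forall i, y i != 0) -> forall N B, (N < B)%N ->
    G y N = (\sum_(R < B) poly (Q y R)%:P * psi R) N.
  move=> y0 N B NB; have ny0 z : z \in xs y -> z != 0 by case/mapP => i _ ->.
  have -> : G y N = \sum_(R < N.+1) Q y R * psi R N.
    rewrite /psi /c -(sz y); case: htype => -[_ e]; rewrite /G /Q e.
      exact: expansionC.
    by apply: expansionD => //; rewrite -size_eq0 sz -lt0n.
  rewrite fcoef_sum (@sum_widen _ N.+1 B (fun R => Q y R * psi R N)) //.
    by apply: eq_bigr => R' _; rewrite fcoefCM.
  by move=> i Ni _; rewrite /= leqNgt Ni mulr0.
have shift0 k : forall i, node_shift q k x i != 0.
  move=> i; rewrite /node_shift /scale_var ffunE; case: ifP => // _.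
  by case: k.2; rewrite mulf_neq0 ?invr_eq0.
pose X : {poly K} := (q * T * t ^+ n)%:P * kernel_den q t.
pose L (f : fps K) : fps K := poly (hat_plus q t T n) * dil q f + poly (hat_minus q t) * dil q^-1 f
    + poly (kernel_const q t T n) * f.
have Lpsi S : L (psi S) = poly X * (poly (row_eigenvalue n S)%:P * psi S).
  have hTc : T = t ^+ 2 / q /\ c S = t ^+ n * q ^+ S \/
      T = 1 /\ c S = t ^+ n * q ^+ S * q / t ^+ 2.
    by rewrite /c /level; case: htype => -[-> ->]; [left|right]; rewrite ?mulr1 ?mulrA.
  have htc i : 1 - q ^+ i * (t * c S) != 0.
    case: hTc => -[_ ->].
      have -> : q ^+ i * (t * (t ^+ n * q ^+ S)) = q ^+ (i + S) * t ^+ n.+1.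
        by rewrite exprD exprS; ring.
      by have := hqt n (i + S) 0; rewrite expr0.
    have -> : q ^+ i * (t * (t ^+ n * q ^+ S * q / t ^+ 2)) = q ^+ (i + S) * q * t ^+ n.-1.
      by rewrite -{1}(prednK n0) exprS exprD; field; nz.
    case: n.-1 => [|m]; first by rewrite expr0 mulr1.
    by have := hqt m (i + S).+1 0; rewrite expr0 exprSr.
  rewrite /L (psi_equation q0 t0 hq hTc htc) /X mulrA -rmorphM; congr (poly _ * _).
  rewrite [RHS]mulrAC -polyCM; congr (_%:P * _); congr (_ * _).
  have tn0 : t ^+ n != 0 by rewrite expf_neq0.
  have qS0 : q ^+ S != 0 by rewrite expf_neq0.
  by rewrite /row_eigenvalue; case: hTc => -[-> ->]; field; nz.
have dilC d (a : K) f : dil d (poly a%:P * f) = poly a%:P * dil d f.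
  rewrite rmorphM; congr (_ * _); apply: fpsP => M /=.
  by rewrite coefC; case: M => [|M] /=; rewrite ?mul1r ?mulr0.
have Lsum B (a : nat -> K) : L (\sum_(S < B) poly (a S)%:P * psi S) =
    \sum_(S < B) poly (a S)%:P * L (psi S).
  rewrite /L !raddf_sum !mulr_sumr -!big_split /=; apply: eq_bigr => S _.
  by rewrite !dilC; ring.
(* The operator never lowers the degree in u, so its coefficients up to u^N can be computed from
   truncated expansions. *)
have Llow (f g : fps K) N : (forall M, (M <= N)%N -> f M = g M) -> L f N = L g N.
  move=> fg; rewrite /L !fcoefD (fcoefM_low _ fg); congr (_ + _ + _);
  by apply: fcoefM_low => M MN /=; rewrite fg.
have key N : (poly X * \sum_(S < N.+1) poly (D S - row_eigenvalue n S * Q x S)%:P * psi S) N = 0.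
  have H := hat_kernel_equation n0 hx; rewrite -/(L _) -/xs in H.
  have E1 : (poly X * \sum_(S < N.+1) poly (D S)%:P * psi S) N = L (G x) N.
    rewrite -H; apply: fcoefM_low => M; rewrite -ltnS => MN.
    rewrite !fcoef_sum; under [RHS]eq_bigr => k _.
      rewrite fcoefCM fcoefB (expand _ (shift0 k) _ _ MN) (expand _ x0 _ _ MN).
      rewrite -fcoefB -sumrB fcoef_sum mulr_sumr; over.
    rewrite [RHS]exchange_big; apply: eq_bigr => S _.
    rewrite fcoefCM /D mulr_suml; apply: eq_bigr => k _.
    by rewrite fcoefB !fcoefCM; ring.
  have E2 : L (G x) N = (poly X * \sum_(S < N.+1) poly (row_eigenvalue n S * Q x S)%:P * psi S) N.
    rewrite (Llow _ (\sum_(S < N.+1) poly (Q x S)%:P * psi S)).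
      rewrite Lsum mulr_sumr; congr (fcoef _ _); apply: eq_bigr => S _.
      by rewrite Lpsi polyCM (rmorphM (@fps_of_poly K)); ring.
    by move=> M MN; apply: expand.
  have -> : \sum_(S < N.+1) poly (D S - row_eigenvalue n S * Q x S)%:P * psi S =
      \sum_(S < N.+1) poly (D S)%:P * psi S
      - \sum_(S < N.+1) poly (row_eigenvalue n S * Q x S)%:P * psi S.
    by rewrite -sumrB; apply: eq_bigr => S _; rewrite polyCB rmorphB mulrBl.
  by rewrite mulrBr fcoefB E1 E2 subrr.
suff delta0 S : D S - row_eigenvalue n S * Q x S = 0.
  by apply/eqP; rewrite -subr_eq0; apply/eqP; exact: delta0.
(* Since psi_N starts at u^N and X has constant term q T t^n, the coefficient of u^N isolates the
   defect of Q_N once those of lower index vanish. *)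
elim/ltn_ind: S => N IH.
have E : \sum_(S < N.+1) poly (D S - row_eigenvalue n S * Q x S)%:P * psi S =
    poly (D N - row_eigenvalue n N * Q x N)%:P * psi N.
  rewrite big_ord_recr /= big1 ?add0r // => S _.
  by rewrite IH ?ltn_ord // rmorph0 mul0r.
have := key N; rewrite E fcoefM big_ord_recl big1 ?addr0 => [|i _]; last first.
  rewrite fcoefCM /=; have -> : (N <= N - bump 0 i)%N = false.
    by have := ltn_ord i; rewrite /bump; nlia.
  by rewrite !mulr0.
rewrite subn0 fcoefCM /= leqnn subnn /= /psi_coef !qpoch0 expr0 !mulr1 divr1 mulr1.
rewrite -horner_coef0 /X hornerM hornerC /kernel_den !hornerM !lin2_eval.
rewrite expr0n /= !mulr0 subr0 !mulr1 => /eqP.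
rewrite mulf_eq0 (negPf (mulf_neq0 (mulf_neq0 q0 T0) (expf_neq0 n t0))) /=.
by move/eqP.
Qed.
End Eigenfunctions.

(** * The explicit sums as iterated branching *)

Section FamilySums.
Variables (K : fieldType) (q t : K) (B : nat).
Hypotheses (q0 : q != 0) (t0 : t != 0).
Hypothesis hq : forall i, 1 - q ^+ i * q != 0.
Hypothesis hqt : forall m i j, q ^+ j - q ^+ i * t ^+ m.+1 != 0.
Local Notation qp := (qpoch q).

(** The bound B on the entries stays fixed while the sum of the family decreases, so the recursion
    on n does not change the range of the entries. *)
Definition family_cons n (a b : 'I_B.+1) (th : row_family n B) : row_family n.+1 B :=
  [ffun k => match k with
    | inl i => if unlift ord0 i is Some j then th (inl j) else a
    | inr i => if unlift ord0 i is Some j then th (inr j) else b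
    end].

Section Cons.
Variables (n : nat) (a b : 'I_B.+1) (th : row_family n B).
Let th' := family_cons a b th.

Lemma family_cons_inl0 : th' (inl ord0) = a. Proof. by rewrite ffunE unlift_none. Qed.
Lemma family_cons_inr0 : th' (inr ord0) = b. Proof. by rewrite ffunE unlift_none. Qed.
Lemma family_cons_inl l : th' (inl (lift ord0 l)) = th (inl l).
Proof. by rewrite ffunE liftK. Qed.
Lemma family_cons_inr l : th' (inr (lift ord0 l)) = th (inr l).
Proof. by rewrite ffunE liftK. Qed.

Lemma th_sum_cons : th_sum th' = (a + b + th_sum th)%N.
Proof.
rewrite /th_sum !big_sumType /= !big_ord_recl family_cons_inl0 family_cons_inr0 addnACA.
congr (_ + _)%N; congr (_ + _)%N; apply: eq_bigr => l _.
  by rewrite family_cons_inl.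
by rewrite family_cons_inr.
Qed.

Lemma th_after_cons0 : th_after th' ord0 = th_sum th.
Proof.
rewrite /th_after /th_sum big_sumType /= -big_split /= big_mkcond big_ord_recl /= add0n.
by apply: eq_bigr => l _; rewrite family_cons_inl family_cons_inr.
Qed.

Lemma th_from_cons0 : th_from th' ord0 = (a + th_sum th)%N.
Proof.
rewrite /th_from /th_sum big_sumType /= big_ord_recl family_cons_inl0 -addnA.
congr (_ + (_ + _))%N; first by apply: eq_bigr => l _; rewrite family_cons_inl.
rewrite big_mkcond big_ord_recl /= add0n.
by apply: eq_bigr => l _; rewrite family_cons_inr.
Qed.

Lemma th_after_cons l : th_after th' (lift ord0 l) = th_after th l.
Proof.
rewrite /th_after big_mkcond big_ord_recl /= add0n [RHS]big_mkcond.
by apply: eq_bigr => k _; rewrite /bump !leq0n !add1n ltnS family_cons_inl family_cons_inr.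
Qed.

Lemma th_from_cons l : th_from th' (lift ord0 l) = th_from th l.
Proof.
rewrite /th_from big_mkcond big_ord_recl /= add0n [in RHS]big_mkcond.
congr (_ + _)%N.
  by apply: eq_bigr => k _; rewrite /bump !leq0n !add1n ltnS family_cons_inl.
rewrite big_mkcond big_ord_recl /= add0n [in RHS]big_mkcond.
by apply: eq_bigr => k _; rewrite /bump !leq0n !add1n ltnS family_cons_inr.
Qed.

Lemma th_weight_cons :
  th_weight th' q t = row_coef q t a * row_coef q t b * th_weight th q t.
Proof.
rewrite /th_weight !big_sumType /= !big_ord_recl family_cons_inl0 family_cons_inr0 mulrACA.
congr (_ * _); congr (_ * _); apply: eq_bigr => l _.
  by rewrite family_cons_inl.
by rewrite family_cons_inr.
Qed.

End Cons.

Lemma family_reindex (V : nmodType) n (F : row_family n.+1 B -> V) :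
  \sum_th F th = \sum_(a < B.+1) \sum_(b < B.+1) \sum_(th : row_family n B) F (family_cons a b th).
Proof.
rewrite (reindex (fun p : 'I_B.+1 * 'I_B.+1 * row_family n B => family_cons p.1.1 p.1.2 p.2)).
  by rewrite pair_bigA /= pair_bigA.
exists (fun th : row_family n.+1 B => (th (inl ord0), th (inr ord0),
    [ffun k : 'I_n + 'I_n => match k with
    | inl i => th (inl (lift ord0 i)) | inr i => th (inr (lift ord0 i)) end])).
  move=> [[a b] th] _ /=; rewrite family_cons_inl0 family_cons_inr0; congr (_, _, _).
  by apply/ffunP => -[i|i]; rewrite ffunE ?family_cons_inl ?family_cons_inr.
move=> th _; apply/ffunP => -[i|i]; rewrite ffunE /=;
  by case: unliftP => [j|] ->; rewrite ?ffunE.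
Qed.

Definition family_monomial n (x : {ffun 'I_n -> K}) (th : row_family n B) : K :=
  \prod_(i < n) x i ^ th_exponent th i.

Definition ffun_tail n (x : {ffun 'I_n.+1 -> K}) : {ffun 'I_n -> K} :=
  [ffun i => x (lift ord0 i)].

Lemma family_monomial_cons n (x : {ffun 'I_n.+1 -> K}) a b th : x ord0 != 0 ->
  family_monomial x (family_cons a b th) =
  x ord0 ^+ a / x ord0 ^+ b * family_monomial (ffun_tail x) th.
Proof.
move=> x0; rewrite /family_monomial big_ord_recl; congr (_ * _).
  by rewrite ffunE family_cons_inl0 family_cons_inr0 expfzDr // -exprnN.
by apply: eq_bigr => i _; rewrite [th_exponent _ _]ffunE family_cons_inl family_cons_inr !ffunE.
Qed.

Section Recursion.
Variables (tau : K) (fac : forall n, row_family n B -> K).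
Hypothesis fac0 : forall th : row_family 0 B, fac th = 1.
Hypothesis facS : forall n a b (th : row_family n B), fac (family_cons a b th) =
  (let c := level q t tau n.+1 (th_sum th) in branch_weight q c (t * c / q) a b) * fac th.

(** The function [fac] is abstract so that it can carry the indicator of theta_n theta_(bar n) = 0
    in type D as well as the products of factors. *)
Lemma family_sum n (x : {ffun 'I_n -> K}) N : (forall i, x i != 0) -> (N <= B)%N ->
  \sum_(th : row_family n B | th_sum th == N) th_weight th q t * fac th * family_monomial x th
  = row_value q t tau [seq x i | i <- enum 'I_n] N.
Proof.
elim: n x N => [|n IH] x N x0 NB.
  have allE (th : row_family 0 B) : th = [ffun=> ord0] by apply/ffunP => -[[]|[]].
  have -> : enum 'I_0 = [::] by apply: size0nil; rewrite size_enum_ord.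
  rewrite big_mkcond (big_pred1 [ffun=> ord0]) => [|th]; last by rewrite /= [th]allE eqxx.
  rewrite fac0 /th_sum /th_weight /family_monomial !big_sumType !big_ord0 !mulr1 /=.
  by rewrite addn0 mulr1; case: N {NB} => [|N].
rewrite enum_ordSl /= big_mkcond family_reindex.
set tl := [seq x i | i <- [seq lift ord0 i | i <- enum 'I_n]].
have sz : size tl = n by rewrite /tl 2!size_map size_enum_ord.
pose g (th : row_family n B) := th_weight th q t * fac th * family_monomial (ffun_tail x) th.
have gE M : (M <= B)%N -> \sum_(th | th_sum th == M) g th = row_value q t tau tl M.
  move=> MB; rewrite IH // => [|i]; last by rewrite ffunE.
  by congr row_value; rewrite /tl -[RHS]map_comp; apply: eq_map => i; rewrite /= ffunE.
rewrite (branch_sum_widen q t (x ord0) _ _ (NB : (N < B.+1)%N)) sz.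
apply: eq_bigr => a _; apply: eq_bigr => b _.
transitivity (\sum_(M < B.+1) \sum_(th : row_family n B)
  (if (M == th_sum th :> nat)%N then if (a + b + M == N)%N then
     row_coef q t a * row_coef q t b * branch_weight q (level q t tau n.+1 M)
       (t * level q t tau n.+1 M / q) a b * (x ord0 ^+ a / x ord0 ^+ b) * g th else 0 else 0)).
  rewrite exchange_big /=; apply: eq_bigr => th _; rewrite th_sum_cons.
  case: (ltnP (th_sum th) B.+1) => thB.
    rewrite (sum_only (fun M => if (a + b + M == N)%N then
     row_coef q t a * row_coef q t b * branch_weight q (level q t tau n.+1 M)
       (t * level q t tau n.+1 M / q) a b * (x ord0 ^+ a / x ord0 ^+ b) * g th else 0) thB).
    case: eqP => // _; rewrite th_weight_cons facS family_monomial_cons // /g /=; ring.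
  rewrite big1 => [|M _]; case: eqP => // E; exfalso.
    by nlia.
  by have := ltn_ord M; nlia.
apply: eq_bigr => M _; case: ifP => MN; last first.
  by rewrite big1 // => th _; case: ifP.
rewrite -gE; last by rewrite -ltnS.
rewrite mulr_sumr [RHS]big_mkcond /=; apply: eq_bigr => th _.
by rewrite eq_sym.
Qed.

End Recursion.
End FamilySums.

Section LaurentEvaluation.
Variables (K : fieldType) (n : nat).
Implicit Types (P : laurent K n) (x : {ffun 'I_n -> K}).

Definition monomial_value x (m : {ffun 'I_n -> int}) : K := \prod_(i < n) x i ^ m i.

Lemma levalE P x : leval P x = mmap idfun (monomial_value x) P.
Proof. by []. Qed.

Lemma levalB P P' x : leval (P - P') x = leval P x - leval P' x.
Proof. by rewrite !levalE raddfB. Qed.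

Lemma leval_sum (I : Type) (r : seq I) (A : pred I) (F : I -> laurent K n) x :
  leval (\sum_(i <- r | A i) F i) x = \sum_(i <- r | A i) leval (F i) x.
Proof. by rewrite levalE raddf_sum. Qed.

Lemma levalU (c : K) m x : leval << c *g m >> x = c * monomial_value x m.
Proof. by rewrite levalE mmapU. Qed.

Lemma levalZ (c : K) P x : leval (c *: P) x = c * leval P x.
Proof.
rewrite !levalE (mmapEw (msuppZ_le _ _)) mmapE big_distrr /=.
by apply/eq_bigr => k _; rewrite mcoeffZ mulrA.
Qed.

End LaurentEvaluation.

Section RowSums.
Variables (K : fieldType) (q t : K).
Hypotheses (q0 : q != 0) (t0 : t != 0).
Hypothesis hq : forall i, 1 - q ^+ i * q != 0.
Hypothesis hqt : forall m i j, q ^+ j - q ^+ i * t ^+ m.+1 != 0.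
Local Notation qp := (qpoch q).

Let htq m i : 1 - q ^+ i * t ^+ m.+1 != 0.
Proof. by have := hqt m i 0; rewrite expr0. Qed.

Let htqV m i : 1 - q ^+ i * (t ^+ m.+1 / q) != 0.
Proof.
have -> : 1 - q ^+ i * (t ^+ m.+1 / q) = (q ^+ 1 - q ^+ i * t ^+ m.+1) / q.
  by rewrite expr1; field; nz.
by rewrite mulf_neq0 ?invr_eq0.
Qed.

(** Splitting (c)_(a+b) = (c)_a (q^a c)_b, and likewise for z, leaves exactly the four symbols of
    [factorC] and [factorD]. *)
Lemma branch_weight_split c z a b :
  (forall i, 1 - q ^+ i * c != 0) -> (forall i, 1 - q ^+ i * z != 0) ->
  qp (q ^+ a * c) b * qp z b / (qp (q ^+ a * z) b * qp c b) = branch_weight q c z a b.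
Proof.
move=> hc hz; rewrite branch_weightE // /branch_coef !qpochD.
have pc k : qp c k != 0 by exact: qpoch_neq0.
have pz k : qp z k != 0 by exact: qpoch_neq0.
have h : qp (q ^+ a * z) b != 0.
  by apply: qpoch_neq0 => i _; rewrite mulrA -exprD.
by have := pc a; have := pc b; have := pz a; have := pz b => h1 h2 h3 h4; field; nz.
Qed.

Section Factors.
Variables (B n : nat) (a b : 'I_B.+1) (th : row_family n B).

Lemma factorC_cons l :
  factorC (family_cons a b th) q t (lift ord0 l) = factorC th q t l.
Proof. by rewrite /factorC th_from_cons th_after_cons family_cons_inr /= /bump leq0n add1n !subSS. Qed.

Lemma factorD_cons l :
  factorD (family_cons a b th) q t (lift ord0 l) = factorD th q t l.
Proof. by rewrite /factorD th_from_cons th_after_cons family_cons_inr /= /bump leq0n add1n !subSS. Qed.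

Let qX0 i : q ^+ i != 0. Proof. by rewrite expf_neq0. Qed.

Lemma factorC_cons0 (c := level q t 1 n.+1 (th_sum th)) :
  factorC (family_cons a b th) q t ord0 = branch_weight q c (t * c / q) a b.
Proof.
rewrite /factorC th_from_cons0 th_after_cons0 family_cons_inr0 subSS subn0.
rewrite !expfzDr // -!exprnP (_ : q ^ (-1) = q^-1) // addn1 addn2 exprD !exprS.
have hN i : q ^+ (i + th_sum th) = q ^+ i * q ^+ th_sum th by rewrite exprD.
have cE : c = t * t ^+ n * q ^+ th_sum th by rewrite /c /level exprS mulr1.
rewrite cE -branch_weight_split; first last.
- move=> i; have -> : q ^+ i * (t * (t * t ^+ n * q ^+ th_sum th) / q)
      = q ^+ (i + th_sum th) * (t ^+ n.+2 / q).
    rewrite hN !exprS; move: (q ^+ i) (t ^+ n) (q ^+ th_sum th) => u v w.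
    by rewrite !mulrA; congr (_ / _); ring.
  exact: htqV.
- move=> i; have -> : q ^+ i * (t * t ^+ n * q ^+ th_sum th) = q ^+ (i + th_sum th) * t ^+ n.+1.
    rewrite hN exprS; move: (q ^+ i) (t ^+ n) (q ^+ th_sum th) => u v w; ring.
  exact: htq.
move: (q ^+ a) (t ^+ n) (q ^+ th_sum th) => u v w.
congr (qp _ _ * qp _ _ / (qp _ _ * qp _ _)); ring.
Qed.

Lemma factorD_cons0 (c := level q t (q / t ^+ 2) n.+1 (th_sum th)) : (0 < n)%N ->
  factorD (family_cons a b th) q t ord0 = branch_weight q c (t * c / q) a b.
Proof.
move=> n0; have tE : t ^+ n = t * t ^+ n.-1 by rewrite -exprS prednK.
rewrite /factorD th_from_cons0 th_after_cons0 family_cons_inr0 subSS subn0 !addn1 subn1.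
rewrite !(exprS q) exprD.
have hN i : q ^+ (i + th_sum th) = q ^+ i * q ^+ th_sum th by rewrite exprD.
have cE : c = t ^+ n.-1 * (q * q ^+ th_sum th).
  rewrite /c /level exprS tE; move: (t ^+ n.-1) (q ^+ th_sum th) => u v.
  by field; nz.
have zE : t * c / q = t * t ^+ n.-1 * q ^+ th_sum th.
  rewrite cE; move: (t ^+ n.-1) (q ^+ th_sum th) => u v.
  by field; nz.
rewrite zE cE -branch_weight_split; first last.
- move=> i; rewrite -exprS.
  have -> : q ^+ i * (t ^+ n.-1.+1 * q ^+ th_sum th) = q ^+ (i + th_sum th) * t ^+ n.-1.+1.
    rewrite hN; move: (q ^+ i) (t ^+ n.-1.+1) (q ^+ th_sum th) => u v w; ring.
  exact: htq.
- move=> i; have -> : q ^+ i * (t ^+ n.-1 * (q * q ^+ th_sum th)) =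
      q ^+ (i + th_sum th) * q * t ^+ n.-1.
    rewrite hN; move: (q ^+ i) (t ^+ n.-1) (q ^+ th_sum th) => u v w; ring.
  case: (n.-1) => [|m]; last by rewrite -exprSr; exact: htq.
  by rewrite expr0 mulr1.
rewrite tE; move: (q ^+ a) (t ^+ n.-1) (q ^+ th_sum th) => u v w.
congr (qp _ _ * qp _ _ / (qp _ _ * qp _ _)); ring.
Qed.

Lemma th_last_zero_cons : (0 < n)%N -> th_last_zero (family_cons a b th) = th_last_zero th.
Proof.
move=> n0; apply/forallP/forallP => h k.
  by have := h (lift ord0 k); rewrite family_cons_inl family_cons_inr /= /bump leq0n add1n eqSS.
case: (unliftP ord0 k) => [j ->|->].
  by rewrite family_cons_inl family_cons_inr /= /bump leq0n add1n eqSS; exact: h.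
by apply/implyP; rewrite eqSS /= => /eqP E; exfalso; move: n0; clear -E; nlia.
Qed.

End Factors.

Lemma leval_row_sumC n r (x : {ffun 'I_n -> K}) : (forall i, x i != 0) ->
  leval (row_sumC n r q t) x =
  qp q r / qp t r * row_value q t 1 [seq x i | i <- enum 'I_n] r.
Proof.
move=> x0; rewrite /row_sumC levalZ leval_sum; congr (_ * _).
under eq_bigr do rewrite levalU.
pose fac m (th : row_family m r) := \prod_(l < m) factorC th q t l.
apply: (@family_sum K q t r 1 fac _ _ n x r x0 (leqnn r)) => [th|m a b th].
  by rewrite /fac big_ord0.
rewrite /fac big_ord_recl factorC_cons0; congr (_ * _).
by apply: eq_bigr => l _; rewrite factorC_cons.
Qed.

Lemma leval_row_sumD n r (x : {ffun 'I_n -> K}) : (forall i, x i != 0) ->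
  leval (row_sumD n r q t) x =
  qp q r / qp t r * row_value q t (q / t ^+ 2) [seq x i | i <- enum 'I_n] r.
Proof.
move=> x0; rewrite /row_sumD levalZ leval_sum; congr (_ * _).
pose fac m (th : row_family m r) := (th_last_zero th)%:R *
  \prod_(l < m | (l.+1 < m)%N) factorD th q t l.
rewrite -(@family_sum K q t r (q / t ^+ 2) fac _ _ n x r x0 (leqnn r)) => [|th|m a b th].
- rewrite [in RHS](bigID (fun th => th_last_zero th)) /= [X in _ = _ + X]big1; last first.
    by move=> th /andP[_ /negPf h]; rewrite /fac h mul0r mulr0 mul0r.
  by rewrite addr0; apply: eq_bigr => th /andP[_ h]; rewrite levalU /fac h mul1r.
- rewrite /fac big_ord0 (_ : th_last_zero th) ?mulr1 //.
  by apply/forallP => -[].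
- rewrite /fac big_mkcond big_ord_recl.
  have -> : \prod_(i < m) (if ((lift ord0 i).+1 < m.+1)%N then
      factorD (family_cons a b th) q t (lift ord0 i) else 1) =
      \prod_(l < m | (l.+1 < m)%N) factorD th q t l.
    rewrite [RHS]big_mkcond; apply: eq_bigr => l _.
    by rewrite /= /bump leq0n add1n ltnS factorD_cons.
  (* The last variable has no factor in type D; its weight at z = 1 is the indicator of theta_n
     theta_(bar n) = 0. *)
  case: (posnP m) => [m0|m0]; last first.
    rewrite /= ltnS m0 factorD_cons0 // th_last_zero_cons //; ring.
  subst m; rewrite big_ord0 !mulr1 /=.
  have -> : th_last_zero th by apply/forallP => -[].
  have sum0 : th_sum th = 0%N by rewrite /th_sum big_sumType !big_ord0.
  rewrite sum0 (_ : level q t (q / t ^+ 2) 1 0 = q / t); last first.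
    by rewrite /level expr0 expr1; field; nz.
  have -> : t * (q / t) / q = 1 by field; nz.
  rewrite branch_weight1 !mulr1; congr (nat_of_bool _)%:R; apply/idP/idP => [/forallP/(_ ord0)|h].
    by rewrite family_cons_inl0 family_cons_inr0 muln_eq0.
  apply/forallP => k.
  by rewrite (ord1 k) family_cons_inl0 family_cons_inr0 muln_eq0 h implybT.
Qed.

End RowSums.

(** * Uniqueness *)

Section Genericity.
Variables (K : fieldType) (q t : K).
Hypothesis hgen : generic q t.

Definition gen_eval (F : {poly {poly int}}) : K :=
  (map_poly (map_poly intr) F).[t%:P].[q].

Definition bimonomial (i j : nat) : {poly {poly int}} := ('X^j)%:P * 'X^i.

Lemma gen_evalD F G : gen_eval (F + G) = gen_eval F + gen_eval G.
Proof. by rewrite /gen_eval rmorphD /= !hornerD. Qed.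
Lemma gen_evalB F G : gen_eval (F - G) = gen_eval F - gen_eval G.
Proof. by rewrite /gen_eval rmorphB /= !(hornerD, hornerN). Qed.
Lemma gen_eval_sum (I : Type) (r : seq I) (F : I -> {poly {poly int}}) :
  gen_eval (\sum_(i <- r) F i) = \sum_(i <- r) gen_eval (F i).
Proof.
apply: (big_morph gen_eval gen_evalD).
by rewrite /gen_eval rmorph0 !horner0.
Qed.

Lemma gen_eval_bimonomial i j : gen_eval (bimonomial i j) = t ^+ i * q ^+ j.
Proof.
rewrite /gen_eval /bimonomial rmorphM /= map_polyC /= !map_polyXn.
by rewrite !hornerE mulrC.
Qed.

Lemma bimonomial_coef i j k l : (bimonomial i j)`_k`_l = ((k == i) && (l == j))%:R.
Proof.
rewrite /bimonomial coefCM coefXn; case: (k == i); rewrite ?mulr1 ?mulr0 ?coefXn ?coef0 //.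
Qed.

Lemma gen_eval_neq0 (F : {poly {poly int}}) k l : F`_k`_l != 0 -> gen_eval F != 0.
Proof. by move=> h; apply: hgen; apply: contraNneq h => ->; rewrite !coef0. Qed.

Lemma gen_bimonomial_neq i j k l : (i, j) != (k, l) -> t ^+ i * q ^+ j - t ^+ k * q ^+ l != 0.
Proof.
move=> h; rewrite -!gen_eval_bimonomial -gen_evalB; apply: (@gen_eval_neq0 _ i j).
by rewrite !coefB !bimonomial_coef !eqxx -xpair_eqE (negPf h) subr0 oner_neq0.
Qed.

Lemma generic_q0 : q != 0.
Proof.
have := @gen_eval_neq0 (bimonomial 0 1) 0 1.
by rewrite bimonomial_coef gen_eval_bimonomial mul1r; apply; rewrite oner_neq0.
Qed.

Lemma generic_t0 : t != 0.
Proof.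
have := @gen_eval_neq0 (bimonomial 1 0) 1 0.
by rewrite bimonomial_coef gen_eval_bimonomial mulr1; apply; rewrite oner_neq0.
Qed.

Lemma generic_q i : 1 - q ^+ i * q != 0.
Proof. by have := @gen_bimonomial_neq 0 0 0 i.+1 isT; rewrite !mul1r exprSr. Qed.

Lemma generic_qt m i j : q ^+ j - q ^+ i * t ^+ m.+1 != 0.
Proof. by have := @gen_bimonomial_neq 0 j m.+1 i isT; rewrite !mul1r mulrC. Qed.

Lemma generic_qinj : injective (fun i => q ^+ i).
Proof.
move=> i j /= E; apply/eqP; apply: contraT => ij.
have := @gen_bimonomial_neq 0 i 0 j; rewrite xpair_eqE eqxx /= E subrr eqxx.
by move=> /(_ ij).
Qed.

Lemma expz_absz (k : int) : (0 <= k)%R -> q ^+ absz k = q ^ k.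
Proof. by case: k. Qed.

(** Exponents of t ([sep_up], [sep_dn]) and of q ([sep_pos], [sep_neg]) in the eigenvalue terms T
    t^(n-i) q^k and their inverses, after multiplication by t^(n+s) q^(r+1), which makes all of them
    nonnegative. *)
Definition sep_up (n s i : nat) := (n + s + (n - i + s))%N.
Definition sep_dn (n s i : nat) := (n + s - (n - i + s))%N.
Definition sep_pos (r sg : nat) (k : int) := absz ((r.+1)%:Z + k - sg%:Z)%R.
Definition sep_neg (r sg : nat) (k : int) := absz ((r.+1)%:Z - k + sg%:Z)%R.

Definition sep_term n s r sg i k :=
  bimonomial (sep_up n s i) (sep_pos r sg k) - bimonomial (sep_up n s i) (sep_pos r sg 0)
  + (bimonomial (sep_dn n s i) (sep_neg r sg k) - bimonomial (sep_dn n s i) (sep_neg r sg 0)).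

Lemma sep_pos_ge0 r sg (k : int) : (sg <= 1)%N -> (`|k|%N <= r)%N ->
  (0 <= (r.+1)%:Z + k - sg%:Z)%R.
Proof. clear; lia. Qed.
Lemma sep_neg_ge0 r sg (k : int) : (`|k|%N <= r)%N -> (0 <= (r.+1)%:Z - k + sg%:Z)%R.
Proof. clear; lia. Qed.

Lemma gen_eval_sep_term n s r sg i (k : int) (T := t ^+ s / q ^+ sg) :
  (sg <= 1)%N -> (i <= n)%N -> (`|k|%N <= r)%N ->
  gen_eval (sep_term n s r sg i k) = t ^+ (n + s) * q ^+ r.+1 *
    (T * t ^+ (n - i) * (q ^ k - 1) + (T * t ^+ (n - i))^-1 * (q ^ (- k) - 1)).
Proof.
move=> sg1 ni kr; rewrite gen_evalD !gen_evalB !gen_eval_bimonomial.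
have q0 := generic_q0; have t0 := generic_t0.
have Pq (l : int) : (`|l|%N <= r)%N -> q ^+ sep_pos r sg l = q ^+ r.+1 * q ^ l / q ^+ sg.
  by move=> lr; rewrite expz_absz ?sep_pos_ge0 // !expfzDr // -exprnN.
have Nq (l : int) : (`|l|%N <= r)%N -> q ^+ sep_neg r sg l = q ^+ r.+1 * q ^ (- l) * q ^+ sg.
  by move=> lr; rewrite expz_absz ?sep_neg_ge0 // !expfzDr.
rewrite !Pq // !Nq // oppr0 expr0z.
have -> : t ^+ sep_up n s i = t ^+ (n + s) * (t ^+ s * t ^+ (n - i)).
  by rewrite /sep_up -!exprD addnA addnAC addnA.
have -> : t ^+ (n + s) = t ^+ sep_dn n s i * (t ^+ s * t ^+ (n - i)).
  by rewrite /sep_dn -!exprD [(s + _)%N]addnC subnK // leq_add2r leq_subr.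
rewrite /T; have h1 : t ^+ s != 0 by rewrite expf_neq0.
have h2 : q ^+ sg != 0 by rewrite expf_neq0.
have h3 : t ^+ (n - i) != 0 by rewrite expf_neq0.
have h4 : t ^+ sep_dn n s i != 0 by rewrite expf_neq0.
move: (q ^ k) (q ^ (- k)) (q ^+ r.+1) => u v w.
by field; nz.
Qed.

Lemma sep_up_neq n s i : (0 < i)%N -> (i <= n)%N -> (sep_up n s 0 == sep_up n s i) = false.
Proof. rewrite /sep_up; clear; lia. Qed.
Lemma sep_dn_neq n s i : (0 < n + s)%N -> (sep_up n s 0 == sep_dn n s i) = false.
Proof. rewrite /sep_up /sep_dn; clear; lia. Qed.
Lemma sep_pos_neq r sg (k : int) : (sg <= 1)%N -> (`|k|%N < r)%N ->
  (sep_pos r sg r == sep_pos r sg k) = false.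
Proof. rewrite /sep_pos; clear; lia. Qed.
Lemma sep_neg_neq r (k : int) : (0 < r)%N -> (`|k|%N < r)%N || (k == r) ->
  (sep_pos r 0 r == sep_neg r 0 k) = false.
Proof. rewrite /sep_pos /sep_neg; clear; lia. Qed.

(** The chosen monomial has the largest power of t, which only the positive term with i = 0 attains.
    The exception is n + s = 0, where all powers of t agree; then the power q^(2r+1) decides, and an
    inverse term could reach it only for k = -r. *)
Lemma sep_term_coef n s r sg i (k : int) : (sg <= 1)%N -> (sg <= s)%N -> (0 < r)%N ->
  (i <= n)%N -> (i == 0%N) ==> (`|k|%N < r)%N || (k == r) ->
  (sep_term n s r sg i k)`_(sep_up n s 0)`_(sep_pos r sg r) = ((i == 0%N) && (k == r))%:R.
Proof.
move=> sg1 sgs r0 ni.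
rewrite /sep_term coefD !coefB coefD !coefB !bimonomial_coef.
case: (posnP i) => [->|i0 _]; last first.
  rewrite sep_up_neq //= subrr add0r.
  case: (posnP (n + s)) => ns; last by rewrite sep_dn_neq // subrr.
  by move: ns i0 ni => /eqP; rewrite addn_eq0 => /andP[/eqP-> _]; case: (i).
rewrite eqxx /= => hk; rewrite (@sep_pos_neq r sg 0) // subr0.
have -> : (sep_pos r sg r == sep_pos r sg k) = (k == r).
  case/orP: hk => [hk|/eqP->]; last by rewrite !eqxx.
  by rewrite sep_pos_neq //; apply/esym/negP => /eqP E; move: hk; rewrite E ltnn.
case: (posnP (n + s)) => ns; last by rewrite sep_dn_neq // subrr addr0.
have sg0 : sg = 0%N by move: ns sgs; clear; lia.
by rewrite sg0 !sep_neg_neq ?r0 // !andbF subrr addr0.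
Qed.

(* [T = t ^ s / q ^ sg].  Cleared of denominators, the difference is the value of
   a polynomial in which one monomial coming from the right-hand side is not
   cancelled. *)
Lemma eigenvalue_separation n r s sg (m : 'I_n.+1 -> int) (T := t ^+ s / q ^+ sg) :
  (sg <= 1)%N -> (sg <= s)%N -> (forall i, `|m i|%N <= r)%N -> (`|m ord0|%N < r)%N ->
  \sum_(i < n.+1) (T * t ^+ (n - i) * (q ^ m i - 1)
     + (T * t ^+ (n - i))^-1 * (q ^ (- m i) - 1))
  != T * t ^+ n * (q ^+ r - 1) + (T * t ^+ n)^-1 * (q ^- r - 1).
Proof.
move=> sg1 sgs hm hm0; have r0 : (0 < r)%N by exact: leq_ltn_trans hm0.
pose F := \sum_(i < n.+1) sep_term n s r sg i (m i) - sep_term n s r sg 0 r.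
have : gen_eval F != 0.
  apply: (@gen_eval_neq0 _ (sep_up n s 0) (sep_pos r sg r)).
  rewrite /F coefB coefB sep_term_coef // ?eqxx ?orbT //.
  rewrite coef_sum coef_sum big1 ?sub0r ?oppr_eq0 ?oner_neq0 // => i _.
  have hi : (i == 0%N :> nat) ==> (`|m i|%N < r)%N || (m i == r).
    by apply/implyP => /eqP i0; rewrite (_ : i = ord0) ?hm0 //; apply: val_inj.
  rewrite (sep_term_coef sg1 sgs r0 (ltn_ord i : (i <= n)%N) hi).
  have [i0|//] := eqVneq (i : nat) 0%N.
  rewrite (_ : i = ord0) ?andTb; last exact: val_inj.
  by case: eqP => // E; move: hm0; rewrite E ltnn.
rewrite /F gen_evalB gen_eval_sum.
under eq_bigr => i _ do rewrite (gen_eval_sep_term s sg1 (ltn_ord i : (i <= n)%N) (hm i)).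
rewrite -mulr_sumr (@gen_eval_sep_term n s r sg 0 r) // -mulrBr subn0 mulf_eq0 negb_or subr_eq0 => /andP[_].
by rewrite -exprnN.
Qed.

End Genericity.

(** * Leading exponents along a curve *)

Import Order.TTheory Num.Theory.

(** Uniqueness of expansions in base b with signed digits: the last digit is a multiple of b and
    smaller than b in absolute value, hence 0. *)
Lemma weights_free b n (d : 'I_n -> int) : (forall i, `|d i| < b)%N ->
  \sum_(i < n) (b ^ (n - i.+1))%N%:Z * d i = 0 -> forall i, d i = 0.
Proof.
elim: n d => [|n IH] d hd; first by move=> _ [].
rewrite big_ord_recr /= subnn expn0 mul1r.
set d' := fun i : 'I_n => d (widen_ord (leqnSn n) i).
have -> : \sum_(i < n) (b ^ (n.+1 - i.+1))%N%:Z * d' i =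
    b%:Z * \sum_(i < n) (b ^ (n - i.+1))%N%:Z * d' i.
  rewrite mulr_sumr; apply: eq_bigr => i _; rewrite mulrA -PoszM -expnS.
  by rewrite subSS -subSn.
set S := (X in b%:Z * X) => E.
have S0 : S = 0.
  have := hd ord_max; have -> : d ord_max = - (b%:Z * S).
    by apply/eqP; rewrite -addr_eq0 addrC E.
  rewrite abszN abszM absz_nat; case: (S) => [[|s]|s] //=.
    by rewrite mulnS -[X in (_ < X)%N]addn0 ltn_add2l.
  by rewrite mulnS -[X in (_ < X)%N]addn0 ltn_add2l.
move: E; rewrite S0 mulr0 add0r => dmax i.
have hd' := IH d' (fun i => hd _) S0.
case: (ltnP i n) => [lt_in|]; last first.
  move=> le_ni; rewrite -dmax; congr d; apply: val_inj => /=.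
  by apply/eqP; rewrite eqn_leq le_ni -ltnS ltn_ord.
by rewrite -(hd' (Ordinal lt_in)); congr d; apply: val_inj.
Qed.

Lemma seq_max (T : eqType) (f : T -> int) (s : seq T) : s != [::] ->
  exists2 m0, m0 \in s & forall m, m \in s -> (f m <= f m0)%R.
Proof.
elim: s => // x s IH _; have [->|s0] := eqVneq s [::].
  by exists x => [|m]; rewrite ?mem_head // inE => /eqP ->.
have [m0 m0s hm0] := IH s0; have [h|h] := leP (f m0) (f x).
  exists x => [|m]; rewrite ?mem_head // inE => /predU1P[->//|/hm0 h'].
  exact: le_trans h' h.
exists m0 => [|m]; rewrite inE ?m0s ?orbT // => /predU1P[->|/hm0 //].
exact: ltW.
Qed.

Section Uniqueness.
Variables (K : fieldType) (q t : K).
Hypotheses (q0 : q != 0) (t0 : t != 0).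
Hypothesis qinj : injective (fun i => q ^+ i).

Lemma lim0_exprz (k : int) : (0 < k)%R -> lim0 (fun z : K => z ^ k) 0.
Proof.
case: k => [[|k]|] // _; exists ('X^(k.+1) : {poly K}), 1; split; rewrite ?hornerC ?oner_neq0 //.
  by rewrite hornerXn expr0n mul0r.
by apply: gen_true => z; rewrite hornerC mulr1 hornerXn.
Qed.

Lemma gen_z0 : generically (fun z : K => z != 0).
Proof. by apply: gen_imp (gen_neq0 (negbT (polyX_eq0 K))) _ => z; rewrite hornerX. Qed.

Lemma gen_binomial (c : K) i j : i != j -> generically (fun z => z ^+ i - c * z ^+ j != 0).
Proof.
move=> ij; have p0 : 'X^i - c *: 'X^j != 0 :> {poly K}.
  apply/eqP => /(congr1 (fun p : {poly K} => p`_i)).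
  rewrite coefB coefZ !coefXn eqxx (negPf ij) mulr0 subr0 coef0 => /eqP.
  by rewrite oner_eq0.
by apply: gen_imp (gen_neq0 p0) _ => z; rewrite hornerD hornerN hornerZ !hornerXn.
Qed.

Lemma gen_binomialz (c : K) (k : int) : k != 0 -> generically (fun z => 1 - c * z ^ k != 0).
Proof.
case: k => k k0.
  have h := @gen_binomial c 0 k; rewrite eq_sym in h.
  by apply: gen_imp (h k0) _ => z; rewrite expr0.
have h := @gen_binomial c k.+1 0 isT.
apply: gen_imp (gen_and gen_z0 h) _ => z [z0]; rewrite expr0 NegzE -exprnN => h'.
have -> : 1 - c * z ^- k.+1 = (z ^+ k.+1 - c * 1) / z ^+ k.+1.
  have : z ^+ k.+1 != 0 by rewrite expf_neq0.
  by move: (z ^+ k.+1) => u u0; field; nz.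
by rewrite mulf_neq0 // invr_eq0 expf_neq0.
Qed.

(** The limit at z = 0 of (1 - a z^k) / (1 - b z^k): for k < 0 the powers of z dominate and leave
    the quotient of their coefficients. *)
Definition ratio_limit (a b : K) (k : int) : K := if (0 < k)%R then 1 else a / b.

Lemma lim0_ratio (a b : K) (k : int) : b != 0 -> k != 0 ->
  lim0 (fun z => (1 - a * z ^ k) / (1 - b * z ^ k)) (ratio_limit a b k).
Proof.
move=> b0 k0; have gk := gen_binomialz b k0.
case: k k0 gk => k k0 gk.
  exists (1 - a *: 'X^k : {poly K}), (1 - b *: 'X^k : {poly K}); rewrite /ratio_limit.
  have -> : (0 < k%:Z)%R by rewrite ltz_nat lt0n.
  have k0' : (0 ^+ k = 0 :> K) by rewrite expr0n; case: k k0 {gk}.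
  rewrite !hornerE ?hornerXn k0' !mulr0 !subr0; split; rewrite ?mulr1 ?oner_neq0 //.
  apply: gen_imp gk _ => z h; rewrite !hornerE ?hornerXn; exact: divfK.
exists ('X^(k.+1) - a%:P), ('X^(k.+1) - b%:P); rewrite /ratio_limit /=.
rewrite !hornerE ?hornerXn expr0n /= !sub0r; split; rewrite ?oppr_eq0 //.
  by rewrite mulrN divfK.
apply: gen_imp (gen_and gen_z0 gk) _ => z [z0]; rewrite NegzE -exprnN !hornerE ?hornerXn.
have : z ^+ k.+1 != 0 by rewrite expf_neq0.
move: (z ^+ k.+1) => u u0 h.
have h' : u - b != 0.
  apply: contraNneq h => /eqP; rewrite subr_eq0 => /eqP <-; by rewrite divff // subrr.
by field; nz.
Qed.

Section Curve.
Variables (n b : nat).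
Hypothesis b2 : (1 < b)%N.
Implicit Types (P : laurent K n) (m : {ffun 'I_n -> int}).

Definition weight (i : 'I_n) : nat := (b ^ (n - i.+1))%N.
Definition weighted_degree m : int := \sum_(i < n) (weight i)%:Z * m i.
(* As [z] tends to 0, [curve z] tends to infinity with
   [x_0 >> x_1 >> ... >> x_(n-1) >> 1]. *)
Definition curve (z : K) : {ffun 'I_n -> K} := [ffun i => z ^ (- (weight i)%:Z)].

Lemma weight_gt0 i : (0 < weight i)%N.
Proof. by rewrite expn_gt0 ltnW. Qed.

Lemma ltn_weight i j : (weight i < weight j)%N = (j < i)%N.
Proof. by rewrite ltn_exp2l //; have := ltn_ord i; have := ltn_ord j; nlia. Qed.

Lemma monomial_curve z m : z != 0 -> monomial_value (curve z) m = z ^ (- weighted_degree m).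
Proof.
move=> z0; rewrite /monomial_value /weighted_degree -sumrN.
apply: (big_ind2 (fun a c => a = z ^ c)) => [|a c a' c' -> ->|i _] //.
  by rewrite expfzDr.
by rewrite ffunE exprz_exp mulNr.
Qed.

Lemma curve_neq0 z i : z != 0 -> curve z i != 0.
Proof. by move=> z0; rewrite ffunE expfz_neq0. Qed.

Lemma curve_regular : generically (fun z => regular_point q (curve z)).
Proof.
have wz i : ((weight i)%:Z != 0 :> int) by have := weight_gt0 i; rewrite lt0n.
have sqz i z : curve z i ^+ 2 = z ^ (- ((weight i)%:Z *+ 2)).
  by rewrite ffunE exprnP exprz_exp mulNr -mulr_natr natz.
apply: gen_imp (gen_and (gen_and (gen_z0) (gen_forall (P := fun i z =>
  [/\ 1 - 1 * z ^ (- ((weight i)%:Z *+ 2)) != 0, 1 - q * z ^ (- ((weight i)%:Z *+ 2)) != 0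
    & 1 - q * z ^ ((weight i)%:Z *+ 2) != 0]) _))
  (gen_forall (P := fun i z => forall j, j != i -> 1 - 1 * z ^ (- (weight i)%:Z - (weight j)%:Z) != 0 /\
   1 - 1 * z ^ (- (weight i)%:Z + (weight j)%:Z) != 0) _)) _; last first.
- move=> z [[z0 h1] h2]; split=> [i|i j ji].
    have [a1 a2 a3] := h1 i; rewrite mul1r in a1.
    split; rewrite ?curve_neq0 // sqz //.
    by rewrite invr_expz opprK.
  have [a1 a2] := h2 i j ji; rewrite !mul1r in a1 a2.
  by rewrite !ffunE invr_expz opprK -!expfzDr.
- move=> i; apply: gen_forall => j; have [_|ji] := eqVneq j i; first by apply: (@gen_true K) => z.
  have wij : weight i != weight j.
    rewrite neq_ltn !ltn_weight orbC -neq_ltn; apply: contra_neq ji => E; exact/val_inj/esym.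
  apply: gen_imp (gen_and (gen_binomialz 1 (k := - (weight i)%:Z - (weight j)%:Z) _)
    (gen_binomialz 1 (k := - (weight i)%:Z + (weight j)%:Z) _)) _ => //.
    by have := weight_gt0 i; move: (weight i) (weight j); clear; lia.
  by move: (weight i) (weight j) wij; clear; lia.
- move=> i; have w0 := wz i.
  have w2 : (weight i)%:Z *+ 2 != 0 by move: (weight i) w0; clear; lia.
  have w2' : - ((weight i)%:Z *+ 2) != 0 by rewrite oppr_eq0.
  apply: gen_imp (gen_and (gen_and (gen_binomialz 1 w2') (gen_binomialz q w2')) (gen_binomialz q w2)) _.
  by move=> z [[]].
Qed.

Lemma lead_limit (s : seq {ffun 'I_n -> int}) (c : {ffun 'I_n -> int} -> K) m0 :
  uniq s -> m0 \in s ->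
  (forall m, m \in s -> m != m0 -> (weighted_degree m < weighted_degree m0)%R) ->
  lim0 (fun z => z ^ weighted_degree m0 * \sum_(m <- s) c m * monomial_value (curve z) m) (c m0).
Proof.
move=> us m0s h.
apply: (@lim0_gen_eq _ (fun z => c m0 + \sum_(m <- s | (m \in s) && (m != m0))
    c m * z ^ (weighted_degree m0 - weighted_degree m))).
  rewrite -[X in lim0 _ X]addr0; apply: lim0_add; first exact: lim0_cst.
  have zE : \sum_(m <- s | (m \in s) && (m != m0)) 0 = 0 :> K by rewrite big1.
  rewrite -[X in lim0 _ X]zE.
  apply: (@lim0_sum K _ s _ (fun m z => c m * z ^ (weighted_degree m0 - weighted_degree m))
    (fun=> 0)) => m /andP[ms mm0].
  rewrite -[X in lim0 _ X](mulr0 (c m)); apply: lim0_mul; first exact: lim0_cst.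
  by apply: lim0_exprz; rewrite subr_gt0 h.
apply: gen_imp gen_z0 _ => z z0.
rewrite (bigD1_seq m0) //= mulrDr; congr (_ + _).
  by rewrite monomial_curve // mulrCA -expfzDr // subrr expr0z mulr1.
rewrite mulr_sumr -big_seq_cond; apply: eq_bigr => m _.
by rewrite monomial_curve // mulrCA -expfzDr.
Qed.

Lemma prod_above (i : 'I_n) : \prod_(j < n | (i < j)%N) t = t ^+ (n - i.+1).
Proof.
by rewrite -prodr_const_nat (@big_nat_widenl _ _ _ i.+1 0 n) // big_mkord.
Qed.

Lemma prod_below (i : 'I_n) : \prod_(j < n | (j < i)%N) t = t ^+ i.
Proof.
rewrite -[in RHS](subn0 i) -prodr_const_nat (@big_nat_widen _ _ _ 0 i n) ?big_mkord //.
exact: ltnW.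
Qed.

Lemma prod_others (i : 'I_n) : \prod_(j < n | j != i) t = t ^+ (n - 1).
Proof. by rewrite prodr_const cardC1 card_ord subn1. Qed.

Definition node_exponent (k : 'I_n * bool) (m : {ffun 'I_n -> int}) : int :=
  if k.2 then m k.1 else - m k.1.

Definition lead_coef_limit (T : K) (k : 'I_n * bool) : K :=
  if k.2 then T * t ^+ (n - k.1.+1) else (T * t ^+ (n - k.1.+1))^-1.

(** Each quotient whose argument grows along the curve contributes the ratio of its leading
    coefficients, and each of the others contributes 1. At x_i the factors of index j > i contribute
    t^2 and those with j < i contribute t; at 1 / x_i only j < i contributes, with t. Division by T
    t^(n-1) gives the stated powers. *)
Lemma koornwinder_coef_limit T k : T != 0 ->
  lim0 (fun z => koornwinder_coef q t T (curve z) k) (lead_coef_limit T k).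
Proof.
move=> T0; case: k => i e.
pose d : int := if e then - (weight i)%:Z else (weight i)%:Z.
have wi := weight_gt0 i.
have d2 : d *+ 2 != 0 by rewrite /d; move: (weight i) wi; case: (e); clear; lia.
have dj1 j : j != i -> d - (weight j)%:Z != 0 /\ d + (weight j)%:Z != 0.
  move=> ji; have wj := weight_gt0 j.
  have : weight i != weight j.
    rewrite neq_ltn !ltn_weight orbC -neq_ltn; apply: contra_neq ji => E; exact/val_inj/esym.
  by rewrite /d; move: (weight i) (weight j) wi wj; case: (e); clear; lia.
pose L := ratio_limit.
have lim : lim0 (fun z => koornwinder_coef q t T (curve z) (i, e))
    ((T * t ^+ (n - 1))^-1 * L T 1 (d *+ 2) * L (q * T) q (d *+ 2)
     * \prod_(j < n | j != i) (L t 1 (d - (weight j)%:Z) * L t 1 (d + (weight j)%:Z))).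
  apply: (@lim0_gen_eq _ (fun z => (T * t ^+ (n - 1))^-1
     * ((1 - T * z ^ (d *+ 2)) / (1 - 1 * z ^ (d *+ 2)))
     * ((1 - q * T * z ^ (d *+ 2)) / (1 - q * z ^ (d *+ 2)))
     * \prod_(j < n | j != i)
       ((1 - t * z ^ (d - (weight j)%:Z)) / (1 - 1 * z ^ (d - (weight j)%:Z))
        * ((1 - t * z ^ (d + (weight j)%:Z)) / (1 - 1 * z ^ (d + (weight j)%:Z)))))).
    apply: lim0_mul; last first.
      apply: lim0_prod => j ji; have [h1 h2] := dj1 j ji.
      by apply: lim0_mul; apply: lim0_ratio; rewrite ?oner_neq0.
    apply: lim0_mul; last exact: lim0_ratio.
    apply: lim0_mul; first exact: lim0_cst.
    by apply: lim0_ratio; rewrite ?oner_neq0.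
  apply: gen_imp gen_z0 _ => z z0; rewrite /koornwinder_coef.
  have yE : node (curve z) (i, e) = z ^ d.
    by rewrite /node /d /= ffunE; case: (e); rewrite // invr_expz opprK.
  have y2 : (z ^ d) ^+ 2 = z ^ (d *+ 2).
    by rewrite exprnP exprz_exp -mulr_natr natz.
  rewrite yE y2; congr (_ * _).
    rewrite !invfM !mul1r; move: (z ^ _) => u; ring.
  apply: eq_bigr => j _; rewrite ffunE !expfzDr // -invr_expz invrK !mul1r.
  move: (z ^ d) (z ^ (weight j)%:Z) => u v; rewrite !mulrA invfM; ring.
have -> : lead_coef_limit T (i, e) = (T * t ^+ (n - 1))^-1 * L T 1 (d *+ 2) * L (q * T) q (d *+ 2)
     * \prod_(j < n | j != i) (L t 1 (d - (weight j)%:Z) * L t 1 (d + (weight j)%:Z)).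
  have tX k : t ^+ k != 0 by rewrite expf_neq0.
  have := tX (n - i.+1)%N; have := tX (n - 1)%N; have := tX i => h1 h2 h3.
  rewrite big_split /= /lead_coef_limit /L /ratio_limit /d /=.
  have le_w j : ((weight i)%:Z - (weight j)%:Z > 0)%R = (i < j)%N.
    by rewrite subr_gt0 ltz_nat ltn_weight.
  case: (e).
    have -> : (0 < - (weight i)%:Z *+ 2)%R = false by move: (weight i) wi; clear; lia.
    have -> : \prod_(j < n | j != i) (if (0 < - (weight i)%:Z - (weight j)%:Z)%R then 1 else t / 1)
        = t ^+ (n - 1).
      rewrite -(prod_others i); apply: eq_bigr => j _.
      by rewrite divr1 ifF //; move: (weight i) (weight j) wi; clear; lia.
    have -> : \prod_(j < n | j != i) (if (0 < - (weight i)%:Z + (weight j)%:Z)%R then 1 else t / 1)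
        = t ^+ (n - i.+1).
      rewrite -(prod_above i) [LHS]big_mkcond [RHS]big_mkcond; apply: eq_bigr => j _.
      rewrite addrC subr_gt0 ltz_nat ltn_weight divr1 -(inj_eq val_inj) /=.
      by case: ltngtP.
    by field; nz.
  have -> : (0 < (weight i)%:Z *+ 2)%R by move: (weight i) wi; clear; lia.
  have -> : \prod_(j < n | j != i) (if (0 < (weight i)%:Z + (weight j)%:Z)%R then 1 else t / 1) = 1.
    apply: big1 => j _.
    by rewrite divr1 ifT //; move: (weight i) (weight j) wi; clear; lia.
  have -> : \prod_(j < n | j != i) (if (0 < (weight i)%:Z - (weight j)%:Z)%R then 1 else t / 1)
        = t ^+ i.
    rewrite -(prod_below i) [LHS]big_mkcond [RHS]big_mkcond; apply: eq_bigr => j _.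
    rewrite le_w divr1 -(inj_eq val_inj) /=.
    by case: ltngtP.
  have -> : t ^+ (n - 1) = t ^+ (n - i.+1) * t ^+ i.
    by rewrite -exprD; congr (_ ^+ _); have := ltn_ord i; nlia.
  by field; nz.
exact: lim.
Qed.

Lemma leval_node_shift P k x : leval P (node_shift q k x) =
  \sum_(m <- msupp P) (P@_m * q ^ node_exponent k m) * monomial_value x m.
Proof.
apply: eq_bigr => m _; rewrite -mulrA; congr (_ * _).
rewrite /monomial_value (bigD1 k.1) //= [in RHS](bigD1 k.1) //= mulrA; congr (_ * _).
  rewrite /node_shift ffunE eqxx expfzMl; congr (_ * _).
  by rewrite /node_exponent; case: k.2; rewrite // exprz_inv.
by apply: eq_bigr => j jk; rewrite /node_shift ffunE (negPf jk).
Qed.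

End Curve.

(** Differences of exponents are at most 2B < b in absolute value, so they are signed digits in base
    b. *)
Lemma weighted_degree_inj b B n (m m' : {ffun 'I_n -> int}) : (2 * B < b)%N ->
  (forall i, `|m i| <= B)%N -> (forall i, `|m' i| <= B)%N ->
  weighted_degree b m = weighted_degree b m' -> m = m'.
Proof.
move=> Bb hm hm' E; apply/ffunP => i; apply/eqP; rewrite -subr_eq0; apply/eqP.
apply: (@weights_free b n (fun i => m i - m' i)) => [j|].
  have := hm j; have := hm' j; move: (m j) (m' j) Bb; clear; lia.
under eq_bigr do rewrite mulrBr.
by rewrite sumrB; apply/eqP; rewrite subr_eq0; apply/eqP.
Qed.

Lemma msupp_bound n (P : laurent K n) :
  exists B, forall m, m \in msupp P -> forall i, (`|m i| <= B)%N.
Proof.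
exists (\sum_(m <- msupp P) \sum_i `|m i|)%N => m mP i.
rewrite (big_rem m) //= (bigD1 i) //= -addnA; exact: leq_addr.
Qed.

Lemma leading_exponent n (P : laurent K n) : P != 0 ->
  exists2 b, (1 < b)%N & exists2 m0, m0 \in msupp P &
    forall m, m \in msupp P -> m != m0 -> (weighted_degree b m < weighted_degree b m0)%R.
Proof.
move=> P0; have [B hB] := msupp_bound P; pose b := (2 * B).+2.
exists b => //; have s0 : (msupp P : seq _) != [::].
  by apply: contraNneq P0 => s0; rewrite (monalgE P) s0 big_nil.
have [m0 m0P hm0] := seq_max (@weighted_degree n b) s0.
exists m0 => // m mP mm0; rewrite lt_neqAle hm0 // andbT.
apply: contra_neq mm0; apply: (@weighted_degree_inj b B) => //.
- exact: hB.
- exact: hB.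
Qed.

Lemma leval_eq0 n (P : laurent K n) :
  (forall x : {ffun 'I_n -> K}, (forall i, x i != 0) -> leval P x = 0) -> P = 0.
Proof.
move=> h; apply/eqP; apply: contraT => P0.
have [b b1 [m0 m0P hm0]] := leading_exponent P0.
have L := @lead_limit n b (msupp P) (mcoeff^~ P) m0 (fset_uniq _) m0P hm0.
have : lim0 (fun z => z ^ weighted_degree b m0 *
    \sum_(m <- msupp P) P@_m * monomial_value (curve n b z) m) 0.
  apply: lim0_gen_eq (lim0_cst 0) _; apply: gen_imp gen_z0 _ => z z0.
  by have := h _ (fun i => curve_neq0 b i z0); rewrite /leval => ->; rewrite mulr0.
by move/(lim0_uniq qinj L) => E; move: m0P; rewrite -mcoeff_neq0 E eqxx.
Qed.

Lemma eigen_leading n T d (P : laurent K n) : T != 0 -> P != 0 ->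
  (forall x : {ffun 'I_n -> K}, regular_point q x ->
    \sum_k koornwinder_coef q t T x k * (leval P (node_shift q k x) - leval P x)
    = d * leval P x) ->
  exists2 m0, m0 \in msupp P & \sum_k lead_coef_limit T k * (q ^ node_exponent k m0 - 1) = d.
Proof.
move=> T0 P0 h; have [b b1 [m0 m0P hm0]] := leading_exponent P0.
exists m0 => //.
have L c := @lead_limit n b (msupp P) c m0 (fset_uniq _) m0P hm0.
pose F (z : K) c := z ^ weighted_degree b m0 * \sum_(m <- msupp P) c m * monomial_value (curve n b z) m.
have L1 : lim0 (fun z => \sum_k koornwinder_coef q t T (curve n b z) k *
      F z (fun m => P@_m * (q ^ node_exponent k m - 1)))
    (\sum_k lead_coef_limit T k * (P@_m0 * (q ^ node_exponent k m0 - 1))).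
  apply: lim0_sum => k _; apply: lim0_mul; first exact: koornwinder_coef_limit.
  exact: L.
have L2 : lim0 (fun z => d * F z (mcoeff^~ P)) (d * P@_m0).
  by apply: lim0_mul; [exact: lim0_cst | exact: L].
have E : \sum_k lead_coef_limit T k * (P@_m0 * (q ^ node_exponent k m0 - 1)) = d * P@_m0.
  apply: (lim0_uniq qinj L1); apply: lim0_gen_eq L2 _.
  apply: gen_imp (curve_regular n b1) _ => z hz; rewrite /F mulrCA.
  have := h _ hz; rewrite {2}/leval => <-; rewrite mulr_sumr; apply: eq_bigr => k _.
  rewrite mulrCA; congr (_ * (_ * _)); rewrite leval_node_shift -sumrB.
  by apply: eq_bigr => m _; rewrite /monomial_value; ring.
have c0 : P@_m0 != 0 by rewrite mcoeff_neq0.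
apply: (mulIf c0); rewrite -E mulr_suml; apply: eq_bigr => k _; ring.
Qed.

End Uniqueness.

(** * Orbit sums and uniqueness of the row polynomial *)

Section Orbits.
Variables (K : fieldType) (n : nat).
Implicit Types (m : {ffun 'I_n -> int}) (la mu : {ffun 'I_n -> nat}).

Definition int_exponent la : {ffun 'I_n -> int} := [ffun i => (la i)%:Z].

Lemma absz_hyp_act w la i : `|hyp_act w (int_exponent la) i|%N = la (w.1 i).
Proof. by rewrite !ffunE abszM absz_sign mul1n. Qed.

Lemma orbit_sum_coef la m : (orbit_sum K la)@_m =
  (m \in [seq hyp_act w (int_exponent la) | w : {perm 'I_n} * {ffun 'I_n -> bool}])%:R.
Proof.
rewrite -mem_undup /orbit_sum; move: (undup _) (undup_uniq
  [seq hyp_act w (int_exponent la) | w : {perm 'I_n} * {ffun 'I_n -> bool}]) => s us.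
rewrite raddf_sum /=; under eq_bigr do rewrite mcoeffU.
have [ms|ms] := boolP (m \in s).
  rewrite (bigD1_seq m) //= eqxx big1 ?addr0 // => m' m'm.
  by rewrite (negPf m'm).
by rewrite big_seq big1 // => m' m's; case: eqP => // E; move: ms; rewrite -E m's.
Qed.

Lemma orbit_sum_supp la m : (orbit_sum K la)@_m != 0 ->
  exists w, m = hyp_act w (int_exponent la).
Proof.
rewrite orbit_sum_coef; case: (boolP (m \in _)) => [/mapP[w _ ->] _|_]; last by rewrite eqxx.
by exists w.
Qed.

Lemma triangular_supp s (u : {ffun 'I_n -> nat} -> K) m :
  (\sum_(mu <- s) u mu *: orbit_sum K mu)@_m != 0 ->
  exists2 mu, mu \in s & exists w, m = hyp_act w (int_exponent mu).
Proof.
rewrite raddf_sum /= => h; have : has (fun mu => (orbit_sum K mu)@_m != 0) s.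
  apply: contraNT h => /hasPn h; apply/eqP; rewrite big_seq; apply: big1 => mu /h.
  by rewrite negbK mcoeffZ => /eqP ->; rewrite mulr0.
by case/hasP => mu mus /orbit_sum_supp h'; exists mu.
Qed.

End Orbits.

(** If the first part were r, domination by (r) would make all other parts 0 and mu would be (r)
    itself. *)
Lemma dominated_row_lt n r (mu : {ffun 'I_n.+1 -> nat}) : is_partition mu ->
  dominated mu (row_partition n.+1 r) -> mu <> row_partition n.+1 r ->
  forall i, (mu i < r)%N.
Proof.
move=> pmu dmu neq i; apply: leq_ltn_trans (pmu ord0 i _) _ => //.
have rowS (j : 'I_n.+1) : (\sum_(k < n.+1 | k <= j) row_partition n.+1 r k = r)%N.
  rewrite (bigD1 ord0) //= ffunE eqxx big1 ?addn0 // => k /andP[_ k0].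
  by rewrite ffunE; case: ifP => // /eqP E; case/eqP: k0; exact: val_inj.
have mu0 : (mu ord0 <= r)%N.
  have := dmu ord0; rewrite rowS; apply: leq_trans.
  by rewrite (bigD1 ord0) //= leq_addr.
rewrite ltn_neqAle mu0 andbT; apply/eqP => E; apply: neq; apply/ffunP => j.
rewrite ffunE; case: ifP => [/eqP j0|j0].
  by rewrite -E; congr (mu _); apply: val_inj.
have := dmu j; rewrite rowS (bigD1 ord0) //= (bigD1 j) ?leqnn /=; last first.
  by rewrite -(inj_eq val_inj) j0.
by rewrite E -[X in (_ <= X)%N]addn0 leq_add2l leqn0 addn_eq0 => /andP[/eqP].
Qed.

Section KoornwinderRow.
Variables (K : fieldType) (q t : K).
Hypothesis hgen : generic q t.

Lemma koornwinder_eigenvalue_row n r T :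
  koornwinder_eigenvalue q t T (row_partition n.+1 r) =
  T * t ^+ n * (q ^+ r - 1) + (T * t ^+ n)^-1 * (q ^- r - 1).
Proof.
rewrite /koornwinder_eigenvalue big_ord_recl big1 ?addr0 => [|i _]; last first.
  by rewrite ffunE /= expr0 !mulr1 invr1 mulr1; ring.
by rewrite ffunE eqxx subSS subn0 invfM; ring.
Qed.

(** The orbit sum of (r) cancels in the difference, so every exponent left has all entries smaller
    than r in absolute value. The pair ([s], [sg]) is (2, 1) in type C and (0, 0) in type D. *)
Lemma koornwinder_row_uniq n r s sg a b c d T (P P' : laurent K n.+1) :
  T = t ^+ s / q ^+ sg -> (sg <= 1)%N -> (sg <= s)%N ->
  (forall z, (1 - a * z) * (1 - b * z) * (1 - c * z) * (1 - d * z)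
             = (1 - T * z ^+ 2) * (1 - q * T * z ^+ 2)) ->
  is_koornwinder a b c d q t T (row_partition n.+1 r) P ->
  is_koornwinder a b c d q t T (row_partition n.+1 r) P' -> P = P'.
Proof.
move=> TE sg1 sgs habcd [_ [s1 [u1 [h1 E1]]] e1] [_ [s2 [u2 [h2 E2]]] e2].
have q0 := generic_q0 hgen; have t0 := generic_t0 hgen.
have T0 : T != 0 by rewrite TE mulf_neq0 ?invr_eq0 ?expf_neq0.
apply/eqP; rewrite -subr_eq0; apply: contraT => R0.
have eigen (x : {ffun 'I_n.+1 -> K}) : regular_point q x ->
    \sum_k koornwinder_coef q t T x k
      * (leval (P - P') (node_shift q k x) - leval (P - P') x)
    = koornwinder_eigenvalue q t T (row_partition n.+1 r) * leval (P - P') x.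
  move=> hx; rewrite [in RHS]levalB mulrBr -(e1 x hx) -(e2 x hx).
  rewrite !(koornwinder_opE _ _ _ habcd) -sumrB; apply: eq_bigr => k _.
  by rewrite !levalB; ring.
have [m0 m0P] := eigen_leading q0 t0 (generic_qinj hgen) T0 R0 eigen.
have hm0 i : (`|m0 i| < r)%N.
  have [mu [pmu dmu neq] [w ->]] : exists2 mu,
      [/\ is_partition mu, dominated mu (row_partition n.+1 r) & mu <> row_partition n.+1 r]
      & exists w, m0 = hyp_act w (int_exponent mu).
    have : (\sum_(mu <- s1) u1 mu *: orbit_sum K mu)@_m0 != 0 \/
           (\sum_(mu <- s2) u2 mu *: orbit_sum K mu)@_m0 != 0.
      apply/orP; rewrite -negb_and; apply: contraL m0P => /andP[/eqP z1 /eqP z2].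
      by rewrite -mcoeff_neq0 E1 E2 mcoeffB !mcoeffD z1 z2 subrr eqxx.
    case=> /triangular_supp[mu mus hw]; exists mu => //.
      exact: h1.
    exact: h2.
  by rewrite absz_hyp_act; apply: dominated_row_lt.
have := @eigenvalue_separation K q t hgen n r s sg m0 sg1 sgs (fun i => ltnW (hm0 i)) (hm0 ord0).
rewrite -TE koornwinder_eigenvalue_row => /negPf H E; move: H.
rewrite -E -(pair_bigA _ (fun i e => lead_coef_limit t T (i, e) * (q ^ node_exponent (i, e) m0 - 1))) /=.
by under eq_bigr => i _ do rewrite -subSS; under [X in _ == X]eq_bigr => i _ do rewrite big_bool; rewrite eqxx.
Qed.

End KoornwinderRow.

(** * Symmetry and triangularity *)

Section Symmetry.
Variables (K : fieldType) (q t tau : K).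
Hypotheses (q0 : q != 0) (t0 : t != 0).
Hypothesis hq : forall i, 1 - q ^+ i * q != 0.
Hypothesis hqt : forall m i j, q ^+ j - q ^+ i * t ^+ m.+1 != 0.
Hypothesis htau : tau = 1 \/ tau = q / t ^+ 2.

Lemma psi_series_lead c R : psi_series q t c R R = 1.
Proof. by rewrite /= leqnn subnn /= /psi_coef !qpoch0 expr0 !mulr1 divr1. Qed.

(** The generating series determines the Q_R: psi_R starts with u^R and depends on the variables
    only through their number. *)
Lemma row_value_hat (xs xs' : seq K) : size xs = size xs' -> xs != [::] ->
  (forall x, x \in xs -> x != 0) -> (forall x, x \in xs' -> x != 0) ->
  hat_series q t tau xs = hat_series q t tau xs' ->
  forall r, row_value q t tau xs r = row_value q t tau xs' r.
Proof.
move=> sz ne hx hx' E r; elim/ltn_ind: r => r IH.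
have ne' : xs' != [::] by rewrite -size_eq0 -sz size_eq0.
have expand (ys : seq K) : ys != [::] -> (forall x, x \in ys -> x != 0) ->
    hat_series q t tau ys r = \sum_(R < r.+1)
      row_value q t tau ys R * psi_series q t (level q t tau (size ys) R) R r.
  move=> h1 h2; case: htau => ->; first exact: expansionC.
  exact: expansionD.
have := expand xs' ne' hx'; rewrite -E (expand xs ne hx) !big_ord_recr !psi_series_lead !mulr1 sz.
rewrite (eq_bigr (fun R : 'I_r => row_value q t tau xs' R
  * psi_series q t (level q t tau (size xs') R) R r)) => [/addrI//|i _].
by rewrite IH /=.
Qed.

Section Action.
Variables (n : nat) (w : {perm 'I_n.+1} * {ffun 'I_n.+1 -> bool}).
Implicit Types (x : {ffun 'I_n.+1 -> K}) (m : {ffun 'I_n.+1 -> int}).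

(* The transpose of the action on exponents. *)
Definition hyp_point x : {ffun 'I_n.+1 -> K} :=
  [ffun j => x ((w.1^-1)%g j) ^ ((-1) ^+ w.2 ((w.1^-1)%g j))].

Lemma monomial_hyp_act x m :
  monomial_value x (hyp_act w m) = monomial_value (hyp_point x) m.
Proof.
rewrite /monomial_value [RHS](reindex_inj (@perm_inj _ w.1)) /=.
by apply: eq_bigr => i _; rewrite !ffunE permK exprz_exp.
Qed.

Lemma hyp_point_neq0 x : (forall i, x i != 0) -> forall i, hyp_point x i != 0.
Proof. by move=> x0 i; rewrite ffunE expfz_neq0. Qed.

Lemma row_value_hyp_point x r : (forall i, x i != 0) ->
  row_value q t tau [seq hyp_point x i | i <- enum 'I_n.+1] r =
  row_value q t tau [seq x i | i <- enum 'I_n.+1] r.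
Proof.
move=> x0; apply: row_value_hat.
- by rewrite !size_map.
- by rewrite -size_eq0 size_map size_enum_ord.
- by move=> y /mapP[i _ ->]; exact: hyp_point_neq0.
- by move=> y /mapP[i _ ->].
rewrite /hat_series; congr (_ * _); rewrite [LHS]big_map [RHS]big_map [LHS]big_enum [RHS]big_enum /=.
rewrite [LHS](reindex_inj (@perm_inj _ w.1)) /=; apply: eq_bigr => i _.
rewrite ffunE permK; case: (w.2 i); last by rewrite expr0 expr1z.
by rewrite expr1 exprN1 invrK mulrC.
Qed.

Lemma hyp_act_inj : injective (hyp_act w).
Proof.
move=> m m' E; apply/ffunP => i; have := congr1 (fun f : {ffun _ -> _} => f ((w.1^-1)%g i)) E.
by rewrite !ffunE permKV => /(inv_inj (signrMK _)).
Qed.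

End Action.

(** Symmetry of the values gives symmetry of the coefficients, since a Laurent polynomial vanishing
    at all points with nonzero coordinates is 0. *)
Lemma leval_invariant n (P : laurent K n.+1) : injective (fun i => q ^+ i) ->
  (forall w (x : {ffun 'I_n.+1 -> K}), (forall i, x i != 0) -> leval P (hyp_point w x) = leval P x) ->
  hyp_invariant P.
Proof.
move=> qinj h w m; pose P' := \sum_(k <- msupp P) << P@_k *g hyp_act w k >>.
have coefP' : P'@_(hyp_act w m) = P@_m.
  rewrite /P' [in RHS](monalgE P) !raddf_sum; apply: eq_bigr => k _.
  by rewrite /= !mcoeffU (inj_eq (@hyp_act_inj n w)).
rewrite -coefP'; congr (_@__); apply/eqP; rewrite -subr_eq0; apply/eqP.
apply: (leval_eq0 qinj) => x x0; rewrite levalB -(h w x x0); apply/eqP.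
rewrite subr_eq0; apply/eqP; rewrite leval_sum; apply: eq_bigr => k _.
by rewrite levalU monomial_hyp_act.
Qed.

End Symmetry.

Section Triangular.
Variables (K : fieldType) (n : nat).
Implicit Types (m : {ffun 'I_n.+1 -> int}) (la mu : {ffun 'I_n.+1 -> nat}).

Definition abs_seq m : seq nat := [seq `|m i|%N | i <- enum 'I_n.+1].

Definition dominant m : {ffun 'I_n.+1 -> nat} :=
  [ffun i => nth 0%N (sort geq (abs_seq m)) (nat_of_ord i)].

Let geq_total : total geq. Proof. by move=> x y; exact: leq_total. Qed.
Let geq_trans : transitive geq. Proof. by move=> x y z h1 h2; exact: leq_trans h2 h1. Qed.
Let geq_anti : antisymmetric geq.
Proof. by move=> x y /=; rewrite andbC -eqn_leq => /eqP. Qed.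

Lemma dominant_seq m : [seq dominant m i | i <- enum 'I_n.+1] = sort geq (abs_seq m).
Proof.
have sz : size (sort geq (abs_seq m)) = n.+1 by rewrite size_sort size_map size_enum_ord.
apply: (@eq_from_nth _ 0%N); first by rewrite size_map size_enum_ord sz.
move=> i; rewrite size_map size_enum_ord => lt_in.
rewrite (nth_map ord0) ?size_enum_ord // ffunE.
by rewrite -[i]/(nat_of_ord (Ordinal lt_in)) nth_ord_enum.
Qed.

Lemma partition_sorted la : is_partition la -> sorted geq [seq la i | i <- enum 'I_n.+1].
Proof.
move=> pla; rewrite sorted_map; apply: (@sub_sorted _ (relpre val leq)) => [i j|].
  exact: pla.
by rewrite -sorted_map val_enum_ord iota_sorted.
Qed.

Lemma dominant_partition m : is_partition (dominant m).
Proof.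
move=> i j ij; rewrite !ffunE; have srt := sort_sorted geq_total (abs_seq m).
have sz : size (sort geq (abs_seq m)) = n.+1 by rewrite size_sort size_map size_enum_ord.
by apply: (sorted_leq_nth geq_trans leqnn 0%N srt); rewrite // inE sz.
Qed.

Lemma dominant_hyp_act w la : is_partition la -> dominant (hyp_act w (int_exponent la)) = la.
Proof.
move=> pla; set m := hyp_act w _.
have E : [seq dominant m i | i <- enum 'I_n.+1] = [seq la i | i <- enum 'I_n.+1].
  rewrite dominant_seq; apply: (sorted_eq geq_trans geq_anti).
  - exact: sort_sorted.
  - exact: partition_sorted.
  rewrite perm_sort /abs_seq; under eq_map do rewrite absz_hyp_act.
  rewrite [X in perm_eq X _](map_comp la w.1); apply: perm_map; apply: uniq_perm.
  - by rewrite map_inj_uniq ?enum_uniq //; exact: perm_inj.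
  - exact: enum_uniq.
  move=> i; rewrite mem_enum inE; apply/mapP; exists ((w.1^-1)%g i); rewrite ?mem_enum //.
  by rewrite permKV.
by apply/ffunP => i; move/eq_in_map: E => /(_ i); apply; rewrite mem_enum.
Qed.

Lemma dominantP m : exists w, m = hyp_act w (int_exponent (dominant m)).
Proof.
pose a := [tuple `|m i|%N | i < n.+1]; pose d := [tuple dominant m i | i < n.+1].
have /tuple_permP[p Ep] : perm_eq a d.
  by rewrite /= dominant_seq perm_sym perm_sort.
exists (p, [ffun i => (m i < 0)%R]); apply/ffunP => i.
have : `|m i|%N = dominant m (p i).
  have /val_inj Ea : tval a = tval [tuple tnth d (p i) | i < n.+1] := Ep.
  by have := congr1 (fun s => tnth s i) Ea; rewrite !tnth_mktuple.
by move=> H; rewrite ffunE /= [int_exponent _ _]ffunE -H ffunE abszE -intEsign.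
Qed.

Lemma orbit_sum_dominant la m : is_partition la ->
  (orbit_sum K la)@_m = (dominant m == la)%:R.
Proof.
move=> pla; rewrite orbit_sum_coef; congr (nat_of_bool _)%:R.
apply/mapP/eqP => [[w _ ->]|<-]; first exact: dominant_hyp_act.
by have [w E] := dominantP m; exists w; rewrite ?mem_enum.
Qed.

Lemma sum_dominant m : (\sum_i `|m i| = \sum_i dominant m i)%N.
Proof.
have [w {1}->] := dominantP m; rewrite [RHS](reindex_inj (@perm_inj _ w.1)).
by apply: eq_bigr => i _; rewrite absz_hyp_act.
Qed.

(** All partial sums of (r) equal r, so domination by (r) amounts to a bound on the total degree,
    and triangularity follows from that bound together with the symmetry. *)
Lemma triangular_row (P : laurent K n.+1) r : hyp_invariant P ->
  (forall m, m \in msupp P -> \sum_i `|m i| <= r)%N ->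
  P@_(int_exponent (row_partition n.+1 r)) = 1 ->
  exists (s : seq {ffun 'I_n.+1 -> nat}) (u : {ffun 'I_n.+1 -> nat} -> K),
    (forall mu, mu \in s ->
       [/\ is_partition mu, dominated mu (row_partition n.+1 r)
         & mu <> row_partition n.+1 r]) /\
    P = orbit_sum K (row_partition n.+1 r) + \sum_(mu <- s) u mu *: orbit_sum K mu.
Proof.
move=> inv supp P1; set row := row_partition n.+1 r.
pose s := [seq mu <- undup [seq dominant m | m <- msupp P] | mu != row].
have prow : is_partition row.
  move=> i j ij; rewrite !ffunE; case: (nat_of_ord j =P 0%N) => // j0.
  by rewrite j0 leqn0 in ij; rewrite ij.
have hs mu : mu \in s -> exists2 m, m \in msupp P & mu = dominant m.
  by rewrite mem_filter mem_undup => /andP[_ /mapP[m mP ->]]; exists m.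
exists s, (fun mu => P@_(int_exponent mu)); split.
  move=> mu mus; have [m mP Emu] := hs mu mus; rewrite Emu; split.
  - exact: dominant_partition.
  - move=> i; rewrite [X in (_ <= X)%N](bigD1 ord0) //= ffunE eqxx.
    apply: leq_trans (leq_trans (supp m mP) (leq_addr _ _)).
    rewrite sum_dominant [X in (_ <= X)%N](bigID (fun j : 'I_n.+1 => (j <= i)%N)) /=.
    exact: leq_addr.
  - by move=> E; move: mus; rewrite Emu E mem_filter eqxx.
have invP m : P@_m = P@_(int_exponent (dominant m)).
  by have [w {1}->] := dominantP m; rewrite inv.
apply/malgP => m; rewrite mcoeffD orbit_sum_dominant // raddf_sum /= big_seq.
under eq_bigr => mu mus.
  rewrite mcoeffZ orbit_sum_dominant; last first.
    by have [m' _ ->] := hs mu mus; exact: dominant_partition.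
  over.
rewrite -big_seq invP; have us : uniq s by rewrite filter_uniq ?undup_uniq.
have [E|neq] := eqVneq (dominant m) row.
  rewrite E P1 big_seq big1 ?addr0 // => mu; rewrite mem_filter => /andP[h _].
  by rewrite eq_sym (negPf h) mulr0.
rewrite add0r; have [ms|ms] := boolP (dominant m \in s).
  rewrite (bigD1_seq (dominant m)) //= eqxx mulr1 big1 ?addr0 // => mu h.
  by rewrite eq_sym (negPf h) mulr0.
rewrite big_seq big1 => [|mu mus]; last first.
  by case: eqP => [E|]; rewrite ?mulr0 //; move: ms; rewrite E mus.
apply/eqP; rewrite -invP mcoeff_eq0; apply: contra ms => mP.
by rewrite mem_filter neq mem_undup map_f.
Qed.

End Triangular.

(** * Degree bound and leading coefficient of the explicit sums *)

Section RowSumCoefficients.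
Variables (K : fieldType) (q t : K) (n r : nat).
Hypothesis hq : forall i, 1 - q ^+ i * q != 0.
Hypothesis hqt : forall m i j, q ^+ j - q ^+ i * t ^+ m.+1 != 0.
Variables (A : pred (row_family n.+1 r)) (fac : row_family n.+1 r -> K).

Definition family_laurent : laurent K n.+1 := (qpoch q q r / qpoch q t r) *:
  \sum_(th | (th_sum th == r) && A th) << th_weight th q t * fac th *g th_exponent th >>.

Lemma family_laurent_supp m : m \in msupp family_laurent -> (\sum_i `|m i| <= r)%N.
Proof.
rewrite -mcoeff_neq0 mcoeffZ raddf_sum /= => h.
have /existsP[th /andP[/andP[/eqP sum_th _] /eqP ->]] :
    [exists th : row_family n.+1 r, ((th_sum th == r) && A th) && (m == th_exponent th)].
  apply: contraNT h => /existsPn h; apply/eqP; rewrite big1 ?mulr0 // => th hth.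
  by have := h th; rewrite hth /= mcoeffU eq_sym => /negPf ->.
rewrite -[X in (_ <= X)%N]sum_th /th_sum big_sumType /= -big_split; apply: leq_sum => i _; rewrite ffunE.
have abs_le (a b : nat) : (absz (a%:Z - b%:Z)%R <= a + b)%N by clear; lia.
exact: abs_le.
Qed.

Definition row_family_top : row_family n.+1 r :=
  [ffun k => if k == inl ord0 then ord_max else ord0].

Lemma row_family_top_inr i : row_family_top (inr i) = ord0.
Proof. by rewrite ffunE. Qed.

(** From theta_1 - theta_(bar 1) = r and theta_1 <= r follows theta_1 = r, and the constraint on the
    sum makes all other entries 0. Hence one family alone contributes to the leading coefficient,
    and its weight cancels the prefactor. *)
Lemma row_family_topP th : th_sum th = r ->
  (th_exponent th == int_exponent (row_partition n.+1 r)) = (th == row_family_top).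
Proof.
move=> sum_th; apply/eqP/eqP => [E|->]; last first.
  apply/ffunP => i; rewrite !ffunE /= subr0.
  rewrite (_ : (inl i == inl ord0 :> 'I_n.+1 + 'I_n.+1) = (i == ord0)) //.
  by rewrite -(inj_eq val_inj) /=; case: eqP.
have h0 : r = th (inl ord0).
  have := congr1 (fun f : {ffun _ -> int} => f ord0) E; rewrite !ffunE /=.
  have := ltn_ord (th (inl ord0)); move: (nat_of_ord _) (nat_of_ord _) => a b; clear.
  by rewrite ltnS; lia.
apply/ffunP => k; rewrite ffunE; apply: val_inj; case: eqP => [->|k0] //=.
have := sum_th; rewrite /th_sum (bigD1 (inl ord0)) //= -h0 (bigD1 k) /=; last exact/eqP.
by move/eqP; rewrite -[X in _ == X]addn0 eqn_add2l addn_eq0 => /andP[/eqP].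
Qed.

Lemma th_sum_top : th_sum row_family_top = r.
Proof.
rewrite /th_sum (bigD1 (inl ord0)) //= ffunE eqxx big1 ?addn0 // => k /negPf h.
by rewrite ffunE h.
Qed.

Lemma family_laurent_top : A row_family_top -> fac row_family_top = 1 ->
  family_laurent@_(int_exponent (row_partition n.+1 r)) = 1.
Proof.
move=> hA hfac; rewrite mcoeffZ raddf_sum /= (bigD1 row_family_top) /=; last first.
  by rewrite th_sum_top eqxx.
rewrite mcoeffU row_family_topP ?th_sum_top // eqxx big1 ?addr0; last first.
  move=> th /andP[/andP[/eqP hs _] /negPf h].
  by rewrite mcoeffU row_family_topP // h.
rewrite hfac mulr1 /th_weight (bigD1 (inl ord0)) //= big1 ?mulr1; last first.
  by move=> k /negPf h; rewrite ffunE h !qpoch0 divr1.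
rewrite ffunE eqxx /=.
have h1 : qpoch q q r != 0 by apply: qpoch_neq0.
have h2 : qpoch q t r != 0.
  by apply: qpoch_neq0 => i _; have := hqt 0 i 0; rewrite expr1.
by rewrite mulr1n; field; nz.
Qed.

End RowSumCoefficients.

Section RowSumKoornwinder.
Variables (K : fieldType) (q t : K) (n r : nat).
Hypothesis hgen : generic q t.
Let q0 := generic_q0 hgen.
Let t0 := generic_t0 hgen.
Let hq := generic_q hgen.
Let hqt := generic_qt hgen.
Let qinj := generic_qinj hgen.

Lemma koornwinder_row_value a b c d T tau (P : laurent K n.+1) C :
  T = t ^+ 2 / q /\ tau = 1 \/ T = 1 /\ tau = q / t ^+ 2 ->
  (forall z, (1 - a * z) * (1 - b * z) * (1 - c * z) * (1 - d * z)
             = (1 - T * z ^+ 2) * (1 - q * T * z ^+ 2)) ->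
  (forall x : {ffun 'I_n.+1 -> K}, (forall i, x i != 0) ->
    leval P x = C * row_value q t tau [seq x i | i <- enum 'I_n.+1] r) ->
  (forall m, m \in msupp P -> (\sum_i `|m i| <= r)%N) ->
  P@_(int_exponent (row_partition n.+1 r)) = 1 ->
  is_koornwinder a b c d q t T (row_partition n.+1 r) P.
Proof.
move=> htype habcd lev supp top.
have htau : tau = 1 \/ tau = q / t ^+ 2 by case: htype => -[_ ->]; [left|right].
have inv : hyp_invariant P.
  apply: (leval_invariant qinj) => w x x0.
  by rewrite !lev ?(row_value_hyp_point q0 t0 hq hqt htau) //; exact: hyp_point_neq0.
split=> //; first exact: triangular_row.
move=> x hx; have x0 i : x i != 0 by case: hx => /(_ i) [].
have shift0 k : forall i, node_shift q k x i != 0.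
  move=> i; rewrite /node_shift ffunE; case: ifP => // _.
  by case: k.2; rewrite mulf_neq0 ?invr_eq0.
rewrite (koornwinder_opE _ _ _ habcd).
under eq_bigr => k _ do rewrite (lev _ (shift0 k)) (lev _ x0) -mulrBr mulrCA.
rewrite -mulr_sumr (row_value_eigen q0 t0 hq hqt qinj htype) // (lev _ x0) mulrCA.
congr (_ * (_ * _)); rewrite koornwinder_eigenvalue_row /row_eigenvalue exprS.
have T0 : T != 0.
  by case: htype => -[-> _]; rewrite ?oner_neq0 // mulf_neq0 ?invr_eq0 ?expf_neq0.
have tn0 : t ^+ n != 0 by rewrite expf_neq0.
have qr0 : q ^+ r != 0 by rewrite expf_neq0.
by field; nz.
Qed.

Lemma row_sumC_koornwinder a b c d (T := t ^+ 2 / q) :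
  (forall z, (1 - a * z) * (1 - b * z) * (1 - c * z) * (1 - d * z)
             = (1 - T * z ^+ 2) * (1 - q * T * z ^+ 2)) ->
  is_koornwinder a b c d q t T (row_partition n.+1 r) (row_sumC n.+1 r q t).
Proof.
move=> habcd; have E : row_sumC n.+1 r q t = family_laurent q t xpredT
    (fun th : row_family n.+1 r => \prod_(l < n.+1) factorC th q t l).
  by rewrite /row_sumC /family_laurent; congr (_ *: _); apply: eq_bigl => th; rewrite andbT.
apply: (@koornwinder_row_value _ _ _ _ _ 1 _ (qpoch q q r / qpoch q t r)) => //.
- by left.
- by move=> x x0; exact: leval_row_sumC.
- by rewrite E; exact: family_laurent_supp.
rewrite E; apply: family_laurent_top => //.
by apply: big1 => l _; rewrite /factorC !row_family_top_inr !qpoch0 !mulr1 divr1.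
Qed.

Lemma row_sumD_koornwinder a b c d :
  (forall z, (1 - a * z) * (1 - b * z) * (1 - c * z) * (1 - d * z)
             = (1 - 1 * z ^+ 2) * (1 - q * 1 * z ^+ 2)) ->
  is_koornwinder a b c d q t 1 (row_partition n.+1 r) (row_sumD n.+1 r q t).
Proof.
move=> habcd; have E : row_sumD n.+1 r q t = family_laurent q t (@th_last_zero _ _)
    (fun th : row_family n.+1 r => \prod_(l < n.+1 | (l.+1 < n.+1)%N) factorD th q t l) by [].
apply: (@koornwinder_row_value _ _ _ _ _ (q / t ^+ 2) _ (qpoch q q r / qpoch q t r)) => //.
- by right.
- by move=> x x0; exact: leval_row_sumD.
- by rewrite E; exact: family_laurent_supp.
rewrite E; apply: family_laurent_top => //.
  by apply/forallP => k; rewrite row_family_top_inr muln0 eqxx implybT.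
by apply: big1 => l _; rewrite /factorD !row_family_top_inr !qpoch0 !mulr1 divr1.
Qed.

End RowSumKoornwinder.

Theorem theorem1p1 (K : fieldType) (n r : nat) (q t rq rT : K)
    (hn : (1 <= n)%N) (hgen : generic q t)
    (hrq : rq ^+ 2 = q) (hrT : rT ^+ 2 = t ^+ 2 / q) :
  (forall P : laurent K n,
     is_macdonaldC q t (t ^+ 2 / q) rq rT (row_partition n r) P
     <-> P = row_sumC n r q t) /\
  (forall P : laurent K n,
     is_macdonaldD q t rq (row_partition n r) P
     <-> P = row_sumD n r q t).
Proof.
case: n hn => // n _.
have hC z : (1 - - rT * z) * (1 - rT * z) * (1 - - (rq * rT) * z) * (1 - rq * rT * z)
    = (1 - t ^+ 2 / q * z ^+ 2) * (1 - q * (t ^+ 2 / q) * z ^+ 2).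
  by move: (t ^+ 2 / q) hrT => u <-; rewrite -hrq; ring.
have hD z : (1 - -1 * z) * (1 - 1 * z) * (1 - - rq * z) * (1 - rq * z)
    = (1 - 1 * z ^+ 2) * (1 - q * 1 * z ^+ 2).
  by rewrite -hrq; ring.
split=> P; split=> [hP|->].
- apply: (@koornwinder_row_uniq K q t hgen n r 2 1 _ _ _ _ _ _ _ erefl isT isT hC hP).
  exact: row_sumC_koornwinder.
- exact: row_sumC_koornwinder.
- have E : 1 = t ^+ 0 / q ^+ 0 :> K by rewrite !expr0 divr1.
  apply: (@koornwinder_row_uniq K q t hgen n r 0 0 _ _ _ _ _ _ _ E isT isT hD hP).
  exact: row_sumD_koornwinder.
- exact: row_sumD_koornwinder.
Qed.
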